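(* Let $A$ be a finite dimensional weak $C^*$-Hopf algebra with dual $\hat A$, let $l\in\mathcal L(A)$ be a positive nondegenerate left integral and let $\lambda\in\mathcal L(\hat A)$ be its p-dual. Then: (i) $l$ is also the p-dual of $\lambda$. (ii) The indices $\mathrm{Ind}\,l$ and $\mathrm{Ind}\,\lambda$ are both positive and invertible and satisfy $$\mathrm{Ind}\,l=n_R(\lambda)\in C(\hat A)\cap\hat A_R,\qquad \mathrm{Ind}\,\lambda=n_R(l)\in C(A)\cap A_R.$$ (iii) For any $A$-module algebra $M$ the elements $e=((1_M\rtimes e_l)\rtimes\hat1)$ and $\hat e=((1_M\rtimes1)\rtimes e_\lambda)$ of $(M\rtimes A)\rtimes\hat A$ satisfy $$e^2=e\,\mathrm{Ind}\,\lambda,\qquad \hat e^2=\hat e\,\mathrm{Ind}\,l,\qquad \hat e\,e\,\hat e=\hat e,\qquad e\,\hat e\,e=e,$$ where $\mathrm{Ind}\,\lambda\in A$ and $\mathrm{Ind}\,l\in\hat A$ stand for $((1_M\rtimes\mathrm{Ind}\,\lambda)\rtimes\hat1)$ and $((1_M\rtimes1)\rtimes\mathrm{Ind}\,l)$ respectively.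
   Context: A finite dimensional weak $C^*$-Hopf algebra is a finite dimensional $C^*$-algebra $A$ (unit $1$) with linear maps $\Delta:A\to A\otimes A$, $\varepsilon:A\to\mathbb C$, $S:A\to A$ such that, for all $x,y,z\in A$ in Sweedler notation: $\Delta(xy)=\Delta(x)\Delta(y)$; $\Delta(x^* )=\Delta(x)^*$; $(\Delta\otimes\mathrm{id})\Delta=(\mathrm{id}\otimes\Delta)\Delta$; $(\Delta(1)\otimes1)(1\otimes\Delta(1))=1_{(1)}\otimes1_{(2)}\otimes1_{(3)}$; $(\varepsilon\otimes\mathrm{id})\Delta=\mathrm{id}=(\mathrm{id}\otimes\varepsilon)\Delta$; $\varepsilon(xyz)=\varepsilon(xy_{(1)})\varepsilon(y_{(2)}z)$; $S(x_{(1)})x_{(2)}=1_{(1)}\varepsilon(x1_{(2)})$; $x_{(1)}S(x_{(2)})=\varepsilon(1_{(1)}x)1_{(2)}$; $S(x_{(1)})x_{(2)}S(x_{(3)})=S(x)$. ($\Delta(1)\neq 1\otimes 1$ in general; $S$ is automatically invertible.) Put $x_*:=S(x)^*$. The dual $\hat A$ is the dual vector space with $\langle\psi\varphi|x\rangle=\langle\psi\otimes\varphi|\Delta(x)\rangle$, $\langle\hat\Delta(\psi)|x\otimes y\rangle=\langle\psi|xy\rangle$, $\hat1=\varepsilon$, $\hat\varepsilon(\psi)=\langle\psi|1\rangle$, $\langle\hat S(\psi)|x\rangle=\langle\psi|S(x)\rangle$, $\langle\psi^*|x\rangle=\overline{\langle\psi|x_*\rangle}$; it is again a finite dimensional weak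 $C^*$-Hopf algebra, with dual $A$. Canonical actions: $\langle a\rightharpoonup\varphi|b\rangle=\langle\varphi|ba\rangle$, $\langle\varphi\leftharpoonup a|b\rangle=\langle\varphi|ab\rangle$, and likewise $\varphi\rightharpoonup a=a_{(1)}\langle\varphi|a_{(2)}\rangle$, $a\leftharpoonup\varphi=\langle\varphi|a_{(1)}\rangle a_{(2)}$. $A_L=\{(\varphi\otimes\mathrm{id})(\Delta(1)):\varphi\in\hat A\}$, $A_R=\{(\mathrm{id}\otimes\varphi)(\Delta(1)):\varphi\in\hat A\}$ are unital $*$-subalgebras of $A$; $\hat A_L,\hat A_R\subset\hat A$ are defined in the same way for $\hat A$. $C(\cdot)$ denotes the center. Integrals (all notions apply equally to $\hat A$): $l\in A$ is a left integral if $al=a_{(1)}S(a_{(2)})l$ for all $a\in A$; $r\in A$ is a right integral if $ra=rS(a_{(1)})a_{(2)}$ for all $a$; $\mathcal L(A)$ is the space of left integrals. The normalized Haar integral $h\in A$ is the unique two-sided integral with $S(h_{(1)})h_{(2)}=h_{(1)}S(h_{(2)})=1$. A left integral $l$ is positive if $\langle l|\varphi^*\varphi\rangle\ge0$ for all $\varphi\in\hat A$, and nondegenerate if the bilinear form $(\varphi,\psi)\mapsto\langle l|\varphi\psi\rangle$ on $\hat A$ is nondegenerate. For $l\in\mathcal L(A)$: $n_R(l)=l_{(2)}S^{-1}(l_{(1)})$, $d_R(l)=S(l_{(1)})l_{(2)}\in A_R$ (with $d_R(l)\geq0$ if $l$ is positive). For positive $l$ put $e_l:=d_R(l)^{1/2}\,h\,d_R(l)^{1/2}\in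 A$; similarly $e_\lambda:=d_R(\lambda)^{1/2}\hat h\,d_R(\lambda)^{1/2}\in\hat A$ for positive $\lambda\in\mathcal L(\hat A)$, with $\hat h$ the normalized Haar integral of $\hat A$. The p-dual of a positive nondegenerate $l\in\mathcal L(A)$ is the unique positive nondegenerate left integral $\lambda\in\mathcal L(\hat A)$ with $\lambda\rightharpoonup e_l=1$ (it exists); p-duals of elements of $\mathcal L(\hat A)$ are defined with the roles of $A,\hat A$ exchanged. Index: for nondegenerate $l\in\mathcal L(A)$, $\mathrm{Ind}\,l\in\hat A$ is the Watatani index of $E_l:\hat A\to\hat A_L$, $\varphi\mapsto l\rightharpoonup\varphi$, i.e. $\mathrm{Ind}\,l=\sum_iu_iv_i$ for any finite quasi-basis $u_i,v_i\in\hat A$, meaning $\sum_iu_iE_l(v_i\varphi)=\varphi=\sum_iE_l(\varphi u_i)v_i$ for all $\varphi$. Analogously $\mathrm{Ind}\,\lambda\in A$ for nondegenerate $\lambda\in\mathcal L(\hat A)$. An $A$-module algebra is a unital $*$-algebra $M$ with a linear left action $\triangleright:A\otimes M\to M$ such that $(ab)\triangleright m=a\triangleright(b\triangleright m)$, $1\triangleright m=m$, $a\triangleright(mn)=(a_{(1)}\triangleright m)(a_{(2)}\triangleright n)$, $(a\triangleright m)^*=a_*\triangleright m^*$, $a\triangleright1_M=(a_{(1)}S(a_{(2)}))\triangleright1_M$. The crossed product $M\rtimes A$ is $M\otimes_{A_L}A$ (span of $(m\rtimes a)$ modulo $(m\rtimes ba)=(m(b\triangleright1_M)\rtimes a)$,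 $b\in A_L$) with $(m\rtimes a)(m'\rtimes a')=(m(a_{(1)}\triangleright m')\rtimes a_{(2)}a')$, $(m\rtimes a)^*=(1_M\rtimes a^* )(m^*\rtimes1)$. It is an $\hat A$-module algebra via $\varphi\triangleright(m\rtimes a)=(m\rtimes(\varphi\rightharpoonup a))$, which is used to form $(M\rtimes A)\rtimes\hat A$. *)

(* Defs.v *)
From HB Require Import structures.
From mathcomp Require Import all_boot all_order all_algebra all_field.
From mathcomp Require Import complex boolp classical_sets reals.

Set Implicit Arguments.
Unset Strict Implicit.
Unset Printing Implicit Defensive.
Import Order.TTheory GRing.Theory Num.Theory.
Local Open Scope ring_scope.

Reserved Notation "a ⊗ b" (at level 35, right associativity).
Reserved Notation "m ⋊ a" (at level 40, left associativity).
Reserved Notation "\sw ( a , b <- x ) E"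
  (at level 41, a name, b name, x at level 200, E at level 41,
   format "'[' \sw ( a ,  b  <-  x ) '/  '  E ']'").

Section Tensor.
Variable R : realType.
Local Notation C := R[i].

Definition bas (A : vectType C) (i : 'I_(\dim {:A})) : A := (vbasis {:A})`_i.

Definition crd (A : vectType C) (i : 'I_(\dim {:A})) (a : A) : C :=
  coord (vbasis {:A}) i a.

(* A ⊗ B for finite dimensional A and B: the matrix t represents
   \sum_(i, j) t i j *: (bas i ⊗ bas j). *)
Definition tens (A B : vectType C) : vectType C :=
  'M[C]_(\dim {:A}, \dim {:B}).

Definition tensor (A B : vectType C) (a : A) (b : B) : tens A B :=
  \matrix_(i, j) (crd i a * crd j b).

(* The linear map induced on A ⊗ B by a bilinear map f; it is only meaningful
   for bilinear f. *)
Definition tlift (A B : vectType C) (V : lmodType C) (f : A -> B -> V)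
    (t : tens A B) : V :=
  \sum_i \sum_j (t : 'M_(_, _)) i j *: f (bas i) (bas j).

Definition antilinear (V W : lmodType C) (f : V -> W) :=
  forall (c : C) (x y : V), f (c *: x + y) = c^* *: f x + f y.

End Tensor.

Notation "a ⊗ b" := (tensor a b) : ring_scope.

(* Finite dimensional algebras that are also coalgebras and carry a linear map
   S and an antilinear map *, without any compatibility requirement. This
   structure is inherited by the dual space, so that each notion below is
   defined once and can be used both for an algebra and for its dual. *)
HB.mixin Record isPreWeakHopf (R : realType) A of Falgebra R[i] A := {
  comul : 'Hom(A, tens A A);
  counit : 'Hom(A, R[i]^o);
  antipode : 'End(A);
  star : A -> A;
  comulA : forall x : A,
    tlift (fun a b : A =>
      tlift (fun c d : A => c ⊗ (d ⊗ b)) (comul a)) (comul x) =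
    tlift (fun a b : A => a ⊗ comul b) (comul x);
  counitl : forall x : A, tlift (fun a b : A => counit a *: b) (comul x) = x;
  counitr : forall x : A, tlift (fun a b : A => counit b *: a) (comul x) = x;
  star_antilinear : antilinear star
}.

#[short(type="preWeakHopfType")]
HB.structure Definition PreWeakHopf (R : realType) :=
  { A of Falgebra R[i] A & isPreWeakHopf R A }.

(* Sweedler notation: \sw(a, b <- x) E is E[x_(1), x_(2)], for E bilinear in
   a and b. *)
Notation "\sw ( a , b <- x ) E" :=
  (tlift (fun a b => E) (comul x)) : ring_scope.

(* The * of A ⊗ A; the coefficients have to be conjugated because
   (a, b) |-> star a ⊗ star b is not bilinear. *)
Definition tstar (R : realType) (A : preWeakHopfType R) (t : tens A A) :
    tens A A :=
  tlift (fun a b : A => star a ⊗ star b)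
    (map_mx Num.conj (t : 'M[R[i]]_(_, _))).

(* Completeness of the C*-norm N is automatic in finite dimension. *)
HB.mixin Record isWeakCstarHopf (R : realType) A of PreWeakHopf R A := {
  starK : involutive (star : A -> A);
  starM : forall x y : A, star (x * y) = star y * star x;
  cstar_norm : exists N : A -> R,
    [/\ forall x, N x = 0 -> x = 0,
        forall x y, N (x + y) <= N x + N y,
        forall (c : R[i]) x, (N (c *: x))%:C%C = `|c| * (N x)%:C%C,
        forall x y, N (x * y) <= N x * N y
      & forall x, N (star x * x) = N x ^+ 2];
  comulM : forall x y : A,
    comul (x * y) =
    \sw(x1, x2 <- x) \sw(y1, y2 <- y) (x1 * y1) ⊗ (x2 * y2);
  comul_star : forall x : A, comul (star x) = tstar (comul x);
  comul1 :
    \sw(a, b <- (1 : A)) \sw(c, d <- (1 : A)) a ⊗ ((b * c) ⊗ d) =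
    \sw(a, b <- (1 : A)) a ⊗ comul b;
  counitM : forall x y z : A,
    counit (x * y * z) =
    \sw(y1, y2 <- y) (counit (x * y1) * counit (y2 * z) : R[i]^o);
  antipodel : forall x : A,
    \sw(x1, x2 <- x) (antipode x1 * x2) =
    \sw(a, b <- (1 : A)) (counit (x * b) *: a);
  antipoder : forall x : A,
    \sw(x1, x2 <- x) (x1 * antipode x2) =
    \sw(a, b <- (1 : A)) (counit (a * x) *: b);
  antipodeS : forall x : A,
    \sw(x1, y <- x) \sw(x2, x3 <- y) (antipode x1 * x2 * antipode x3) =
    antipode x
}.

#[short(type="weakCstarHopfType")]
HB.structure Definition WeakCstarHopf (R : realType) :=
  { A of PreWeakHopf R A & isWeakCstarHopf R A }.

Section TensorTheory.
Variable R : realType.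
Local Notation C := R[i].

Lemma crd_is_linear (A : vectType C) i : linear (@crd R A i : A -> C^o).
Proof. by move=> c x y; rewrite /crd linearP. Qed.

HB.instance Definition _ (A : vectType C) i :=
  GRing.isLinear.Build C A C^o _ (@crd R A i) (@crd_is_linear A i).

Lemma crd_sum (A : vectType C) (a : A) : a = \sum_i crd i a *: bas i.
Proof. exact: coord_vbasis (memvf a). Qed.

Lemma crd_bas (A : vectType C) i j : crd i (bas j : A) = (j == i)%:R.
Proof. by rewrite /crd /bas coord_free ?(basis_free (vbasisP _)). Qed.

Lemma tlift_is_linear (A B : vectType C) (V : lmodType C) (f : A -> B -> V) :
  linear (tlift f).
Proof.
move=> c s t; rewrite /tlift scaler_sumr -big_split; apply: eq_bigr => i _ /=.
rewrite scaler_sumr -big_split; apply: eq_bigr => j _ /=.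
by rewrite !mxE scalerDl scalerA.
Qed.

HB.instance Definition _ (A B : vectType C) (V : lmodType C)
    (f : A -> B -> V) :=
  GRing.isLinear.Build C (tens A B) V _ (tlift f) (tlift_is_linear f).

Lemma eq_tlift (A B : vectType C) (V : lmodType C) (f g : A -> B -> V) t :
  (forall a b, f a b = g a b) -> tlift f t = tlift g t.
Proof.
by move=> fg; apply: eq_bigr => i _; apply: eq_bigr => j _; rewrite fg.
Qed.

Lemma linear_tlift (A B : vectType C) (V W : lmodType C) (L : V -> W)
    (f : A -> B -> V) t :
  linear L -> L (tlift f t) = tlift (fun a b => L (f a b)) t.
Proof.
move=> linL.
pose L' := HB.pack_for {linear V -> W} L (GRing.isLinear.Build _ _ _ _ _ linL).
rewrite /tlift -[L]/(L' : V -> W) linear_sum; apply: eq_bigr => i _.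
by rewrite linear_sum; apply: eq_bigr => j _; rewrite linearZ.
Qed.

Lemma linear_sumZ (V W : lmodType C) (L : V -> W) (I : finType)
    (c : I -> C) (v : I -> V) :
  linear L -> L (\sum_i c i *: v i) = \sum_i c i *: L (v i).
Proof.
move=> linL.
pose L' := HB.pack_for {linear V -> W} L (GRing.isLinear.Build _ _ _ _ _ linL).
rewrite -[L]/(L' : V -> W) linear_sum; apply: eq_bigr => i _.
by rewrite linearZ.
Qed.

Lemma tlift_tensor (A B : vectType C) (V : lmodType C) (f : A -> B -> V) a b :
  (forall y, linear (f^~ y)) -> (forall x, linear (f x)) ->
  tlift f (a ⊗ b) = f a b.
Proof.
move=> f1 f2; rewrite {2}[a]crd_sum (linear_sumZ _ _ (f1 _)).
apply: eq_bigr => i _; rewrite {2}[b]crd_sum (linear_sumZ _ _ (f2 _)).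
rewrite scaler_sumr; apply: eq_bigr => j _.
by rewrite mxE scalerA.
Qed.

Lemma tensor_linearl (A B : vectType C) (b : B) :
  linear (fun a : A => a ⊗ b).
Proof.
by move=> c x y; apply/matrixP => i j; rewrite !mxE linearP /= mulrDl mulrA.
Qed.

Lemma tensor_linearr (A B : vectType C) (a : A) :
  linear (fun b : B => a ⊗ b).
Proof.
move=> c x y; apply/matrixP => i j; rewrite !mxE linearP /= mulrDr.
by rewrite [in X in X + _]mulrCA.
Qed.

HB.instance Definition _ (A B : vectType C) (a : A) :=
  GRing.isLinear.Build C B (tens A B) _ (tensor a) (@tensor_linearr A B a).

End TensorTheory.

Definition dual (R : realType) (A : preWeakHopfType R) : Type :=
  'Hom(A, R[i]^o).

HB.instance Definition _ (R : realType) (A : preWeakHopfType R) :=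
  Vector.copy (dual A) 'Hom(A, R[i]^o).

Section LinearFunctions.
Variable R : realType.
Local Notation C := R[i].

Lemma linear_linfun (V W : vectType C) (f : V -> W) x :
  linear f -> linfun f x = f x.
Proof.
move=> linf.
pose f' := HB.pack_for {linear V -> W} f (GRing.isLinear.Build _ _ _ _ _ linf).
exact: (lfunE f').
Qed.

Lemma linear_mull (V : lmodType C) (f : V -> C^o) (k : C) :
  linear f -> linear (fun x => (f x : C) * k : C^o).
Proof. by move=> linf c x y; rewrite linf mulrDl -scalerAl. Qed.

Lemma linear_mulr (V : lmodType C) (f : V -> C^o) (k : C) :
  linear f -> linear (fun x => k * (f x : C) : C^o).
Proof. by move=> linf c x y; rewrite linf mulrDr; congr (_ + _); apply: mulrCA. Qed.

Lemma linear_scale (V W : lmodType C) (f : V -> C^o) (w : W) :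
  linear f -> linear (fun x => (f x : C) *: w).
Proof. by move=> linf c x y; rewrite linf scalerDl scalerA. Qed.

Lemma linear_comp (U V W : lmodType C) (f : V -> W) (g : U -> V) :
  linear f -> linear g -> linear (fun x => f (g x)).
Proof. by move=> linf ling c x y; rewrite ling linf. Qed.

Lemma linear_scaler (V W : lmodType C) (k : C) (f : V -> W) :
  linear f -> linear (fun x => k *: f x).
Proof.
by move=> linf c x y; rewrite linf scalerDr !scalerA mulrC.
Qed.

Lemma linear_sumf (V W : lmodType C) (I : finType) (f : I -> V -> W) :
  (forall i, linear (f i)) -> linear (fun x => \sum_i f i x).
Proof.
move=> linf c x y; rewrite scaler_sumr -big_split; apply: eq_bigr => i _ /=.
exact: linf.
Qed.

Lemma linear_tliftf (A B : vectType C) (V W : lmodType C) (f : V -> A -> B -> W)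
    t :
  (forall a b, linear (fun v => f v a b)) -> linear (fun v => tlift (f v) t).
Proof.
move=> linf; apply: linear_sumf => i; apply: linear_sumf => j.
exact: linear_scaler.
Qed.

Lemma linear_lfun (V W : vectType C) (f : 'Hom(V, W)) : linear f.
Proof. exact: linearP. Qed.

End LinearFunctions.

Section DualAlgebra.
Variables (R : realType) (A : preWeakHopfType R).
Local Notation C := R[i].
Implicit Types (phi psi : dual A) (a b x y : A).

Definition pairing phi a : C := (phi : 'Hom(A, C^o)) a.

Lemma pairing_linearl a : linear (fun phi : dual A => pairing phi a : C^o).
Proof. by move=> c f g; rewrite /pairing add_lfunE scale_lfunE. Qed.

Lemma pairing_linearr phi : linear (pairing phi : A -> C^o).
Proof. by move=> c x y; rewrite /pairing linearP. Qed.

Lemma dualP phi psi : pairing phi =1 pairing psi -> phi = psi.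
Proof. by move=> eq_pp; apply/lfunP. Qed.

Definition dual_mul psi phi : dual A :=
  linfun (fun x : A => \sw(x1, x2 <- x) (pairing psi x1 * pairing phi x2 : C^o)).

Definition dual_one : dual A := counit.

Lemma dual_mulE psi phi x :
  pairing (dual_mul psi phi) x =
  \sw(x1, x2 <- x) (pairing psi x1 * pairing phi x2 : C^o).
Proof. by rewrite /pairing linear_linfun// => c y z; rewrite !linearP. Qed.

Fact dual_mulA : associative dual_mul.
Proof.
move=> f g h; apply: dualP => x; rewrite !dual_mulE.
pose G : tens A (tens A A) -> C^o :=
  tlift (fun (a : A) (s : tens A A) =>
    pairing f a * (tlift (fun b c : A => pairing g b * pairing h c : C^o) s : C) : C^o).
have linG : linear G by apply: tlift_is_linear.
have G1E a s : G (a ⊗ s) =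
    pairing f a * (tlift (fun b c : A => pairing g b * pairing h c : C^o) s : C).
  rewrite /G tlift_tensor//.
  - by move=> y; apply: linear_mull; apply: pairing_linearr.
  - by move=> y; apply: linear_mulr; apply: tlift_is_linear.
have G2E a b c : G (a ⊗ (b ⊗ c)) = pairing f a * (pairing g b * pairing h c).
  rewrite G1E tlift_tensor//.
  - by move=> y; apply: linear_mull; apply: pairing_linearr.
  - by move=> y; apply: linear_mulr; apply: pairing_linearr.
have := congr1 G (comulA x).
rewrite 2!(linear_tlift _ _ linG) => GA.
transitivity (tlift (fun a b : A => G (a ⊗ comul b)) (comul x)).
  by apply: eq_tlift => a b; rewrite G1E dual_mulE.
rewrite -GA; apply: eq_tlift => a b.
rewrite dual_mulE (linear_tlift _ _ linG).
have linh : linear (fun y : C^o => (y : C) * pairing h b : C^o).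
  by apply: linear_mull => c u v.
rewrite (linear_tlift _ _ linh).
by apply: eq_tlift => c d; rewrite G2E mulrA.
Qed.

Fact dual_mul1l : left_id dual_one dual_mul.
Proof.
move=> f; apply: dualP => x; rewrite dual_mulE -{2}[x]counitl.
rewrite (linear_tlift _ _ (pairing_linearr f)); apply: eq_tlift => a b.
by rewrite /pairing linearZ.
Qed.

Fact dual_mul1r : right_id dual_one dual_mul.
Proof.
move=> f; apply: dualP => x; rewrite dual_mulE -{2}[x]counitr.
rewrite (linear_tlift _ _ (pairing_linearr f)); apply: eq_tlift => a b.
by rewrite /pairing linearZ mulrC.
Qed.

Fact dual_mulDl : left_distributive dual_mul +%R.
Proof.
move=> f g h; apply: dualP => x.
rewrite {2}/pairing add_lfunE -!/(pairing _ _) !dual_mulE -big_split.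
apply: eq_bigr => i _; rewrite -big_split; apply: eq_bigr => j _ /=.
by rewrite -scalerDr -mulrDl /pairing add_lfunE.
Qed.

Fact dual_mulDr : right_distributive dual_mul +%R.
Proof.
move=> f g h; apply: dualP => x.
rewrite {2}/pairing add_lfunE -!/(pairing _ _) !dual_mulE -big_split.
apply: eq_bigr => i _; rewrite -big_split; apply: eq_bigr => j _ /=.
by rewrite -scalerDr -mulrDr /pairing add_lfunE.
Qed.

Fact dual_1neq0 : dual_one != 0.
Proof.
apply/eqP => e0; have := oner_neq0 A; rewrite -[X in X != _]counitl.
rewrite /tlift big1 ?eqxx// => i _; rewrite big1// => j _.
have -> : counit (bas i : A) = 0 by rewrite -[counit]/dual_one e0 zero_lfunE.
by rewrite scale0r scaler0.
Qed.

HB.instance Definition _ :=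
  GRing.Zmodule_isNzRing.Build (dual A) dual_mulA dual_mul1l dual_mul1r
    dual_mulDl dual_mulDr dual_1neq0.

Fact dual_scaleAl (c : C) psi phi : c *: (psi * phi) = (c *: psi) * phi.
Proof.
apply: dualP => x; rewrite /pairing scale_lfunE -!/(pairing _ _) !dual_mulE.
rewrite scaler_sumr; apply: eq_bigr => i _.
rewrite scaler_sumr; apply: eq_bigr => j _.
rewrite scalerA mulrC -scalerA /pairing scale_lfunE.
by congr (_ *: _); apply: mulrA.
Qed.

HB.instance Definition _ :=
  GRing.Lmodule_isLalgebra.Build C (dual A) dual_scaleAl.

Fact dual_scaleAr (c : C) psi phi : c *: (psi * phi) = psi * (c *: phi).
Proof.
apply: dualP => x; rewrite /pairing scale_lfunE -!/(pairing _ _) !dual_mulE.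
rewrite scaler_sumr; apply: eq_bigr => i _.
rewrite scaler_sumr; apply: eq_bigr => j _.
rewrite scalerA mulrC -scalerA /pairing scale_lfunE.
by congr (_ *: _); apply: mulrCA.
Qed.

HB.instance Definition _ :=
  GRing.Lalgebra_isAlgebra.Build C (dual A) dual_scaleAr.

HB.instance Definition _ := Algebra_isFalgebra.Build C (dual A).

End DualAlgebra.

Section DualCoalgebra.
Variables (R : realType) (A : preWeakHopfType R).
Local Notation C := R[i].
Implicit Types (phi psi : dual A) (a b x y : A).

Lemma dualME psi phi x :
  pairing (psi * phi) x =
  \sw(x1, x2 <- x) (pairing psi x1 * pairing phi x2 : C^o).
Proof. exact: dual_mulE. Qed.

Lemma dual1E x : pairing (1 : dual A) x = counit x.
Proof. by []. Qed.

Definition dual_bas i : dual A := linfun (crd i : A -> C^o).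

Lemma dual_basE i x : pairing (dual_bas i) x = crd i x.
Proof. by rewrite /pairing linear_linfun//; apply: linearP. Qed.

(* The element of the tensor square of the dual that corresponds to the
   bilinear form (x, y) |-> psi (x * y). *)
Definition dual_comul_fun psi : tens (dual A) (dual A) :=
  \sum_i \sum_j pairing psi (bas i * bas j) *: (dual_bas i ⊗ dual_bas j).

Definition dual_comul : 'Hom(dual A, tens (dual A) (dual A)) :=
  linfun dual_comul_fun.

Definition dual_counit : 'Hom(dual A, C^o) :=
  linfun (fun psi : dual A => pairing psi 1 : C^o).

Definition dual_antipode : 'End(dual A) :=
  linfun (fun psi : dual A => (psi \o antipode)%VF : dual A).

Definition lower_star x : A := star (antipode x).

Definition dual_star psi : dual A :=
  linfun (fun x : A => (pairing psi (lower_star x))^* : C^o).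

Lemma dual_comul_lift (V : lmodType C) (f : dual A -> dual A -> V) psi :
  (forall h, linear (f^~ h)) -> (forall g, linear (f g)) ->
  tlift f (dual_comul psi) =
  \sum_i \sum_j pairing psi (bas i * bas j) *: f (dual_bas i) (dual_bas j).
Proof.
move=> f1 f2; rewrite /dual_comul linear_linfun; last first.
  apply: linear_sumf => i; apply: linear_sumf => j.
  by apply: linear_scale; apply: pairing_linearl.
rewrite /dual_comul_fun linear_sum; apply: eq_bigr => i _.
rewrite linear_sum; apply: eq_bigr => j _.
by rewrite linearZ /= tlift_tensor.
Qed.

Lemma dual_comulE psi x y :
  tlift (fun f g : dual A => pairing f x * pairing g y : C^o) (dual_comul psi)
  = pairing psi (x * y).
Proof.
rewrite dual_comul_lift; last 2 first.
- by move=> f; apply: linear_mull; apply: pairing_linearl.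
- by move=> f; apply: linear_mulr; apply: pairing_linearl.
rewrite {2}[x]crd_sum mulr_suml.
rewrite -[pairing psi]/((psi : 'Hom(A, C^o)) : A -> C^o) linear_sum.
apply: eq_bigr => i _; rewrite {2}[y]crd_sum mulr_sumr linear_sum.
apply: eq_bigr => j _; rewrite -scalerAl -scalerAr !linearZ /= !dual_basE.
by congr (_ *: _); apply: mulrC.
Qed.

Lemma dual_counitE psi : dual_counit psi = pairing psi 1.
Proof. by rewrite linear_linfun//; apply: pairing_linearl. Qed.

Lemma dual_antipodeE psi x :
  pairing (dual_antipode psi) x = pairing psi (antipode x).
Proof.
rewrite /dual_antipode linear_linfun /pairing ?comp_lfunE// => c f g.
by apply/lfunP => z; rewrite !(comp_lfunE, add_lfunE, scale_lfunE).
Qed.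

Lemma dual_starE psi x :
  pairing (dual_star psi) x = (pairing psi (lower_star x))^*.
Proof.
rewrite {1}/pairing linear_linfun// => c y z.
rewrite /lower_star linearP star_antilinear pairing_linearr.
by rewrite rmorphD /= rmorphM /= conjCK.
Qed.

Lemma dual_bas_sum psi : psi = \sum_i pairing psi (bas i) *: dual_bas i.
Proof.
apply: dualP => x; rewrite {1}[x]crd_sum /pairing linear_sum /= sum_lfunE.
apply: eq_bigr => i _; rewrite linearZ scale_lfunE -/(pairing _ _).
rewrite -[dual_bas i x]/(pairing _ _) dual_basE.
exact: mulrC.
Qed.

Fact dual_comulA psi :
  tlift (fun f g : dual A =>
    tlift (fun h k : dual A => h ⊗ (k ⊗ g)) (dual_comul f)) (dual_comul psi) =
  tlift (fun f g : dual A => f ⊗ dual_comul g) (dual_comul psi).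
Proof.
have lindc : linear dual_comul by apply: linear_lfun.
rewrite dual_comul_lift; last 2 first.
- by move=> g c u v; rewrite !linearP.
- move=> f; apply: linear_tliftf => a b.
  by apply: (linear_comp (f := tensor a) (g := tensor b));
    apply: tensor_linearr.
rewrite dual_comul_lift; last 2 first.
- by move=> g; apply: tensor_linearl.
- by move=> f; apply: linear_comp (@tensor_linearr _ _ _ f) lindc.
pose T i j k := dual_bas i ⊗ (dual_bas j ⊗ dual_bas k).
pose c i j k := pairing psi (bas i * bas j * bas k).
transitivity (\sum_i \sum_j \sum_k c i j k *: T i j k).
  transitivity (\sum_m \sum_k \sum_i \sum_j
      (pairing psi (bas m * bas k) * crd m (bas i * bas j)) *: T i j k).
    apply: eq_bigr => m _; apply: eq_bigr => k _.
    rewrite dual_comul_lift; last 2 first.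
    - by move=> f; apply: tensor_linearl.
    - move=> f; apply: (linear_comp (f := tensor f) (g := fun h => h ⊗ _)).
        exact: tensor_linearr.
      exact: tensor_linearl.
    rewrite scaler_sumr; apply: eq_bigr => i _.
    rewrite scaler_sumr; apply: eq_bigr => j _.
    by rewrite scalerA dual_basE.
  rewrite exchange_big /=.
  transitivity (\sum_k \sum_i \sum_j c i j k *: T i j k).
    apply: eq_bigr => k _; rewrite exchange_big; apply: eq_bigr => i _.
    rewrite exchange_big; apply: eq_bigr => j _.
    rewrite -scaler_suml; congr (_ *: _).
    rewrite /c [bas i * bas j in RHS]crd_sum mulr_suml.
    rewrite -[pairing psi]/((psi : 'Hom(A, C^o)) : A -> C^o) linear_sum.
    apply: eq_bigr => m _; rewrite -scalerAl linearZ; exact: mulrC.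
  rewrite exchange_big; apply: eq_bigr => i _; rewrite exchange_big.
  exact: eq_bigr.
rewrite [RHS]exchange_big /=.
have -> : \sum_j \sum_i pairing psi (bas i * bas j) *:
      (dual_bas i ⊗ dual_comul (dual_bas j)) =
    \sum_m \sum_i \sum_j \sum_k
      (pairing psi (bas i * bas m) * crd m (bas j * bas k)) *: T i j k.
  apply: eq_bigr => m _; apply: eq_bigr => i _.
  have -> : dual_comul (dual_bas m) = dual_comul_fun (dual_bas m).
    rewrite /dual_comul linear_linfun//.
    apply: linear_sumf => a; apply: linear_sumf => b.
    by apply: linear_scale; apply: pairing_linearl.
  rewrite linear_sum scaler_sumr.
  apply: eq_bigr => j _; rewrite linear_sum scaler_sumr.
  by apply: eq_bigr => k _; rewrite linearZ scalerA dual_basE.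
rewrite [RHS]exchange_big; apply: eq_bigr => i _.
rewrite [RHS]exchange_big; apply: eq_bigr => j _.
rewrite [RHS]exchange_big; apply: eq_bigr => k _.
rewrite -scaler_suml; congr (_ *: _).
rewrite /c -mulrA [bas j * bas k in LHS]crd_sum mulr_sumr.
rewrite -[pairing psi]/((psi : 'Hom(A, C^o)) : A -> C^o) linear_sum.
by apply: eq_bigr => m _; rewrite -scalerAr linearZ; apply: mulrC.
Qed.

Fact dual_counitl psi :
  tlift (fun f g : dual A => dual_counit f *: g) (dual_comul psi) = psi.
Proof.
rewrite dual_comul_lift; last 2 first.
- by move=> f; apply: linear_scale; apply: linear_lfun.
- by move=> f c g h; rewrite scalerDr !scalerA mulrC.
rewrite exchange_big {2}[psi]dual_bas_sum; apply: eq_bigr => j _ /=.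
under eq_bigr do rewrite scalerA.
rewrite -scaler_suml; congr (_ *: _).
rewrite -[bas j in RHS]mul1r [1 in RHS]crd_sum mulr_suml.
rewrite -[pairing psi]/((psi : 'Hom(A, C^o)) : A -> C^o) linear_sum.
apply: eq_bigr => m _; rewrite -scalerAl linearZ dual_counitE dual_basE.
exact: mulrC.
Qed.

Fact dual_counitr psi :
  tlift (fun f g : dual A => dual_counit g *: f) (dual_comul psi) = psi.
Proof.
rewrite dual_comul_lift; last 2 first.
- by move=> f c g h; rewrite scalerDr !scalerA mulrC.
- by move=> f; apply: linear_scale; apply: linear_lfun.
rewrite {2}[psi]dual_bas_sum; apply: eq_bigr => j _ /=.
under eq_bigr do rewrite scalerA.
rewrite -scaler_suml; congr (_ *: _).
rewrite -[bas j in RHS]mulr1 [1 in RHS]crd_sum mulr_sumr.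
rewrite -[pairing psi]/((psi : 'Hom(A, C^o)) : A -> C^o) linear_sum.
apply: eq_bigr => m _; rewrite -scalerAr linearZ dual_counitE dual_basE.
exact: mulrC.
Qed.

Fact dual_star_antilinear : antilinear dual_star.
Proof.
move=> c f g; apply: dualP => x; rewrite dual_starE /pairing.
rewrite !(add_lfunE, scale_lfunE) -!/(pairing _ _) !dual_starE.
by rewrite rmorphD /= rmorphM.
Qed.

HB.instance Definition _ :=
  isPreWeakHopf.Build R (dual A) dual_antipode dual_comulA dual_counitl
    dual_counitr dual_star_antilinear.

End DualCoalgebra.

Section Integrals.
Variables (R : realType) (A : preWeakHopfType R).
Local Notation C := R[i].
Local Open Scope classical_set_scope.
Implicit Types (phi psi lambda : dual A) (a b l r h x : A).

(* a ⇀ phi *)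
Definition act_dual a phi : dual A := (phi \o amulr a)%VF.

Lemma act_dualE a phi b : pairing (act_dual a phi) b = pairing phi (b * a).
Proof. by rewrite /pairing comp_lfunE lfunE. Qed.

(* phi ⇀ a *)
Definition dual_act phi a : A := \sw(a1, a2 <- a) (pairing phi a2 *: a1).

Definition left_subalg : set A :=
  [set b | exists phi, b = \sw(x, y <- (1 : A)) (pairing phi x *: y)].

Definition right_subalg : set A :=
  [set b | exists phi, b = \sw(x, y <- (1 : A)) (pairing phi y *: x)].

Definition left_integral l :=
  forall a, a * l = (\sw(a1, a2 <- a) (a1 * antipode a2)) * l.

Definition right_integral r :=
  forall a, r * a = r * (\sw(a1, a2 <- a) (antipode a1 * a2)).

Definition normalized_haar h :=
  [/\ left_integral h, right_integral h,
      \sw(h1, h2 <- h) (antipode h1 * h2) = 1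
    & \sw(h1, h2 <- h) (h1 * antipode h2) = 1].

Definition haar : A := xget 0 [set h | normalized_haar h].

Definition positive_integral l :=
  left_integral l /\ forall phi, 0 <= pairing (star phi * phi) l.

Definition nondegenerate_integral l :=
  (forall phi, (forall psi, pairing (phi * psi) l = 0) -> phi = 0) /\
  (forall psi, (forall phi, pairing (phi * psi) l = 0) -> psi = 0).

Definition n_R l : A :=
  \sw(l1, l2 <- l) (l2 * (antipode^-1)%VF l1).

Definition d_R l : A := \sw(l1, l2 <- l) (antipode l1 * l2).

Definition positive_element x := exists y, x = star y * y.

Definition psqrt x : A := xget 0 [set s | positive_element s /\ s * s = x].

Definition e_of l : A := psqrt (d_R l) * haar * psqrt (d_R l).

End Integrals.

Definition is_p_dual (R : realType) (A : preWeakHopfType R) (l : A)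
    (lambda : dual A) :=
  unique (fun lambda' : dual A =>
    [/\ positive_integral lambda', nondegenerate_integral lambda'
      & dual_act lambda' (e_of l) = 1]) lambda.

Section Index.
Variables (R : realType) (B : falgType R[i]).
Local Open Scope classical_set_scope.

Definition quasi_basis (E : B -> B) (uv : seq (B * B)) :=
  forall x, \sum_(p <- uv) p.1 * E (p.2 * x) = x /\
            \sum_(p <- uv) E (x * p.1) * p.2 = x.

(* The value does not depend on the chosen quasi-basis; it is 0 if there is
   none. *)
Definition watatani_index (E : B -> B) : B :=
  \sum_(p <- xget [::] [set uv | quasi_basis E uv]) p.1 * p.2.

End Index.

Section PairIndex.
Variables (R : realType) (A : preWeakHopfType R).

Definition Ind (l : A) : dual A := watatani_index (act_dual l).

Definition dual_Ind (lambda : dual A) : A := watatani_index (dual_act lambda).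

(* The canonical map from A to its bidual, which identifies A with the dual of
   its dual. *)
Definition bidual (a : A) : dual (dual A) :=
  linfun (fun phi : dual A => pairing phi a : R[i]^o).

Lemma bidualE a phi : pairing (bidual a) phi = pairing phi a.
Proof. by rewrite {1}/pairing linear_linfun//; apply: pairing_linearl. Qed.

End PairIndex.

(* A complex vector space with a product, a unit, a * and a map
   A × M -> M; the axioms are in is_module_algebra. *)
Record modAlg (R : realType) (A : preWeakHopfType R) := ModAlg {
  carrier :> lmodType R[i];
  mmul : carrier -> carrier -> carrier;
  mone : carrier;
  mstar : carrier -> carrier;
  mact : A -> carrier -> carrier
}.

Arguments mone {R A} _.

Record is_module_algebra (R : realType) (A : preWeakHopfType R)
    (M : modAlg A) : Prop := IsModuleAlgebra {
  mmulA : associative (@mmul _ _ M);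
  mmul1l : left_id (mone M) (@mmul _ _ M);
  mmul1r : right_id (mone M) (@mmul _ _ M);
  mmul_linearl : forall n : M, linear (fun m : M => mmul m n);
  mmul_linearr : forall m : M, linear (fun n : M => mmul m n);
  mstar_antilinear : antilinear (@mstar _ _ M);
  mstarK : involutive (@mstar _ _ M);
  mstarM : forall m n : M, mstar (mmul m n) = mmul (mstar n) (mstar m);
  mact_linearl : forall m : M, linear (fun a : A => mact a m);
  mact_linearr : forall a : A, linear (fun m : M => mact a m);
  mactA : forall (a b : A) (m : M), mact (a * b) m = mact a (mact b m);
  mact1 : forall m : M, mact 1 m = m;
  mactM : forall (a : A) (m n : M),
    mact a (mmul m n) = \sw(a1, a2 <- a) (mmul (mact a1 m) (mact a2 n));
  mact_star : forall (a : A) (m : M),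
    mstar (mact a m) = mact (lower_star a) (mstar m);
  mact_one : forall a : A,
    mact a (mone M) = mact (\sw(a1, a2 <- a) (a1 * antipode a2)) (mone M)
}.

Section CrossedProduct.
Variables (R : realType) (A : preWeakHopfType R) (M : modAlg A).
Local Notation C := R[i].

(* M ⊗ A over C: t represents \sum_i t i ⊗ bas i. *)
Definition mtens : lmodType C := {ffun 'I_(\dim {:A}) -> M}.

Definition mtensor (m : M) (a : A) : mtens := [ffun i => crd i a *: m].

Definition mlift (V : lmodType C) (f : M -> A -> V) (t : mtens) : V :=
  \sum_i f ((t : {ffun _ -> M}) i) (bas i).

Inductive balancing : mtens -> Prop :=
| Balancing0 : balancing 0
| BalancingD c s t : balancing s -> balancing t -> balancing (c *: s + t)
| BalancingG m b a : left_subalg b ->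
    balancing (mtensor m (b * a) - mtensor (mmul m (mact b (mone M))) a).

Definition balancing_pred : {pred mtens} := [pred t | `[< balancing t >]].

Lemma balancingP t : reflect (balancing t) (t \in balancing_pred).
Proof. exact: asboolP. Qed.

Fact balancing_zmod_closed : zmod_closed balancing_pred.
Proof.
split=> [|s t /balancingP bs /balancingP bt]; apply/balancingP.
  exact: Balancing0.
by rewrite addrC -scaleN1r; apply: BalancingD.
Qed.

HB.instance Definition _ :=
  GRing.isZmodClosed.Build mtens balancing_pred balancing_zmod_closed.

(* M ⊗ A over the left subalgebra of A. *)
Definition crossed_space : Type := Quotient.quot balancing_pred.

HB.instance Definition _ := GRing.Zmodule.on crossed_space.

Definition proj (t : mtens) : crossed_space :=
  \pi_(Quotient.quot balancing_pred)%qT t.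

Lemma projK (x : crossed_space) : proj (repr x) = x.
Proof. exact: reprK. Qed.

Lemma projE s t : proj s = proj t <-> balancing (s - t).
Proof.
split=> [st|/balancingP st].
  by apply/balancingP; rewrite Quotient.idealrBE; apply/eqP.
by apply/eqP; rewrite -Quotient.idealrBE.
Qed.

Lemma projD s t : proj (s + t) = proj s + proj t.
Proof. exact: raddfD. Qed.

Definition crossed_scale (c : C) (x : crossed_space) : crossed_space :=
  proj (c *: repr x).

Lemma projZ c t : proj (c *: t) = crossed_scale c (proj t).
Proof.
apply/projE; rewrite -scalerBr -[X in balancing X]addr0.
by apply: BalancingD; [apply/projE; rewrite projK|apply: Balancing0].
Qed.

Fact crossed_scaleA c d x :
  crossed_scale c (crossed_scale d x) = crossed_scale (c * d) x.
Proof. by rewrite -[x]projK -!projZ scalerA. Qed.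

Fact crossed_scale1 : left_id 1 crossed_scale.
Proof. by move=> x; rewrite -[x]projK -projZ scale1r. Qed.

Fact crossed_scaleDr : right_distributive crossed_scale +%R.
Proof.
move=> c x y; rewrite -[x]projK -[y]projK -projD -!projZ.
by rewrite scalerDr projD.
Qed.

Fact crossed_scaleDl x : {morph crossed_scale^~ x : c d / c + d}.
Proof. by move=> c d; rewrite -[x]projK -!projZ scalerDl projD. Qed.

HB.instance Definition _ := GRing.Zmodule_isLmodule.Build C crossed_space
  crossed_scaleA crossed_scale1 crossed_scaleDr crossed_scaleDl.

Definition crossed (m : M) (a : A) : crossed_space := proj (mtensor m a).

(* The product, the * and the action of the dual are computed on
   representatives; for a module algebra M over a weak C*-Hopf algebra A they
   do not depend on the representatives. *)
Definition crossed_mul (x y : crossed_space) : crossed_space :=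
  mlift (fun m a => mlift (fun m' a' =>
      \sw(a1, a2 <- a) crossed (mmul m (mact a1 m')) (a2 * a'))
    (repr y)) (repr x).

Definition crossed_star (x : crossed_space) : crossed_space :=
  mlift (fun m a =>
    crossed_mul (crossed (mone M) (star a)) (crossed (mstar m) 1)) (repr x).

Definition crossed_act (phi : dual A) (x : crossed_space) : crossed_space :=
  mlift (fun m a => crossed m (dual_act phi a)) (repr x).

Definition crossed_product : modAlg (dual A) := {|
  carrier := crossed_space;
  mmul := crossed_mul;
  mone := crossed (mone M) 1;
  mstar := crossed_star;
  mact := crossed_act
|}.

Definition cross (m : M) (a : A) : crossed_product := crossed m a.

End CrossedProduct.

Notation "m ⋊ a" := (cross m a) : ring_scope.

(* Main.v *)
(* Let k be the square root of d_R(l), t = S(k) in A_L, and let E be the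
   conditional expectation a |-> lambda ⇀ a onto A_L. Then l = h k^2 and
   e_l = k h k = t h t^*, so that lambda ⇀ e_l = 1 says E(h) = (t^* t)^-1; in
   particular t is invertible. The functionals lambda and <l|.> are faithful and
   positive on A and on its dual, and l makes eps faithful and positive on A_L,
   so that each positive element has a square root that is a polynomial in it.
   Writing lambda = hd . (w ⇀ 1) with hd the dual Haar integral and w in A_L, the
   element z' = hd ⇀ h implements S^4 on A_L; by positivity its square root
   implements S^2, which computes the square root of d_R(lambda) and gives (i).
   For (ii), h_(2) y ⊗ S^-1(h_(1)) with y = S(E(h)^-1) is a quasi-basis for E.
   The relations (iii) are computed in the crossed products from the explicit
   forms of e_l and e_lambda. *)

Require Import Defs.
From HB Require Import structures.
From mathcomp Require Import all_boot all_order all_algebra all_field.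
From mathcomp Require Import complex boolp classical_sets reals ring.

Import Order.TTheory GRing.Theory Num.Theory.
Local Open Scope ring_scope.

Set Implicit Arguments.
Unset Strict Implicit.
Unset Printing Implicit Defensive.

(** Only half of the claims is proved directly. [p_dual_pair] is stable under passing from (l,
    lambda) to (lambda, bidual l), and this stability is the core of (i). So (i) comes first, and
    the claims on [Ind l] and on the square of the second element of (iii) are those on
    [dual_Ind lambda] and on e_l read in the dual. This is why the theory is stated for predicates
    on [preWeakHopfType] that pass to the dual. The obstacle is (i). The hypothesis determines only
    z = E(h), whereas e_lambda involves the square root of w, where d_R(lambda) = w ⇀ 1. With z' =
    g^2 one gets z = g w g once S^2, and not only S^4, is known to be conjugation by g on A_L. Then
    v = t g satisfies w v^2 = 1, but [psqrt] asks for a positive element. So v is exhibited as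
    [q * star q] with q = n r, where r^2 = g, n = S(m) and m^2 = k: fourth roots of z' and of d_R(l)
    have to be carried along. Behind all modular computations is one identity on A_L: eps(x x') =
    eps(x' S^2(x)). *)

Section Multilinear.
Variable R : realType.
Local Notation C := R[i].

Definition bilin (U V W : lmodType C) (f : U -> V -> W) :=
  (forall v, linear (f^~ v)) /\ (forall u, linear (f u)).

Definition trilin (U V W X : lmodType C) (f : U -> V -> W -> X) :=
  [/\ forall v w, linear (fun u => f u v w), forall u w, linear (fun v => f u v w)
    & forall u v, linear (f u v)].

Lemma lin0 (V W : lmodType C) (f : V -> W) : linear f -> f 0 = 0.
Proof. by move=> lf; rewrite -[0](addrN 0) -scaleN1r addrC lf scaleN1r addNr. Qed.

Lemma linZ (V W : lmodType C) (f : V -> W) c x : linear f -> f (c *: x) = c *: f x.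
Proof. by move=> lf; rewrite -[c *: x]addr0 lf lin0 ?addr0. Qed.

Lemma linD (V W : lmodType C) (f : V -> W) x y : linear f -> f (x + y) = f x + f y.
Proof. by move=> lf; rewrite -[x]scale1r lf !scale1r. Qed.

Lemma bilZl (U V W : lmodType C) (f : U -> V -> W) c u v :
  bilin f -> f (c *: u) v = c *: f u v.
Proof. by case=> fl _; exact: (linZ _ _ (fl v)). Qed.

Lemma bilZr (U V W : lmodType C) (f : U -> V -> W) c u v :
  bilin f -> f u (c *: v) = c *: f u v.
Proof. by case=> _ fr; exact: (linZ _ _ (fr u)). Qed.

Lemma lin_id (V : lmodType C) : linear (fun x : V => x).
Proof. by []. Qed.

Lemma lin_mull (V : lmodType C) (B : algType C) (f : V -> B) (a : B) :
  linear f -> linear (fun x => f x * a).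
Proof. by move=> lf c x y; rewrite lf mulrDl scalerAl. Qed.

Lemma lin_mulr (V : lmodType C) (B : algType C) (f : V -> B) (a : B) :
  linear f -> linear (fun x => a * f x).
Proof. by move=> lf c x y; rewrite lf mulrDr scalerAr. Qed.

Lemma lin_pairingl (A : preWeakHopfType R) (V : lmodType C) (f : V -> dual A) a :
  linear f -> linear (fun x => pairing (f x) a : C^o).
Proof. by move=> lf; apply: (linear_comp (@pairing_linearl R A a)). Qed.

Lemma lin_pairingr (A : preWeakHopfType R) (V : lmodType C) (f : V -> A) phi :
  linear f -> linear (fun x => pairing phi (f x) : C^o).
Proof. exact: linear_comp (@pairing_linearr R A phi). Qed.

Lemma lin_tensorl (V : lmodType C) (A B : vectType C) (f : V -> A) (b : B) :
  linear f -> linear (fun x => f x ⊗ b).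
Proof. exact: (linear_comp (@tensor_linearl R A B b)). Qed.

Lemma lin_tensorr (V : lmodType C) (A B : vectType C) (f : V -> B) (a : A) :
  linear f -> linear (fun x => a ⊗ f x).
Proof. exact: (linear_comp (@tensor_linearr R A B a)). Qed.

Lemma lin_add (V W : lmodType C) (f g : V -> W) :
  linear f -> linear g -> linear (fun x => f x + g x).
Proof. by move=> lf lg c x y; rewrite lf lg scalerDr addrACA. Qed.

Lemma lin_opp (V W : lmodType C) (f : V -> W) :
  linear f -> linear (fun x => - f x).
Proof. by move=> lf c x y; rewrite lf opprD scalerN. Qed.

Lemma lin_bil (T U V W : lmodType C) (f : U -> V -> W) (g : T -> U) v :
  bilin f -> linear g -> linear (fun x => f (g x) v).
Proof. by case=> fl _; apply: (linear_comp (fl v)). Qed.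

Lemma lin_bir (T U V W : lmodType C) (f : U -> V -> W) (g : T -> V) u :
  bilin f -> linear g -> linear (fun x => f u (g x)).
Proof. by case=> _ fr; apply: (linear_comp (fr u)). Qed.

Lemma lin_tri1 (T U V W X : lmodType C) (f : U -> V -> W -> X) (g : T -> U) v w :
  trilin f -> linear g -> linear (fun x => f (g x) v w).
Proof. by case=> f1 _ _; apply: (linear_comp (f1 v w)). Qed.

Lemma lin_tri2 (T U V W X : lmodType C) (f : U -> V -> W -> X) (g : T -> V) u w :
  trilin f -> linear g -> linear (fun x => f u (g x) w).
Proof. by case=> _ f2 _; apply: (linear_comp (f2 u w)). Qed.

Lemma lin_tri3 (T U V W X : lmodType C) (f : U -> V -> W -> X) (g : T -> W) u v :
  trilin f -> linear g -> linear (fun x => f u v (g x)).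
Proof. by case=> _ _ f3; apply: (linear_comp (f3 u v)). Qed.

Lemma lin_fun (U V W : lmodType C) (L : {linear V -> W}) (g : U -> V) :
  linear g -> linear (fun x => L (g x)).
Proof. exact: (linear_comp (linearP L)). Qed.

Lemma lin_tlift (A B : vectType C) (V W : lmodType C) (f : A -> B -> V)
    (t : W -> tens A B) :
  linear t -> linear (fun x => tlift f (t x)).
Proof. exact: (linear_comp (tlift_is_linear f)). Qed.

Lemma lin_tliftf (A B : vectType C) (V W : lmodType C) (f : V -> A -> B -> W)
    t : (forall a b, linear (fun v => f v a b)) -> linear (fun v => tlift (f v) t).
Proof. exact: linear_tliftf. Qed.

End Multilinear.

(** Syntax-directed: each branch removes the outermost operation around the bound variable. Products
    and multiples by constants get two attempts, since the product of values in [C^o] is taken in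
    the field. The branch for bundled linear maps matches any application, so it comes last. *)
Ltac lin_step :=
  match goal with
  | |- bilin _ => split
  | |- trilin _ => split
  | |- forall _, _ => intro
  | |- GRing.linear_for _ (fun x => x) => exact: lin_id
  | |- GRing.linear_for _ (fun x => tlift ?f (@?t x)) =>
      apply: (lin_tlift f (t := t))
  | |- GRing.linear_for _ (fun x => tlift _ ?t) =>
      apply: (lin_tliftf t) => ? ?
  | |- GRing.linear_for _ (fun x => @?f x * ?a) =>
      first [apply: (linear_mull (f := f) a) | apply: (@lin_mull _ _ _ f a)]
  | |- GRing.linear_for _ (fun x => ?a * @?f x) =>
      first [apply: (linear_mulr (f := f) a) | apply: (@lin_mulr _ _ _ f a)]
  | |- GRing.linear_for _ (fun x => @?f x *: ?a) => apply: (linear_scale (f := f) a)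
  | |- GRing.linear_for _ (fun x => ?a *: @?f x) => apply: (linear_scaler a (f := f))
  | |- GRing.linear_for _ (fun x => @?f x + @?g x) => apply: (lin_add (f := f))
  | |- GRing.linear_for _ (fun x => - @?f x) => apply: (lin_opp (f := f))
  | |- GRing.linear_for _ (fun x => pairing (@?f x) ?a) => apply: (lin_pairingl (f := f) a)
  | |- GRing.linear_for _ (fun x => pairing ?f (@?a x)) => apply: (lin_pairingr f (f := a))
  | |- GRing.linear_for _ (fun x => @?f x ⊗ ?a) => apply: (lin_tensorl (f := f) a)
  | |- GRing.linear_for _ (fun x => ?a ⊗ @?f x) => apply: (lin_tensorr (f := f) a)
  | H : trilin ?f |- GRing.linear_for _ (fun x => ?f (@?g x) ?a ?b) =>
      apply: (lin_tri1 a b H (g := g))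
  | H : trilin ?f |- GRing.linear_for _ (fun x => ?f ?a (@?g x) ?b) =>
      apply: (lin_tri2 a b H (g := g))
  | H : trilin ?f |- GRing.linear_for _ (fun x => ?f ?a ?b (@?g x)) =>
      apply: (lin_tri3 a b H (g := g))
  | H : trilin ?f |- GRing.linear_for _ (?f ?a ?b) => by case: H
  | H : bilin ?f |- GRing.linear_for _ (fun x => ?f (@?g x) ?b) =>
      apply: (lin_bil b H (g := g))
  | H : bilin ?f |- GRing.linear_for _ (fun x => ?f ?a (@?g x)) =>
      apply: (lin_bir a H (g := g))
  | H : bilin ?f |- GRing.linear_for _ (?f ?a) => by case: H
  | H : GRing.linear_for _ ?f |- GRing.linear_for _ (fun x => ?f (@?g x)) =>
      apply: (linear_comp H (g := g))
  | |- GRing.linear_for _ (GRing.scale ?k) => exact: (linear_scaler k (@lin_id _ _))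
  | |- GRing.linear_for _ (GRing.mul ?a) =>
      first [exact: (linear_mulr a (@lin_id _ _)) | exact: (lin_mulr a (@lin_id _ _))]
  | |- GRing.linear_for _ ?f =>
     first [assumption | exact: linearP | exact: tensor_linearr
           | exact: tensor_linearl | exact: pairing_linearr]
  | |- GRing.linear_for _ (fun x => ?f (@?g x)) => apply: (@lin_fun _ _ _ _ _ g)
  end.

Ltac lin := solve [repeat (cbv beta; lin_step)].

(** * Calculus of Sweedler sums *)

Section WeakHopf.
Variable R : realType.
Local Notation C := R[i].

Section TliftLemmas.
Variables (A B A' B' : vectType C).

Lemma tlift_exch (V : lmodType C) (F : A -> B -> A' -> B' -> V) s t :
  tlift (fun a b => tlift (F a b) t) s =
  tlift (fun c d => tlift (fun a b => F a b c d) s) t.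
Proof.
rewrite /tlift.
transitivity (\sum_i \sum_j \sum_k \sum_l
  ((s : 'M_(_,_)) i j * (t : 'M_(_,_)) k l) *: F (bas i) (bas j) (bas k) (bas l)).
  apply: eq_bigr => i _; apply: eq_bigr => j _.
  rewrite scaler_sumr; apply: eq_bigr => k _; rewrite scaler_sumr.
  by apply: eq_bigr => l _; rewrite scalerA.
transitivity (\sum_k \sum_i \sum_j \sum_l
  ((s : 'M_(_,_)) i j * (t : 'M_(_,_)) k l) *: F (bas i) (bas j) (bas k) (bas l)).
  by under eq_bigr => i _ do rewrite exchange_big; rewrite exchange_big.
apply: eq_bigr => k _.
transitivity (\sum_l \sum_i \sum_j
  ((s : 'M_(_,_)) i j * (t : 'M_(_,_)) k l) *: F (bas i) (bas j) (bas k) (bas l)).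
  by under eq_bigr => i _ do rewrite exchange_big; rewrite exchange_big.
apply: eq_bigr => l _.
rewrite scaler_sumr; apply: eq_bigr => i _; rewrite scaler_sumr.
by apply: eq_bigr => j _; rewrite scalerA mulrC.
Qed.

Lemma tlift_tens (V : lmodType C) (f : A -> B -> V) a b :
  bilin f -> tlift f (a ⊗ b) = f a b.
Proof. by case=> *; apply: tlift_tensor. Qed.

Lemma tens_inj (s t : tens A B) :
  (forall i j, tlift (fun a b => crd i a * crd j b : C^o) s =
     tlift (fun a b => crd i a * crd j b : C^o) t) -> s = t.
Proof.
move=> st; apply/matrixP => i j.
suff coefE (t' : tens A B) :
    tlift (fun a b => crd i a * crd j b : C^o) t' = (t' : 'M_(_,_)) i j.
  by rewrite -!coefE; apply: st.
rewrite /tlift (bigD1 i)//= [X in _ + X]big1 ?addr0 => [|k ki].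
  rewrite (bigD1 j)//= [X in _ + X]big1 ?addr0 => [|l lj].
    by rewrite !crd_bas !eqxx mulr1 /GRing.scale /= mulr1.
  by rewrite !crd_bas (negPf lj) mulr0 scaler0.
by rewrite big1// => l _; rewrite !crd_bas (negPf ki) mul0r scaler0.
Qed.

Lemma tlift_inj (s t : tens A B) :
  (forall f : A -> B -> C^o, bilin f -> tlift f s = tlift f t) -> s = t.
Proof. by move=> st; apply: tens_inj => i j; apply: st; lin. Qed.

Lemma tlift_id (t : tens A B) : tlift (fun a b => a ⊗ b) t = t.
Proof.
apply: tlift_inj => f bf; rewrite (linear_tlift _ _ (tlift_is_linear f)).
by apply: eq_tlift => a b; rewrite tlift_tensor//; case: bf.
Qed.

End TliftLemmas.

Lemma tlift_scale (A B : vectType C) (V : lmodType C) (f : A -> B -> C^o)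
    (v : V) t :
  (tlift f t : C) *: v = tlift (fun a b => (f a b : C) *: v) t.
Proof. by rewrite (linear_tlift (L := fun c : C^o => (c : C) *: v))//; lin. Qed.

Lemma scale_tlift (A B : vectType C) (V : lmodType C) (f : A -> B -> V) c t :
  c *: tlift f t = tlift (fun a b => c *: f a b) t.
Proof. by rewrite (linear_tlift (L := fun v => c *: v))//; lin. Qed.

Lemma mul_tlift (A B : vectType C) (D : algType C) (f : A -> B -> D) c t :
  c * tlift f t = tlift (fun a b => c * f a b) t.
Proof. by rewrite (linear_tlift (L := fun v => c * v))//; lin. Qed.

Lemma tlift_mul (A B : vectType C) (D : algType C) (f : A -> B -> D) c t :
  tlift f t * c = tlift (fun a b => f a b * c) t.
Proof. by rewrite (linear_tlift (L := fun v => v * c))//; lin. Qed.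

Lemma pairing_tlift (A B : vectType C) (D : preWeakHopfType R) (phi : dual D)
    (f : A -> B -> D) t :
  pairing phi (tlift f t) = tlift (fun a b => pairing phi (f a b) : C^o) t.
Proof. by rewrite (linear_tlift (L := fun v => pairing phi v : C^o))//; lin. Qed.

Lemma fun_tlift (A B : vectType C) (V W : lmodType C) (L : {linear V -> W})
    (f : A -> B -> V) t :
  L (tlift f t) = tlift (fun a b => L (f a b)) t.
Proof. by rewrite (linear_tlift (L := L))//; lin. Qed.

Lemma tlift_comul_tlift (A B : vectType C) (D : preWeakHopfType R) (V : lmodType C)
   (f : A -> B -> D) (g : D -> D -> V) t :
  tlift g (comul (tlift f t)) = tlift (fun a b => tlift g (comul (f a b))) t.
Proof. by rewrite (linear_tlift (L := fun v => tlift g (comul v)))//; lin. Qed.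

(** [comulA] is an identity of tensors; lifting [F] in its last two arguments and then in the first
    gives a map on A ⊗ (A ⊗ A) that can be applied to it. *)
Lemma sw_coassoc (A : preWeakHopfType R) (V : lmodType C) (F : A -> A -> A -> V) x :
  trilin F ->
  \sw(a, b <- x) \sw(c, d <- a) F c d b = \sw(a, b <- x) \sw(c, d <- b) F a c d.
Proof.
move=> tF; pose G (a : A) (s : tens A A) := tlift (F a) s.
have bG : bilin G.
  by split=> [t|a]; rewrite /G; lin.
have := congr1 (tlift G) (comulA x).
rewrite !(linear_tlift _ _ (tlift_is_linear G)) => E.
transitivity (\sw(a, b <- x) tlift G (tlift (fun c d => c ⊗ (d ⊗ b)) (comul a))).
  apply: eq_tlift => a b; rewrite (linear_tlift _ _ (tlift_is_linear G)).
  apply: eq_tlift => c d; rewrite tlift_tens// /G tlift_tens//.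
  lin.
rewrite E; apply: eq_tlift => a b; rewrite tlift_tens//.
Qed.
End WeakHopf.

(** * Weak Hopf algebras *)

Section WeakHopfTheory.
Variable R : realType.
Local Notation C := R[i].

(* The dual of A is only a preWeakHopfType, so the axioms are a predicate that
   can be transported to it. The primed axioms follow from the unprimed ones by
   means of the *; including them makes the notion self-dual without a *. *)
Record weak_hopf (A : preWeakHopfType R) : Prop := WeakHopf {
  wcomulM : forall x y : A,
    comul (x * y) = \sw(x1, x2 <- x) \sw(y1, y2 <- y) (x1 * y1) ⊗ (x2 * y2);
  wcomul1 :
    \sw(a, b <- (1 : A)) \sw(c, d <- (1 : A)) a ⊗ ((b * c) ⊗ d) =
    \sw(a, b <- (1 : A)) a ⊗ comul b;
  wcomul1' :
    \sw(a, b <- (1 : A)) \sw(c, d <- (1 : A)) a ⊗ ((c * b) ⊗ d) =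
    \sw(a, b <- (1 : A)) a ⊗ comul b;
  wcounitM : forall x y z : A,
    counit (x * y * z) =
    \sw(y1, y2 <- y) (counit (x * y1) * counit (y2 * z) : R[i]^o);
  wcounitM' : forall x y z : A,
    counit (x * y * z) =
    \sw(y1, y2 <- y) (counit (x * y2) * counit (y1 * z) : R[i]^o);
  wantipodel : forall x : A,
    \sw(x1, x2 <- x) (antipode x1 * x2) =
    \sw(a, b <- (1 : A)) (counit (x * b) *: a);
  wantipoder : forall x : A,
    \sw(x1, x2 <- x) (x1 * antipode x2) =
    \sw(a, b <- (1 : A)) (counit (a * x) *: b);
  wantipodeS : forall x : A,
    \sw(x1, y <- x) \sw(x2, x3 <- y) (antipode x1 * x2 * antipode x3) = antipode x
}.

Section Projections.
Variable A : preWeakHopfType R.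

Fact Pi_key : unit. Proof. by []. Qed.
(** For a weak Hopf algebra, [PiL] and [PiR] are the counital projections onto A_L and A_R, equal to
    x1 S(x2) and S(x1) x2. Locking keeps them from unfolding into sums over Delta(1). *)
Definition PiL : A -> A :=
  locked_with Pi_key (fun x => \sw(a, b <- (1 : A)) (counit (a * x) *: b)).
Definition PiR : A -> A :=
  locked_with Pi_key (fun x => \sw(a, b <- (1 : A)) (counit (x * b) *: a)).

Lemma PiLE x : PiL x = \sw(a, b <- (1 : A)) (counit (a * x) *: b).
Proof. by rewrite /PiL unlock. Qed.

Lemma PiRE x : PiR x = \sw(a, b <- (1 : A)) (counit (x * b) *: a).
Proof. by rewrite /PiR unlock. Qed.

Lemma PiL_is_linear : linear PiL.
Proof. by rewrite /PiL unlock; lin. Qed.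
HB.instance Definition _ := GRing.isLinear.Build C A A _ PiL PiL_is_linear.

Lemma PiR_is_linear : linear PiR.
Proof. by rewrite /PiR unlock; lin. Qed.
HB.instance Definition _ := GRing.isLinear.Build C A A _ PiR PiR_is_linear.

(** Membership in A_L and A_R as an equation to rewrite with; [left_subalg_inL] and [right_subalgP]
    relate it to the subalgebras of the statement. *)
Definition inL (x : A) := PiL x = x.
Definition inR (x : A) := PiR x = x.

Lemma sw_scale (V : lmodType C) (f : A -> A -> V) c x :
  \sw(a, b <- c *: x) f a b = \sw(a, b <- x) (c *: f a b).
Proof. by rewrite -scale_tlift !linearZ. Qed.

Lemma sw_counitl (V : lmodType C) (f : A -> V) x :
  linear f -> \sw(a, b <- x) (counit a *: f b) = f x.
Proof.
move=> lf; rewrite -{2}[x]counitl (linear_tlift _ _ lf).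
by apply: eq_tlift => a b; rewrite (linZ _ _ lf).
Qed.

Lemma sw_counitr (V : lmodType C) (f : A -> V) x :
  linear f -> \sw(a, b <- x) (counit b *: f a) = f x.
Proof.
move=> lf; rewrite -{2}[x]counitr (linear_tlift _ _ lf).
by apply: eq_tlift => a b; rewrite (linZ _ _ lf).
Qed.

End Projections.

(** The product [m] in the middle leg is a parameter, to cover both forms of the axiom for Delta(1).
    The axiom is a hypothesis because [comul1_op] uses the lemma to establish [weak_hopf]. *)
Lemma sw_one_of (A : preWeakHopfType R) (m : A -> A -> A) (V : lmodType C)
    (F : A -> A -> A -> V) :
  \sw(a, b <- (1 : A)) \sw(c, d <- (1 : A)) a ⊗ (m b c ⊗ d) =
    \sw(a, b <- (1 : A)) a ⊗ comul b -> trilin F ->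
  \sw(a, b <- (1 : A)) \sw(c, d <- b) F a c d =
  \sw(a, b <- (1 : A)) \sw(c, d <- (1 : A)) F a (m b c) d.
Proof.
move=> one tF; pose G (a : A) (s : tens A A) := tlift (F a) s.
have bG : bilin G by rewrite /G; lin.
have := congr1 (tlift G) one.
rewrite !(linear_tlift _ _ (tlift_is_linear G)) => E.
transitivity (\sw(a, b <- 1 : A) tlift G (a ⊗ comul b)).
  by apply: eq_tlift => a b; rewrite tlift_tens.
rewrite -E; apply: eq_tlift => a b; rewrite (linear_tlift _ _ (tlift_is_linear G)).
by apply: eq_tlift => c d; rewrite tlift_tens// /G tlift_tens//; lin.
Qed.

Variable A : preWeakHopfType R.
Hypothesis H : weak_hopf A.
Local Notation S := (@antipode R A).
Local Notation eps := (@counit R A).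
Implicit Types x y z a b : A.

Lemma sw_mul (V : lmodType C) (f : A -> A -> V) x y : bilin f ->
  \sw(a, b <- x * y) f a b =
  \sw(x1, x2 <- x) \sw(y1, y2 <- y) f (x1 * y1) (x2 * y2).
Proof.
move=> bf; rewrite (wcomulM H) (linear_tlift _ _ (tlift_is_linear f)).
apply: eq_tlift => a b; rewrite (linear_tlift _ _ (tlift_is_linear f)).
by apply: eq_tlift => c d; rewrite tlift_tens.
Qed.

Lemma sw_one (V : lmodType C) (F : A -> A -> A -> V) : trilin F ->
  \sw(a, b <- (1 : A)) \sw(c, d <- b) F a c d =
  \sw(a, b <- (1 : A)) \sw(c, d <- (1 : A)) F a (b * c) d.
Proof. exact: (sw_one_of (wcomul1 H)). Qed.

Lemma sw_one' (V : lmodType C) (F : A -> A -> A -> V) : trilin F ->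
  \sw(a, b <- (1 : A)) \sw(c, d <- b) F a c d =
  \sw(a, b <- (1 : A)) \sw(c, d <- (1 : A)) F a (c * b) d.
Proof. exact: (sw_one_of (m := fun b c => c * b) (wcomul1' H)). Qed.

Lemma PiL_antipode x : \sw(a, b <- x) (a * S b) = PiL x.
Proof. by rewrite PiLE; apply: wantipoder. Qed.

Lemma PiR_antipode x : \sw(a, b <- x) (S a * b) = PiR x.
Proof. by rewrite PiRE; apply: wantipodel. Qed.

(** The opposite counit axiom with middle factor 1: eps(a 1 b) = eps(a 1_2) eps(1_1 b), where 1_2
    eps(1_1 b) is [PiL b]. *)
Lemma counit_PiL a b : eps (a * PiL b) = eps (a * b).
Proof.
rewrite -{2}[a]mulr1 (wcounitM' H) PiLE mul_tlift fun_tlift.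
by apply: eq_tlift => u v; rewrite -scalerAr linearZ mulrC.
Qed.

Lemma counit_PiR a b : eps (PiR a * b) = eps (a * b).
Proof.
rewrite -{2}[a]mulr1 (wcounitM' H) PiRE tlift_mul fun_tlift.
by apply: eq_tlift => u v; rewrite -scalerAl linearZ.
Qed.

Lemma PiL_mul_PiL a b : PiL (a * PiL b) = PiL (a * b).
Proof. by rewrite [LHS]PiLE [RHS]PiLE; apply: eq_tlift => u v; rewrite mulrA counit_PiL mulrA. Qed.

Lemma PiR_PiR_mul a b : PiR (PiR a * b) = PiR (a * b).
Proof. by rewrite [LHS]PiRE [RHS]PiRE; apply: eq_tlift => u v; rewrite -mulrA counit_PiR mulrA. Qed.

Lemma inL_PiL x : inL (PiL x).
Proof. by rewrite /inL -[in LHS](mul1r (PiL x)) PiL_mul_PiL mul1r. Qed.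

Lemma inR_PiR x : inR (PiR x).
Proof. by rewrite /inR -[in LHS](mulr1 (PiR x)) PiR_PiR_mul mulr1. Qed.

(** Write x as eps(1_1 x) 1_2 and apply the axiom for 1_1 ⊗ 1_2 ⊗ 1_3: its middle leg is a product,
    one factor of which reassembles to x. The two orders of this product put x on the left here and
    on the right in [sw_inLr]. *)
Lemma sw_inLl (V : lmodType C) (f : A -> A -> V) x : bilin f -> inL x ->
  \sw(a, b <- x) f a b = \sw(a, b <- (1 : A)) f (x * a) b.
Proof.
move=> bf xL; rewrite -{1}xL PiLE tlift_comul_tlift.
transitivity (\sw(u, v <- 1 : A) \sw(c, d <- v) (eps (u * x) *: f c d)).
  by apply: eq_tlift => u v; rewrite sw_scale.
rewrite (sw_one (F := fun u c d => eps (u * x) *: f c d)); last by lin.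
rewrite tlift_exch; apply: eq_tlift => c d.
rewrite -{2}xL PiLE tlift_mul (linear_tlift (L := fun e => f e d)); last by lin.
by apply: eq_tlift => u v; rewrite -scalerAl bilZl.
Qed.

Lemma sw_inLr (V : lmodType C) (f : A -> A -> V) x : bilin f -> inL x ->
  \sw(a, b <- x) f a b = \sw(a, b <- (1 : A)) f (a * x) b.
Proof.
move=> bf xL; rewrite -{1}xL PiLE tlift_comul_tlift.
transitivity (\sw(u, v <- 1 : A) \sw(c, d <- v) (eps (u * x) *: f c d)).
  by apply: eq_tlift => u v; rewrite sw_scale.
rewrite (sw_one' (F := fun u c d => eps (u * x) *: f c d)); last by lin.
rewrite tlift_exch; apply: eq_tlift => c d.
rewrite -{2}xL PiLE mul_tlift (linear_tlift (L := fun e => f e d)); last by lin.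
by apply: eq_tlift => u v; rewrite -scalerAr bilZl.
Qed.

Lemma sw_inRr (V : lmodType C) (f : A -> A -> V) y : bilin f -> inR y ->
  \sw(a, b <- y) f a b = \sw(a, b <- (1 : A)) f a (b * y).
Proof.
move=> bf yR; rewrite -{1}yR PiRE tlift_comul_tlift.
transitivity (\sw(u, v <- 1 : A) \sw(c, d <- u) (eps (y * v) *: f c d)).
  by apply: eq_tlift => u v; rewrite sw_scale.
rewrite (sw_coassoc (F := fun c d v => eps (y * v) *: f c d)); last by lin.
rewrite sw_one; last by lin.
apply: eq_tlift => a b.
rewrite -{2}yR PiRE mul_tlift (linear_tlift (L := fun e => f a e)); last by lin.
by apply: eq_tlift => u v; rewrite -scalerAr bilZr.
Qed.

Lemma sw_inRl (V : lmodType C) (f : A -> A -> V) y : bilin f -> inR y ->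
  \sw(a, b <- y) f a b = \sw(a, b <- (1 : A)) f a (y * b).
Proof.
move=> bf yR; rewrite -{1}yR PiRE tlift_comul_tlift.
transitivity (\sw(u, v <- 1 : A) \sw(c, d <- u) (eps (y * v) *: f c d)).
  by apply: eq_tlift => u v; rewrite sw_scale.
rewrite (sw_coassoc (F := fun c d v => eps (y * v) *: f c d)); last by lin.
rewrite sw_one'; last by lin.
apply: eq_tlift => a b.
rewrite -{2}yR PiRE tlift_mul (linear_tlift (L := fun e => f a e)); last by lin.
by apply: eq_tlift => u v; rewrite -scalerAl bilZr.
Qed.

(** Both axioms for 1_1 ⊗ 1_2 ⊗ 1_3 describe the same tensor, so the two factors of its middle leg
    commute. *)
Lemma inLR_comm x y : inL x -> inR y -> x * y = y * x.
Proof.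
move=> <- <-; rewrite PiLE PiRE.
pose F a b c := (eps (a * x) * eps (y * c)) *: b.
have tF : trilin F by rewrite /F; lin.
transitivity (\sw(a, b <- 1 : A) \sw(c, d <- 1 : A) F a (b * c) d).
  rewrite tlift_mul; apply: eq_tlift => a b; rewrite mul_tlift.
  by apply: eq_tlift => c d; rewrite /F -scalerAl -scalerAr scalerA.
rewrite -(sw_one tF) (sw_one' tF) mul_tlift; apply: eq_tlift => a b.
rewrite tlift_mul; apply: eq_tlift => c d.
by rewrite /F -scalerAr -scalerAl !scalerA.
Qed.

Lemma sw_mulLl (V : lmodType C) (f : A -> A -> V) x z : bilin f -> inL x ->
  \sw(a, b <- x * z) f a b = \sw(a, b <- z) f (x * a) b.
Proof.
move=> bf xL; rewrite sw_mul//.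
rewrite (sw_inLl (f := fun a b => \sw(c, d <- z) f (a * c) (b * d)))//; last by lin.
rewrite -[z in RHS]mul1r (sw_mul (f := fun a b => f (x * a) b)); last by lin.
by apply: eq_tlift => a b; apply: eq_tlift => c d; rewrite mulrA.
Qed.

Lemma sw_mulrL (V : lmodType C) (f : A -> A -> V) x z : bilin f -> inL x ->
  \sw(a, b <- z * x) f a b = \sw(a, b <- z) f (a * x) b.
Proof.
move=> bf xL; rewrite sw_mul// tlift_exch.
rewrite (sw_inLr (f := fun c d => \sw(a, b <- z) f (a * c) (b * d)))//; last by lin.
rewrite -[z in RHS]mulr1 (sw_mul (f := fun a b => f (a * x) b)); last by lin.
rewrite [RHS]tlift_exch.
by apply: eq_tlift => a b; apply: eq_tlift => c d; rewrite mulrA.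
Qed.

Lemma sw_mulRl (V : lmodType C) (f : A -> A -> V) y z : bilin f -> inR y ->
  \sw(a, b <- y * z) f a b = \sw(a, b <- z) f a (y * b).
Proof.
move=> bf yR; rewrite sw_mul//.
rewrite (sw_inRl (f := fun a b => \sw(c, d <- z) f (a * c) (b * d)))//; last by lin.
rewrite -[z in RHS]mul1r (sw_mul (f := fun a b => f a (y * b))); last by lin.
by apply: eq_tlift => a b; apply: eq_tlift => c d; rewrite mulrA.
Qed.

Lemma sw_mulrR (V : lmodType C) (f : A -> A -> V) y z : bilin f -> inR y ->
  \sw(a, b <- z * y) f a b = \sw(a, b <- z) f a (b * y).
Proof.
move=> bf yR; rewrite sw_mul// tlift_exch.
rewrite (sw_inRr (f := fun c d => \sw(a, b <- z) f (a * c) (b * d)))//; last by lin.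
rewrite -[z in RHS]mulr1 (sw_mul (f := fun a b => f a (b * y))); last by lin.
rewrite [RHS]tlift_exch.
by apply: eq_tlift => a b; apply: eq_tlift => c d; rewrite mulrA.
Qed.

Lemma inL_sw x :
  (forall (f : A -> A -> A), bilin f ->
     \sw(a, b <- x) f a b = \sw(a, b <- (1 : A)) f (a * x) b) -> inL x.
Proof.
move=> xE; rewrite /inL PiLE -[RHS]counitl.
by rewrite (xE (fun a b => eps a *: b))//; lin.
Qed.

Lemma inR_sw y :
  (forall (f : A -> A -> A), bilin f ->
     \sw(a, b <- y) f a b = \sw(a, b <- (1 : A)) f a (y * b)) -> inR y.
Proof.
move=> yE; rewrite /inR PiRE -[RHS]counitr.
by rewrite (yE (fun a b => eps b *: a))//; lin.
Qed.

Lemma inL_mul x z : inL x -> inL z -> inL (x * z).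
Proof.
move=> xL zL; apply: inL_sw => f bf; rewrite sw_mulrL// sw_inLr//; last by lin.
by apply: eq_tlift => a b; rewrite mulrA.
Qed.

Lemma inR_mul y z : inR y -> inR z -> inR (y * z).
Proof.
move=> yR zR; apply: inR_sw => f bf; rewrite sw_mulRl// sw_inRl//; last by lin.
by apply: eq_tlift => a b; rewrite mulrA.
Qed.

Lemma PiL_mull x a : inL x -> PiL (x * a) = x * PiL a.
Proof.
move=> xL; rewrite -PiL_antipode sw_mulLl//; last by lin.
by rewrite -PiL_antipode mul_tlift; apply: eq_tlift => u v; rewrite mulrA.
Qed.

Lemma PiR_mulr y a : inR y -> PiR (a * y) = PiR a * y.
Proof.
move=> yR; rewrite -PiR_antipode sw_mulrR//; last by lin.
by rewrite -PiR_antipode tlift_mul; apply: eq_tlift => u v; rewrite mulrA.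
Qed.

Lemma inL_leg (f : A -> C^o) :
  linear f -> inL (\sw(u, v <- (1 : A)) ((f u : C) *: v)).
Proof.
move=> lf; rewrite /inL PiLE.
transitivity (\sw(u, v <- (1 : A)) \sw(a, b <- (1 : A))
    ((f u : C) *: (eps (a * v) *: b))).
  rewrite [RHS]tlift_exch; apply: eq_tlift => a b.
  rewrite mul_tlift (linear_tlift (L := fun x => (eps x : C) *: b)); last by lin.
  by apply: eq_tlift => u v; rewrite -scalerAr linearZ scalerA.
rewrite -(sw_one' (F := fun u c b => (f u : C) *: (eps c *: b))); last by lin.
by apply: eq_tlift => u v; rewrite -scale_tlift counitl.
Qed.

Lemma inR_leg (f : A -> C^o) :
  linear f -> inR (\sw(u, v <- (1 : A)) ((f v : C) *: u)).
Proof.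
move=> lf; rewrite /inR PiRE.
transitivity (\sw(a, b <- (1 : A)) \sw(u, v <- (1 : A))
    ((f v : C) *: (eps (u * b) *: a))).
  apply: eq_tlift => a b.
  rewrite tlift_mul (linear_tlift (L := fun x => (eps x : C) *: a)); last by lin.
  by apply: eq_tlift => u v; rewrite -scalerAl linearZ scalerA.
rewrite -(sw_one' (F := fun a c v => (f v : C) *: (eps c *: a))); last by lin.
apply: eq_tlift => u v.
rewrite (eq_tlift (g := fun c d => eps c *: ((f d : C) *: u))); last first.
  by move=> c d; rewrite !scalerA mulrC.
by rewrite (sw_counitl (f := fun v => (f v : C) *: u)) //; lin.
Qed.

Lemma PiL1 : PiL 1 = 1 :> A.
Proof. by rewrite PiLE -[RHS]counitl; apply: eq_tlift => a b; rewrite mulr1. Qed.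

Lemma PiR1 : PiR 1 = 1 :> A.
Proof. by rewrite PiRE -[RHS]counitr; apply: eq_tlift => a b; rewrite mul1r. Qed.

Lemma inL1 : inL (1 : A). Proof. exact: PiL1. Qed.
Lemma inR1 : inR (1 : A). Proof. exact: PiR1. Qed.

(** Insert a counit into 1_1 x ⊗ 1_2 to get 1_1 x1 ⊗ eps(1_2 x2) 1_3 and split the middle leg; the
    copy of Delta(1) next to Delta(x) is then absorbed. *)
Lemma sw_PiL2 (V : lmodType C) (f : A -> A -> V) x : bilin f ->
  \sw(a, b <- x) f a (PiL b) = \sw(a, b <- (1 : A)) f (a * x) b.
Proof.
move=> bf; pose F p c q := \sw(a, b <- x) (eps (c * b) *: f (p * a) q).
have tF : trilin F by rewrite /F; lin.
transitivity (\sw(p, q <- (1 : A)) \sw(p1, p2 <- p) F p1 p2 q); last first.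
  apply: eq_tlift => p q; rewrite -(@sw_counitr A _ (fun c => f c q)); last by lin.
  by rewrite (sw_mul (f := fun c d => eps d *: f c q)); last by lin.
rewrite sw_coassoc// sw_one'// tlift_exch.
under [RHS]eq_tlift => c q.
  have -> : \sw(p, r <- 1 : A) F p (c * r) q =
      \sw(a, b <- 1 * x) (eps (c * b) *: f a q).
    rewrite (sw_mul (f := fun a b => eps (c * b) *: f a q)); last by lin.
    by apply: eq_tlift => a b; apply: eq_tlift => ? ?; rewrite mulrA.
  rewrite mul1r; over.
rewrite [RHS]tlift_exch; apply: eq_tlift => a b.
rewrite PiLE (linear_tlift (L := fun e => f a e)); last by lin.
by apply: eq_tlift => u v; rewrite bilZr.
Qed.

Lemma sw_PiR1 (V : lmodType C) (f : A -> A -> V) x : bilin f ->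
  \sw(a, b <- x) f (PiR a) b = \sw(a, b <- (1 : A)) f a (x * b).
Proof.
move=> bf; pose F p c q := \sw(a, b <- x) (eps (a * c) *: f p (b * q)).
have tF : trilin F by rewrite /F; lin.
transitivity (\sw(p, q <- (1 : A)) \sw(q1, q2 <- q) F p q1 q2); last first.
  apply: eq_tlift => p q; rewrite -(@sw_counitl A _ (fun c => f p c)); last by lin.
  rewrite (sw_mul (f := fun c d => eps c *: f p d)); last by lin.
  by rewrite /F tlift_exch.
rewrite sw_one'//.
under [RHS]eq_tlift => p r.
  have -> : \sw(c, q <- 1 : A) F p (c * r) q =
      \sw(a, b <- x * 1) (eps (a * r) *: f p b).
    rewrite (sw_mul (f := fun a b => eps (a * r) *: f p b)); last by lin.
    rewrite [RHS]tlift_exch.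
    by apply: eq_tlift => a b; apply: eq_tlift => ? ?; rewrite mulrA.
  rewrite mulr1; over.
rewrite [RHS]tlift_exch; apply: eq_tlift => a b.
rewrite PiRE (linear_tlift (L := fun e => f e b)); last by lin.
by apply: eq_tlift => u v; rewrite bilZl.
Qed.

Lemma PiL_mul_id x : \sw(a, b <- x) (PiL a * b) = x.
Proof.
rewrite -[RHS]mul1r -[RHS]counitl (sw_mul (f := fun a b => eps a *: b)); last by lin.
rewrite tlift_exch; apply: eq_tlift => a b; rewrite PiLE tlift_mul.
by apply: eq_tlift => u v; rewrite scalerAl.
Qed.

End WeakHopfTheory.

(** * The antipode and the dual *)

Section Antipode.
Variables (R : realType) (A : preWeakHopfType R).
Hypothesis H : weak_hopf A.
Local Notation C := R[i].
Local Notation S := (@antipode R A).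
Local Notation eps := (@counit R A).
Implicit Types x y z a b : A.

Lemma antipode_PiR x : S x = \sw(a, b <- x) (PiR a * S b).
Proof.
rewrite -(wantipodeS H) -(sw_coassoc (F := fun a b c => S a * b * S c)); last by lin.
by apply: eq_tlift => a b; rewrite -(PiR_antipode H) tlift_mul.
Qed.

Lemma antipode_PiL x : S x = \sw(a, b <- x) (S a * PiL b).
Proof.
rewrite -(wantipodeS H); apply: eq_tlift => a b.
by rewrite -(PiL_antipode H) mul_tlift; apply: eq_tlift => c d; rewrite mulrA.
Qed.

(** Both sides equal S(x1 y1) x2 y2 S(y3) S(x3): the last four factors collapse by [PiL] to the
    left-hand side, the first three by [PiR] to the right-hand side. *)
Lemma antipodeM x y : S (x * y) = S y * S x.
Proof.
pose G x1 c d y1 e f := S (x1 * y1) * (c * e) * (S f * S d).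
transitivity (\sw(x1, x2 <- x) \sw(c, d <- x2)
    \sw(y1, y2 <- y) \sw(e, f <- y2) G x1 c d y1 e f).
  rewrite antipode_PiL (sw_mul H (f := fun a b => S a * PiL b)); last by lin.
  apply: eq_tlift => x1 x2; rewrite tlift_exch; apply: eq_tlift => y1 y2.
  rewrite -(PiL_mul_PiL H) -(PiL_antipode H) (sw_mulrL H); [|by lin|exact: inL_PiL].
  rewrite mul_tlift; apply: eq_tlift => c d.
  rewrite -(PiL_antipode H) mul_tlift tlift_mul mul_tlift.
  by apply: eq_tlift => e f; rewrite /G !mulrA.
transitivity (\sw(x', d <- x) \sw(y', f <- y) (PiR (x' * y') * (S f * S d))).
  rewrite -(sw_coassoc (F := fun x1 c d => \sw(y1, y2 <- y) \sw(e, f <- y2)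
     G x1 c d y1 e f)); last by rewrite /G; lin.
  apply: eq_tlift => x' d.
  transitivity (\sw(x1, c <- x') \sw(y', f <- y) \sw(y1, e <- y') G x1 c d y1 e f).
    apply: eq_tlift => x1 c; rewrite sw_coassoc//; rewrite /G; lin.
  rewrite tlift_exch; apply: eq_tlift => y' f.
  rewrite -(PiR_antipode H) (sw_mul H (f := fun a b => S a * b)); last by lin.
  rewrite tlift_mul; apply: eq_tlift => a b; rewrite tlift_mul.
  by apply: eq_tlift => c' d'.
rewrite [S x]antipode_PiR mul_tlift; apply: eq_tlift => x' d.
transitivity (\sw(y', f <- y) \sw(y1, e <- y') (S y1 * PiR x' * e * S f * S d)).
  apply: eq_tlift => y' f.
  rewrite -(PiR_PiR_mul H) -(PiR_antipode H) (sw_mulRl H); [|by lin|exact: inR_PiR].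
  by rewrite tlift_mul; apply: eq_tlift => y1 e; rewrite !mulrA.
rewrite (sw_coassoc (F := fun y1 e f => S y1 * PiR x' * e * S f * S d)); last by lin.
rewrite [S y]antipode_PiL tlift_mul; apply: eq_tlift => y1 y2.
transitivity (S y1 * PiR x' * PiL y2 * S d).
  rewrite -(PiL_antipode H) mul_tlift tlift_mul.
  by apply: eq_tlift => e f; rewrite !mulrA.
by rewrite -(mulrA (S y1)) -(inLR_comm H (inL_PiL H _) (inR_PiR H _)) !mulrA.
Qed.

Lemma antipode1 : S 1 = 1.
Proof.
rewrite antipode_PiR (sw_PiR1 H (f := fun a b => a * S b)); last by lin.
by under eq_tlift => a b do rewrite mul1r; rewrite (PiL_antipode H) PiL1.
Qed.

Lemma counit_antipode x : eps (S x) = eps x.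
Proof.
rewrite antipode_PiR fun_tlift /=.
under eq_tlift => a b do rewrite (counit_PiR H).
by rewrite -(fun_tlift eps) (PiL_antipode H) -[PiL x]mul1r /= (counit_PiL H) mul1r.
Qed.

(** Delta(x) = 1_1 x ⊗ 1_2 turns S(x1) x2 into S(x) S(1_1) 1_2 = S(x). *)
Lemma antipode_inL x : inL x -> S x = PiR x.
Proof.
move=> xL; rewrite -(PiR_antipode H) (sw_inLr H)//; last by lin.
under eq_tlift => a b do rewrite antipodeM -mulrA.
by rewrite -mul_tlift (PiR_antipode H) PiR1 mulr1.
Qed.

Lemma antipode_inR y : inR y -> S y = PiL y.
Proof.
move=> yR; rewrite -(PiL_antipode H) (sw_inRl H)//; last by lin.
under eq_tlift => a b do rewrite antipodeM mulrA.
by rewrite -tlift_mul (PiL_antipode H) PiL1 mul1r.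
Qed.

Lemma inR_antipode x : inL x -> inR (S x).
Proof. by move=> xL; rewrite antipode_inL//; apply: inR_PiR. Qed.

Lemma inL_antipode y : inR y -> inL (S y).
Proof. by move=> yR; rewrite antipode_inR//; apply: inL_PiL. Qed.

Lemma counit_inR a y : inR y -> eps (a * S y) = eps (a * y).
Proof. by move=> yR; rewrite antipode_inR// (counit_PiL H). Qed.

Lemma counit_inL a x : inL x -> eps (S x * a) = eps (x * a).
Proof. by move=> xL; rewrite antipode_inL// (counit_PiR H). Qed.

(** S^2 is the modular automorphism of eps on A_L: eps allows x to be replaced by S(x) on the left,
    S(x) in A_R commutes with x', and on the right eps allows S(x) to be replaced by S^2(x). *)
Lemma counit_comm x x' : inL x -> inL x' -> eps (x * x') = eps (x' * S (S x)).
Proof.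
move=> xL x'L; rewrite -counit_inL// -(inLR_comm H x'L (inR_antipode xL)).
by rewrite -counit_inR//; apply: inR_antipode.
Qed.

End Antipode.

(** * The dual weak Hopf algebra *)

Section DualWeakHopf.
Variables (R : realType) (A : preWeakHopfType R).
Local Notation C := R[i].
Local Notation D := (dual A).
Implicit Types (phi psi : D) (x y : A).

Lemma tlift_mulC (U V : vectType C) (f : U -> V -> C^o) (c : C) t :
  (tlift f t : C) * c = tlift (fun a b => (f a b : C) * c : C^o) t.
Proof. exact: (@tlift_mul R U V C^o f c t). Qed.

Lemma mulC_tlift (U V : vectType C) (f : U -> V -> C^o) (c : C) t :
  c * (tlift f t : C) = tlift (fun a b => c * (f a b : C) : C^o) t.
Proof. exact: (@mul_tlift R U V C^o f c t). Qed.

Lemma sum_tlift (U V : vectType C) (W : lmodType C) (I : finType)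
    (f : I -> U -> V -> W) t :
  \sum_i tlift (f i) t = tlift (fun a b => \sum_i f i a b) t.
Proof.
rewrite /tlift exchange_big; apply: eq_bigr => k _.
by rewrite exchange_big; apply: eq_bigr => l _; rewrite scaler_sumr.
Qed.

Lemma tlift_tlift (U V U' V' : vectType C) (W : lmodType C) (f : U -> V -> W)
    (g : U' -> V' -> tens U V) t :
  tlift f (tlift g t) = tlift (fun a b => tlift f (g a b)) t.
Proof. exact: (linear_tlift _ _ (tlift_is_linear f)). Qed.

Lemma scaleCo (c : C) (d : C^o) : c *: d = c * d :> C.
Proof. by []. Qed.

Lemma dual_tens_inj (V : vectType C) (s t : tens D V) :
  (forall a, tlift (fun f v => pairing f a *: v) s =
             tlift (fun f v => pairing f a *: v) t) -> s = t.
Proof.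
move=> st; apply: tlift_inj => F bF.
have E (u : tens D V) : tlift F u =
    \sum_i F (dual_bas i) (tlift (fun f v => pairing f (bas i) *: v) u).
  transitivity (\sum_i tlift (fun f v => F (dual_bas i) (pairing f (bas i) *: v)) u).
    rewrite sum_tlift; apply: eq_tlift => f v; rewrite {1}[f]dual_bas_sum.
    rewrite (linear_sumZ (L := fun f => F f v)); last by lin.
    by apply: eq_bigr => i _; rewrite bilZr.
  by apply: eq_bigr => i _; rewrite (linear_tlift (L := F (dual_bas i))); last by lin.
by rewrite !E; apply: eq_bigr => i _; rewrite st.
Qed.

Lemma dual_tens2_inj (s t : tens D D) :
  (forall a b, tlift (fun f g : D => pairing f a * pairing g b : C^o) s =
     tlift (fun f g : D => pairing f a * pairing g b : C^o) t) -> s = t.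
Proof.
move=> st; apply: dual_tens_inj => a; apply: dualP => b.
have ll : linear (fun phi : D => pairing phi b : C^o) by lin.
have := st a b; rewrite !(linear_tlift _ _ ll).
by congr (_ = _); apply: eq_tlift => f g; rewrite (linZ _ _ ll).
Qed.

Lemma pairingZ c phi x : pairing (c *: phi) x = c * pairing phi x.
Proof. by rewrite (linZ _ _ (pairing_linearl x)). Qed.

Lemma pairingZr c phi x : pairing phi (c *: x) = c * pairing phi x.
Proof. by rewrite (linZ _ _ (pairing_linearr phi)). Qed.

Lemma tlift_pairing (U V : vectType C) (f : U -> V -> D) t a :
  pairing (tlift f t) a = tlift (fun u v => pairing (f u v) a : C^o) t.
Proof. by rewrite (linear_tlift (L := fun phi : D => pairing phi a : C^o))//; lin. Qed.

Lemma dual_counitE' phi : counit phi = pairing phi 1.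
Proof. exact: dual_counitE. Qed.

Lemma dual_comulE' phi x y :
  \sw(f, g <- phi) (pairing f x * pairing g y : C^o) = pairing phi (x * y).
Proof. exact: dual_comulE. Qed.

Lemma antipodeE phi x : pairing (antipode phi) x = pairing phi (antipode x).
Proof. exact: dual_antipodeE. Qed.

Lemma dual_PiLE phi x : pairing (PiL phi) x = pairing phi (PiL x).
Proof.
rewrite !PiLE tlift_pairing pairing_tlift.
under eq_tlift => f g.
  rewrite pairingZ dual_counitE' dualME tlift_mulC; over.
rewrite tlift_exch; apply: eq_tlift => a b; rewrite pairingZr -dual1E -dual_comulE'.
by rewrite tlift_mulC; apply: eq_tlift => f g; rewrite mulrAC.
Qed.

Lemma dual_PiRE phi x : pairing (PiR phi) x = pairing phi (PiR x).
Proof.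
rewrite !PiRE tlift_pairing pairing_tlift.
under eq_tlift => f g.
  rewrite pairingZ dual_counitE' dualME tlift_mulC; over.
rewrite tlift_exch; apply: eq_tlift => a b; rewrite pairingZr -dual1E -dual_comulE'.
by rewrite tlift_mulC; apply: eq_tlift => f g; rewrite mulrC mulrA mulrAC.
Qed.

Hypothesis H : weak_hopf A.

(** Each axiom is the transpose of one of A: [wcomulM] is its own transpose, [wcomul1] and
    [wcounitM] are exchanged, as are their primed forms, and [wantipodel] and [wantipoder] follow
    since [PiR] and [PiL] are their own transposes. *)
Lemma weak_hopf_dual : weak_hopf D.
Proof.
have sw2 phi x y z : \sw(f, g <- phi) \sw(h, k <- g)
    (pairing f x * pairing h y * pairing k z : C^o) = pairing phi (x * y * z).
  rewrite -mulrA -dual_comulE'; apply: eq_tlift => f g.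
  by rewrite -dual_comulE' mulC_tlift; apply: eq_tlift => h k; rewrite mulrA.
split.
- move=> phi psi; apply: dual_tens2_inj => a b.
  rewrite dual_comulE' dualME (sw_mul H
    (f := fun p q => pairing phi p * pairing psi q : C^o)); last by lin.
  rewrite tlift_tlift.
  under [RHS]eq_tlift => f g.
    rewrite tlift_tlift.
    under eq_tlift => h k.
      rewrite tlift_tens; last by lin.
      rewrite !dualME tlift_mulC; under eq_tlift => a1 a2 do rewrite mulC_tlift.
      over.
    rewrite tlift_exch; under eq_tlift => a1 a2.
      rewrite tlift_exch; over.
    over.
  rewrite [RHS]tlift_exch; apply: eq_tlift => a1 a2.
  rewrite [RHS]tlift_exch; apply: eq_tlift => b1 b2.
  rewrite -!dual_comulE' tlift_mulC; apply: eq_tlift => f g.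
  rewrite mulC_tlift; apply: eq_tlift => h k.
  by rewrite mulrACA.
- apply: dual_tens_inj => a; apply: dual_tens2_inj => b c.
  rewrite !tlift_tlift.
  under [LHS]eq_tlift => p q.
    rewrite !tlift_tlift; under eq_tlift => r s.
      rewrite tlift_tens ?linearZ /=; last by lin.
      rewrite tlift_tens; last by lin.
      rewrite dualME tlift_mulC scale_tlift; over.
    rewrite tlift_exch; over.
  rewrite tlift_exch.
  under [RHS]eq_tlift => p q.
    rewrite tlift_tens ?linearZ /=; last by lin.
    rewrite dual_comulE'; over.
  transitivity (counit (a * b * c)); last first.
    by rewrite -mulrA -dual1E -dual_comulE'.
  rewrite (wcounitM H); apply: eq_tlift => b1 b2.
  rewrite -!dual1E -!dual_comulE' tlift_mulC; apply: eq_tlift => p q.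
  rewrite mulC_tlift; apply: eq_tlift => r s.
  by rewrite scaleCo !mulrA.
- apply: dual_tens_inj => a; apply: dual_tens2_inj => b c.
  rewrite !tlift_tlift.
  under [LHS]eq_tlift => p q.
    rewrite !tlift_tlift; under eq_tlift => r s.
      rewrite tlift_tens ?linearZ /=; last by lin.
      rewrite tlift_tens; last by lin.
      rewrite dualME tlift_mulC scale_tlift; over.
    rewrite tlift_exch; over.
  rewrite tlift_exch.
  under [RHS]eq_tlift => p q.
    rewrite tlift_tens ?linearZ /=; last by lin.
    rewrite dual_comulE'; over.
  transitivity (counit (a * b * c)); last first.
    by rewrite -mulrA -dual1E -dual_comulE'.
  rewrite (wcounitM' H); apply: eq_tlift => b1 b2.
  rewrite -!dual1E -!dual_comulE' tlift_mulC; apply: eq_tlift => p q.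
  rewrite mulC_tlift; apply: eq_tlift => r s.
  by rewrite scaleCo [pairing r b1 * _]mulrC -!mulrA.
- move=> phi psi chi; rewrite dual_counitE' dualME.
  under eq_tlift => a b do rewrite dualME tlift_mulC.
  rewrite (sw_coassoc
    (F := fun a b c => pairing phi a * pairing psi b * pairing chi c : C^o)); last by lin.
  rewrite (sw_one H); last by lin.
  under [RHS]eq_tlift => f g.
    rewrite !dual_counitE' !dualME tlift_mulC.
    under eq_tlift => a b do rewrite mulC_tlift.
    over.
  rewrite [RHS]tlift_exch; apply: eq_tlift => a b.
  rewrite [RHS]tlift_exch; apply: eq_tlift => c d.
  rewrite -dual_comulE' mulC_tlift tlift_mulC.
  by apply: eq_tlift => f g; rewrite !mulrA.
- move=> phi psi chi; rewrite dual_counitE' dualME.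
  under eq_tlift => a b do rewrite dualME tlift_mulC.
  rewrite (sw_coassoc
    (F := fun a b c => pairing phi a * pairing psi b * pairing chi c : C^o)); last by lin.
  rewrite (sw_one' H); last by lin.
  under [RHS]eq_tlift => f g.
    rewrite !dual_counitE' !dualME tlift_mulC.
    under eq_tlift => a b do rewrite mulC_tlift.
    over.
  rewrite [RHS]tlift_exch; apply: eq_tlift => a b.
  rewrite [RHS]tlift_exch; apply: eq_tlift => c d.
  rewrite -dual_comulE' mulC_tlift tlift_mulC.
  by apply: eq_tlift => f g; rewrite [pairing f c * pairing g b]mulrC -!mulrA.
- move=> phi; apply: dualP => x; rewrite -PiRE dual_PiRE.
  rewrite -(PiR_antipode H) tlift_pairing pairing_tlift.
  under eq_tlift => f g.
    rewrite dualME; under eq_tlift => a b do rewrite antipodeE.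
    over.
  by rewrite tlift_exch; apply: eq_tlift => a b; rewrite dual_comulE'.
- move=> phi; apply: dualP => x; rewrite -PiLE dual_PiLE.
  rewrite -(PiL_antipode H) tlift_pairing pairing_tlift.
  under eq_tlift => f g.
    rewrite dualME; under eq_tlift => a b do rewrite antipodeE.
    over.
  by rewrite tlift_exch; apply: eq_tlift => a b; rewrite dual_comulE'.
- move=> phi; apply: dualP => x; rewrite antipodeE -(wantipodeS H).
  rewrite -(sw_coassoc (F := fun a b c : A => antipode a * b * antipode c)); last by lin.
  rewrite tlift_pairing pairing_tlift.
  under eq_tlift => f g.
    rewrite tlift_pairing; under eq_tlift => h k.
      rewrite dualME; under eq_tlift => a b do rewrite dualME tlift_mulC.
      over.
    rewrite tlift_exch; under eq_tlift => a b do rewrite tlift_exch.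
    over.
  rewrite tlift_exch; apply: eq_tlift => a b.
  rewrite tlift_exch pairing_tlift; apply: eq_tlift => c d.
  rewrite -sw2; apply: eq_tlift => f g; apply: eq_tlift => h k.
  by rewrite !antipodeE.
Qed.

Lemma tens2_inj (s t : tens A A) :
  (forall phi psi : D, tlift (fun x y => pairing phi x * pairing psi y : C^o) s =
     tlift (fun x y => pairing phi x * pairing psi y : C^o) t) -> s = t.
Proof.
move=> st; apply: tens_inj => i j.
have E u : tlift (fun x y => crd i x * crd j y : C^o) u =
    tlift (fun x y => pairing (dual_bas i) x * pairing (dual_bas j) y : C^o) u.
  by apply: eq_tlift => a b; rewrite !dual_basE.
by rewrite !E.
Qed.

(** The transpose of the antimultiplicativity of the antipode of the dual. *)
Lemma sw_antipode (V : lmodType C) (f : A -> A -> V) x : bilin f ->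
  \sw(a, b <- antipode x) f a b = \sw(a, b <- x) f (antipode b) (antipode a).
Proof.
move=> bf.
have -> : comul (antipode x) = \sw(a, b <- x) (antipode b ⊗ antipode a).
  apply: tens2_inj => phi psi.
  rewrite -dualME -antipodeE (antipodeM weak_hopf_dual) dualME tlift_tlift.
  by apply: eq_tlift => a b; rewrite !antipodeE tlift_tens 1?mulrC//; lin.
by rewrite tlift_tlift; apply: eq_tlift => a b; rewrite tlift_tens.
Qed.

End DualWeakHopf.

(** * The star operation *)

Section Antilinear.
Variable R : realType.
Local Notation C := R[i].

Lemma antilin0 (V W : lmodType C) (J : V -> W) : antilinear J -> J 0 = 0.
Proof.
move=> aJ; have := aJ (-1) 0 0.
by rewrite scaler0 addr0 rmorphN rmorph1 scaleN1r addNr.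
Qed.

Lemma antilinZ (V W : lmodType C) (J : V -> W) c v :
  antilinear J -> J (c *: v) = c^* *: J v.
Proof. by move=> aJ; rewrite -[c *: v]addr0 aJ antilin0 ?addr0. Qed.

Lemma antilinD (V W : lmodType C) (J : V -> W) v w :
  antilinear J -> J (v + w) = J v + J w.
Proof. by move=> aJ; rewrite -[v]scale1r aJ rmorph1 !scale1r. Qed.

Lemma antilinB (V W : lmodType C) (J : V -> W) v w :
  antilinear J -> J (v - w) = J v - J w.
Proof.
by move=> aJ; rewrite antilinD// -scaleN1r antilinZ// rmorphN rmorph1 scaleN1r.
Qed.

Lemma antilin_sum (V W : lmodType C) (J : V -> W) (I : finType) (v : I -> V) :
  antilinear J -> J (\sum_i v i) = \sum_i J (v i).
Proof.
move=> aJ; apply: (big_morph J); last exact: antilin0.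
by move=> *; apply: antilinD.
Qed.

Lemma conj_antilin : antilinear (fun c : C^o => (c^* : C^o)).
Proof. by move=> c x y; rewrite rmorphD /= rmorphM. Qed.

(** [tstar] conjugates the coefficients, and the antilinear [J] conjugates them back. *)
Lemma antilin_tstar (A : preWeakHopfType R) (V W : lmodType C) (J : V -> W)
    (f : A -> A -> V) t :
  bilin f -> antilinear J ->
  J (tlift f (tstar t)) = tlift (fun a b => J (f (star a) (star b))) t.
Proof.
move=> bf aJ; rewrite /tstar tlift_tlift.
rewrite (eq_tlift (g := fun a b => f (star a) (star b))); last first.
  by move=> a b; rewrite tlift_tens.
rewrite /tlift antilin_sum//; apply: eq_bigr => i _.
rewrite antilin_sum//; apply: eq_bigr => j _.
by rewrite antilinZ// mxE conjCK.
Qed.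

End Antilinear.

(* The C*-norm is dropped: all positivity comes from l and lambda, which yield
   faithful positive functionals on the dual and on A. *)
Record weak_star_hopf (R : realType) (A : preWeakHopfType R) : Prop := WeakStarHopf {
  wshW : weak_hopf A;
  wstarK : involutive (star : A -> A);
  wstarM : forall x y : A, star (x * y) = star y * star x;
  wcomul_star : forall x : A, comul (star x) = tstar (comul x)
}.

Section WeakCstarHopf.
Variables (R : realType) (A : preWeakHopfType R).
Local Notation C := R[i].
Hypothesis starK : involutive (star : A -> A).
Hypothesis starM : forall x y : A, star (x * y) = star y * star x.
Hypothesis comul_star : forall x : A, comul (star x) = tstar (comul x).
Hypothesis comul1 : \sw(a, b <- (1 : A)) \sw(c, d <- (1 : A)) a ⊗ ((b * c) ⊗ d) =
    \sw(a, b <- (1 : A)) a ⊗ comul b.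
Hypothesis counitM : forall x y z : A, counit (x * y * z) =
    \sw(y1, y2 <- y) (counit (x * y1) * counit (y2 * z) : R[i]^o).

Let sw_star' (V W : lmodType C) (J : V -> W) (f : A -> A -> V) x :
  bilin f -> antilinear J ->
  J (\sw(a, b <- star x) f a b) = \sw(a, b <- x) J (f (star a) (star b)).
Proof. by move=> bf aJ; rewrite comul_star antilin_tstar. Qed.

Let star1' : star 1 = 1 :> A.
Proof. by rewrite -[LHS]mulr1 -{2}(starK 1) -starM mulr1 starK. Qed.

Let sw_conj (f : A -> A -> C^o) x : bilin f ->
  (\sw(a, b <- star x) f a b : C)^* = \sw(a, b <- x) ((f (star a) (star b) : C)^* : C^o).
Proof. by move=> bf; apply: (sw_star' _ bf (conj_antilin (R := R))). Qed.

Let sw1_conj (f : A -> A -> C^o) : bilin f ->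
  (\sw(a, b <- (1 : A)) f a b : C)^* =
  \sw(a, b <- (1 : A)) ((f (star a) (star b) : C)^* : C^o).
Proof. by move=> bf; rewrite -{1}star1' sw_conj. Qed.

Let counit_star' (x : A) : counit (star x) = (counit x)^*.
Proof.
have lc : linear (fun x : A => (counit (star x))^* : C^o).
  by move=> c u v; rewrite star_antilinear linearP rmorphD /= rmorphM /= conjCK.
rewrite -[LHS]conjCK -(sw_counitr _ lc); congr (_^*).
have bf : bilin (fun a b : A => counit a *: b) by lin.
have E : \sw(a, b <- x) ((counit (star a))^* *: b) = x.
  rewrite -{2}[x]starK -(counitl (star x)) (sw_star' _ bf); last exact: star_antilinear.
  by apply: eq_tlift => a b; rewrite antilinZ ?starK//; apply: star_antilinear.
rewrite -[in RHS]E (linear_tlift (L := fun y : A => counit y)); last by lin.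
by apply: eq_tlift => a b; rewrite linearZ; apply: mulrC.
Qed.

(** Taking the star of all three legs of [comul1] reverses the product in the middle. Since the star
    is antilinear, the test form [F] is replaced by the conjugate [G] of its composite with the
    stars, which is trilinear again. *)
Lemma comul1_op :
    \sw(a, b <- (1 : A)) \sw(c, d <- (1 : A)) a ⊗ ((c * b) ⊗ d) =
    \sw(a, b <- (1 : A)) a ⊗ comul b.
Proof.
apply: tlift_inj => f bf.
pose F a b c := f a (b ⊗ c).
have tF : trilin F by rewrite /F; lin.
pose G a b c : C^o := (F (star a) (star b) (star c))^*.
have tG : trilin G.
  case: tF => F1 F2 F3; split=> u v c x y; rewrite /G star_antilinear.
  - by rewrite F1 rmorphD /= rmorphM /= conjCK.
  - by rewrite F2 rmorphD /= rmorphM /= conjCK.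
  - by rewrite F3 rmorphD /= rmorphM /= conjCK.
have E : \sw(a, b <- (1 : A)) \sw(c, d <- b) G a c d =
    \sw(a, b <- (1 : A)) \sw(c, d <- (1 : A)) G a (b * c) d.
  exact: (sw_one_of (m := fun b c => b * c) comul1).
rewrite !tlift_tlift.
transitivity (\sw(a, b <- (1 : A)) \sw(c, d <- (1 : A)) F a (c * b) d).
  apply: eq_tlift => a b; rewrite tlift_tlift; apply: eq_tlift => c d.
  by rewrite tlift_tens.
transitivity (\sw(a, b <- (1 : A)) \sw(c, d <- b) F a c d); last first.
  apply: eq_tlift => a b; rewrite tlift_tens// -[comul b in RHS]tlift_id.
  by rewrite (linear_tlift (L := f a)) //; lin.
have := congr1 (fun c : C => c^*) E.
rewrite sw1_conj; last by lin.
rewrite sw1_conj; last by lin.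
move=> E'; symmetry; etransitivity; last (etransitivity; first exact: E').
  apply: eq_tlift => a b; rewrite sw_conj; last by lin.
  by apply: eq_tlift => c d; rewrite /G !starK conjCK.
apply: eq_tlift => a b; rewrite sw1_conj; last by lin.
by apply: eq_tlift => c d; rewrite /G -starM !starK conjCK.
Qed.

(** The conjugate of [counitM] at star z, star y, star x. *)
Lemma counitM_op (x y z : A) : counit (x * y * z) =
    \sw(y1, y2 <- y) (counit (x * y2) * counit (y1 * z) : R[i]^o).
Proof.
rewrite -[LHS]conjCK -counit_star' !starM mulrA counitM.
rewrite sw_conj; last by lin.
apply: eq_tlift => a b; rewrite rmorphM /= -!starM !counit_star' !conjCK.
by rewrite mulrC.
Qed.

End WeakCstarHopf.

Lemma weakCstarHopf_weak_star (R : realType) (A : weakCstarHopfType R) :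
  weak_star_hopf A.
Proof.
split; [split | exact: starK | exact: starM | exact: comul_star].
- exact: comulM.
- exact: comul1.
- exact: (comul1_op starK starM comul_star comul1).
- exact: counitM.
- exact: (counitM_op starK starM comul_star counitM).
- exact: antipodel.
- exact: antipoder.
- exact: antipodeS.
Qed.


Section WeakStarTheory.
Variables (R : realType) (A : preWeakHopfType R).
Hypothesis HS : weak_star_hopf A.
Local Notation C := R[i].
Local Notation S := (@antipode R A).
Local Notation Si := (fun_of_lfun (@antipode R A)^-1%VF).
Local Notation eps := (@counit R A).
Implicit Types x y z a b : A.
Let H := wshW HS.

Lemma sw_star (V W : lmodType C) (J : V -> W) (f : A -> A -> V) x :
  bilin f -> antilinear J ->
  J (\sw(a, b <- star x) f a b) = \sw(a, b <- x) J (f (star a) (star b)).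
Proof. by move=> bf aJ; rewrite (wcomul_star HS) antilin_tstar. Qed.

Lemma sw_star_conj (f : A -> A -> C^o) x : bilin f ->
  (\sw(a, b <- star x) f a b : C)^* = \sw(a, b <- x) ((f (star a) (star b) : C)^* : C^o).
Proof. by move=> bf; apply: (sw_star _ bf (conj_antilin (R := R))). Qed.

Lemma star1 : star 1 = 1 :> A.
Proof. by rewrite -[LHS]mulr1 -{2}(wstarK HS 1) -(wstarM HS) mulr1 (wstarK HS). Qed.

(** The conjugate of x |-> eps(star x) is again a counit, and a counit is unique. *)
Lemma counit_star x : eps (star x) = (eps x)^*.
Proof.
have lc : linear (fun x : A => (eps (star x))^* : C^o).
  by move=> c u v; rewrite star_antilinear linearP rmorphD /= rmorphM /= conjCK.
rewrite -[LHS]conjCK -(sw_counitr _ lc); congr (_^*).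
have bf : bilin (fun a b : A => eps a *: b) by lin.
have E : \sw(a, b <- x) ((eps (star a))^* *: b) = x.
  rewrite -{2}[x](wstarK HS) -(counitl (star x)) (sw_star _ bf); last exact: star_antilinear.
  by apply: eq_tlift => a b; rewrite antilinZ ?(wstarK HS)//; apply: star_antilinear.
rewrite -[in RHS]E (linear_tlift (L := fun y : A => eps y)); last by lin.
by apply: eq_tlift => a b; rewrite linearZ; apply: mulrC.
Qed.

Lemma PiL_starE x : star (PiL (star x)) = \sw(u, v <- (1 : A)) (eps (x * u) *: v).
Proof.
rewrite PiLE -{1}star1 sw_star; [|by lin|exact: star_antilinear].
apply: eq_tlift => u v; rewrite antilinZ; last exact: star_antilinear.
by rewrite -(wstarM HS) counit_star conjCK (wstarK HS).
Qed.

Lemma PiR_starE x : star (PiR (star x)) = \sw(u, v <- (1 : A)) (eps (v * x) *: u).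
Proof.
rewrite PiRE -{1}star1 sw_star; [|by lin|exact: star_antilinear].
apply: eq_tlift => u v; rewrite antilinZ; last exact: star_antilinear.
by rewrite -(wstarM HS) counit_star conjCK (wstarK HS).
Qed.

Lemma inL_star x : inL x -> inL (star x).
Proof.
move=> xL; rewrite -[x]xL -[x](wstarK HS) PiL_starE.
by apply: (inL_leg H (f := fun u => eps (star x * u))); lin.
Qed.

Lemma inR_star x : inR x -> inR (star x).
Proof.
move=> xR; rewrite -[x]xR -[x](wstarK HS) PiR_starE.
by apply: (inR_leg H (f := fun u => eps (u * star x))); lin.
Qed.

(** The inverse of S, as [antipodeK] will show. The star of the antipode axiom for [PiL] evaluates
    T(x2) x1. *)
Let T x := star (S (star x)).

Let T_lin : linear T.
Proof.
by move=> c x y; rewrite /T star_antilinear linearP star_antilinear conjCK.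
Qed.

Let TM x y : T (x * y) = T y * T x.
Proof. by rewrite /T (wstarM HS) (antipodeM H) (wstarM HS). Qed.

Let T_PiL x : \sw(a, b <- x) (T b * a) = star (PiL (star x)).
Proof.
rewrite -(PiL_antipode H) sw_star; [|by lin|exact: star_antilinear].
by apply: eq_tlift => a b; rewrite (wstarM HS) (wstarK HS).
Qed.

Let TS_inL x : inL x -> T (S x) = x.
Proof.
move=> xL; have T_inR z : inR z -> T z = star (PiL (star z)).
  move=> zR; rewrite -T_PiL (sw_inRr H)//; last by lin.
  under eq_tlift => a b do rewrite TM -mulrA.
  by rewrite -mul_tlift T_PiL star1 PiL1 star1 mulr1.
rewrite T_inR ?(antipode_inL H)//; last exact: inR_PiR.
rewrite PiL_starE -[RHS]counitl [RHS](sw_inLl H)//; last by lin.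
by apply: eq_tlift => u v; rewrite (counit_PiR H).
Qed.

(** T(PiL(x2)) x1 is evaluated in two ways. By [sw_PiL2] it is T(1_2) 1_1 x = x. Expanding [PiL]
    gives T(S(x3)) T(x2) x1, where T(x2) x1 combines to elements of A_L, on which T S is the
    identity; this leads to T(S(x)). *)
Lemma antipodeK x : star (S (star (S x))) = x.
Proof.
rewrite -/(T (S x)); symmetry.
transitivity (\sw(a, b <- x) (T (PiL b) * a)).
  rewrite (sw_PiL2 H (f := fun a b => T b * a)); last by lin.
  under eq_tlift => a b do rewrite mulrA.
  by rewrite -tlift_mul T_PiL star1 PiL1 star1 mul1r.
transitivity (\sw(a, b <- x) \sw(c, d <- b) (T (S d) * (T c * a))).
  apply: eq_tlift => a b; rewrite -(PiL_antipode H) (linear_tlift (L := T))// tlift_mul.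
  by apply: eq_tlift => c d; rewrite TM mulrA.
rewrite -(sw_coassoc (F := fun a c d => T (S d) * (T c * a))); last by lin.
transitivity (\sw(b, d <- x) T (S (d * star (PiL (star b))))).
  apply: eq_tlift => b d; rewrite -mul_tlift T_PiL (antipodeM H) TM.
  by rewrite [T (S (star _))]TS_inL//; apply: inL_star; apply: inL_PiL.
rewrite -(linear_tlift (L := fun y => T (S y))); last by lin.
congr (T (S _)); rewrite -[RHS]mulr1 -[RHS]counitl.
rewrite (sw_mul H (f := fun a b => eps a *: b)); last by lin.
apply: eq_tlift => b d; rewrite PiL_starE mul_tlift.
by apply: eq_tlift => u v; rewrite scalerAr.
Qed.

Lemma antipode_lker0 : lker S == 0%VS.
Proof. by apply/lker0P => x y e; rewrite -[x]antipodeK e antipodeK. Qed.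

Lemma antipodeKi x : S^-1%VF (S x) = x.
Proof. by rewrite lker0_lfunK// antipode_lker0. Qed.

Lemma antipodeiK x : S (S^-1%VF x) = x.
Proof. by rewrite lker0_lfunVK// antipode_lker0. Qed.

Lemma antipode_star x : S (star x) = star (S^-1%VF x).
Proof. by rewrite -[x in LHS]antipodeiK -[LHS](wstarK HS) antipodeK. Qed.

Lemma antipodei_star x : S^-1%VF (star x) = star (S x).
Proof. by rewrite -[x in LHS](antipodeKi x) -antipode_star antipodeKi. Qed.

Lemma antipodeiM x y : S^-1%VF (x * y) = S^-1%VF y * S^-1%VF x.
Proof.
by rewrite -[RHS]antipodeKi (antipodeM H) !antipodeiK.
Qed.

Lemma antipodei1 : S^-1%VF 1 = 1.
Proof. by rewrite -{1}(antipode1 H) antipodeKi. Qed.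

Lemma inR_antipodei x : inL x -> inR (S^-1%VF x).
Proof.
move=> xL; rewrite -[x](wstarK HS) antipodei_star.
by apply: inR_star; apply: (inR_antipode H); apply: inL_star.
Qed.

Lemma inL_antipodei x : inR x -> inL (S^-1%VF x).
Proof.
move=> xR; rewrite -[x](wstarK HS) antipodei_star.
by apply: inL_star; apply: (inL_antipode H); apply: inR_star.
Qed.

Lemma counit_antipodei x : eps (S^-1%VF x) = eps x.
Proof. by rewrite -[in RHS](antipodeiK x) (counit_antipode H). Qed.

Lemma sw_antipodei (V : lmodType C) (f : A -> A -> V) x : bilin f ->
  \sw(a, b <- S^-1%VF x) f a b = \sw(a, b <- x) f (S^-1%VF b) (S^-1%VF a).
Proof.
move=> bf; rewrite -[x in RHS]antipodeiK (sw_antipode H); last by lin.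
by apply: eq_tlift => a b; rewrite !antipodeKi.
Qed.

End WeakStarTheory.

Section DualStar.
Variables (R : realType) (A : preWeakHopfType R).
Hypothesis HS : weak_star_hopf A.
Local Notation C := R[i].
Local Notation S := (@antipode R A).
Let H := wshW HS.

Lemma starE (phi : dual A) x : pairing (star phi) x = (pairing phi (star (S x)))^*.
Proof. exact: dual_starE. Qed.

Lemma weak_star_hopf_dual : weak_star_hopf (dual A).
Proof.
split; first exact: weak_hopf_dual.
- by move=> phi; apply: dualP => x; rewrite !starE (antipodeK HS) conjCK.
- move=> phi psi; apply: dualP => x; rewrite starE !dualME.
  rewrite (sw_star_conj HS); last by lin.
  pose F a b : C^o := (pairing phi (star a) * pairing psi (star b))^*.
  rewrite (sw_antipode H (f := F)); last first.
    split=> v c y z; rewrite /F star_antilinear.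
      by rewrite (pairing_linearr phi) mulrDl -mulrA rmorphD /= rmorphM /= conjCK.
    by rewrite (pairing_linearr psi) mulrDr mulrCA rmorphD /= rmorphM /= conjCK.
  by apply: eq_tlift => a b; rewrite /F !starE rmorphM /= mulrC.
- move=> phi; apply: dual_tens2_inj => a b.
  rewrite dual_comulE' starE (antipodeM H) (wstarM HS) -dual_comulE'.
  have := antilin_tstar (comul phi) _ (conj_antilin (R := R)).
  move=> /(_ (fun f g : dual A => pairing f a * pairing g b : C^o)) /= E.
  rewrite -[RHS]conjCK E; last by lin.
  by congr (_^*); apply: eq_tlift => f g; rewrite !starE rmorphM /= !conjCK.
Qed.
End DualStar.

(** * Integrals *)

Section Integrals.
Variables (R : realType) (A : preWeakHopfType R).
Hypothesis HS : weak_star_hopf A.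
Local Notation C := R[i].
Local Notation S := (@antipode R A).
Local Notation Si := (fun_of_lfun (@antipode R A)^-1%VF).
Local Notation eps := (@counit R A).
Implicit Types (x y z a b l h r : A) (phi psi chi : dual A).
Let H := wshW HS.
Let DH := weak_hopf_dual H.

Lemma pairing_inj a b : (forall phi, pairing phi a = pairing phi b) -> a = b.
Proof.
move=> ab; rewrite [a]crd_sum [b]crd_sum; apply: eq_bigr => i _.
by rewrite -!dual_basE ab.
Qed.

Lemma pairing_dual_act psi phi a :
  pairing psi (dual_act phi a) = pairing (psi * phi) a.
Proof.
rewrite /dual_act pairing_tlift dualME.
by apply: eq_tlift => u v; rewrite pairingZr mulrC.
Qed.

Lemma dual_act_linear phi : linear (dual_act phi).
Proof. by rewrite /dual_act; lin. Qed.
HB.instance Definition _ phi :=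
  GRing.isLinear.Build C A A _ (dual_act phi) (dual_act_linear phi).

Lemma dual_act_linearl a : linear (fun phi => dual_act phi a).
Proof. by rewrite /dual_act; lin. Qed.

Lemma dual_act_mul phi psi a :
  dual_act (phi * psi) a = dual_act phi (dual_act psi a).
Proof. by apply: pairing_inj => chi; rewrite !pairing_dual_act mulrA. Qed.

Lemma dual_act1 a : dual_act 1 a = a.
Proof. by apply: pairing_inj => chi; rewrite pairing_dual_act mulr1. Qed.

Lemma counit_dual_act phi a : eps (dual_act phi a) = pairing phi a.
Proof. by rewrite -dual1E pairing_dual_act mul1r. Qed.

Lemma dual_act_mulLl phi x a : inL x -> dual_act phi (x * a) = x * dual_act phi a.
Proof.
move=> xL; rewrite /dual_act (sw_mulLl H)//; last by lin.
by rewrite mul_tlift; apply: eq_tlift => u v; rewrite scalerAr.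
Qed.

Lemma dual_act_mulrL phi x a : inL x -> dual_act phi (a * x) = dual_act phi a * x.
Proof.
move=> xL; rewrite /dual_act (sw_mulrL H)//; last by lin.
by rewrite tlift_mul; apply: eq_tlift => u v; rewrite scalerAl.
Qed.

Lemma act_dual_mul a b phi : act_dual (a * b) phi = act_dual a (act_dual b phi).
Proof. by apply: dualP => c; rewrite !act_dualE mulrA. Qed.

Lemma act_dual1 phi : act_dual 1 phi = phi.
Proof. by apply: dualP => c; rewrite act_dualE mulr1. Qed.

(** The map x |-> x ⇀ 1 embeds A_L as a star algebra into the right subalgebra of the dual; see also
    [act_dual1M], [star_act_dual1] and [act_dual1_inj]. It allows d_R(lambda) to be handled inside
    A_L. *)
Lemma act_dual1_mull x phi : inL x -> act_dual x 1 * phi = act_dual x phi.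
Proof.
move=> xL; apply: dualP => b; rewrite dualME act_dualE.
rewrite -[b * x](counitl) pairing_tlift (sw_mulrL H)//; last by lin.
by apply: eq_tlift => u v; rewrite act_dualE pairingZr.
Qed.

Lemma act_dual1_mulr x phi : inL x -> phi * act_dual x 1 = act_dual (Si x) phi.
Proof.
move=> xL; have yR : inR (Si x) by apply: inR_antipodei.
apply: dualP => b; rewrite dualME act_dualE.
rewrite -[b * _](counitr) pairing_tlift (sw_mulrR H)//; last by lin.
apply: eq_tlift => u v; rewrite act_dualE pairingZr -(counit_inR H)//.
by rewrite (antipodeiK HS) mulrC.
Qed.

Lemma act_dual1M x y : inL x -> act_dual x 1 * act_dual y 1 = act_dual (x * y) 1 :> dual A.
Proof. by move=> xL; rewrite act_dual1_mull// act_dual_mul. Qed.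

Lemma star_act_dual1 x : inL x -> star (act_dual x 1) = act_dual (star x) 1 :> dual A.
Proof.
move=> xL; apply: dualP => b; rewrite starE !act_dualE !dual1E.
rewrite -(counit_star HS) (wstarM HS) (wstarK HS).
have yR : inR (Si (star x)).
  by apply: (inR_antipodei HS); apply: (inL_star HS).
rewrite -[X in eps (X * S b)](antipodeiK HS) -(antipodeM H) (counit_antipode H).
by rewrite -(counit_inR H)// (antipodeiK HS).
Qed.

Lemma act_dual1_inj x : inL x -> act_dual x 1 = 0 :> dual A -> x = 0.
Proof.
move=> xL x0; rewrite -xL PiLE /tlift big1// => i _; rewrite big1// => j _.
by rewrite -dual1E -act_dualE x0 /pairing zero_lfunE scale0r scaler0.
Qed.

Lemma left_integralE l : left_integral l <-> forall a, a * l = PiL a * l.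
Proof. by split=> lE a; rewrite lE (PiL_antipode H). Qed.

Lemma right_integralE r : right_integral r <-> forall a, r * a = r * PiR a.
Proof. by split=> rE a; rewrite rE (PiR_antipode H). Qed.

(** S(x) l1 ⊗ l2 = S(x1) PiL(x2) l1 ⊗ l2 = S(x1) x2 l1 ⊗ x3 l2 = PiR(x1) l1 ⊗ x2 l2 = 1_1 l1 ⊗ x 1_2
    l2; the second step is the integral property. *)
Lemma left_integral_sw (V : lmodType C) (f : A -> A -> V) l x :
  left_integral l -> bilin f ->
  \sw(a, b <- l) f a (x * b) = \sw(a, b <- l) f (S x * a) b.
Proof.
move=> /left_integralE lE bf; symmetry.
transitivity (\sw(x1, x2 <- x) \sw(a, b <- l) f (S x1 * PiL x2 * a) b).
  rewrite tlift_exch; apply: eq_tlift => a b.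
  rewrite [S x](antipode_PiL H) tlift_mul (linear_tlift (L := fun c => f c b)) //; lin.
transitivity (\sw(x1, x2 <- x) \sw(c, d <- x2) \sw(a, b <- l) f (S x1 * c * a) (d * b)).
  apply: eq_tlift => x1 x2.
  transitivity (\sw(a, b <- x2 * l) f (S x1 * a) b).
    rewrite lE (sw_mulLl H); [|by lin|exact: inL_PiL].
    by apply: eq_tlift => a b; rewrite mulrA.
  rewrite (sw_mul H); last by lin.
  by apply: eq_tlift => c d; apply: eq_tlift => a b; rewrite mulrA.
rewrite -(sw_coassoc (F := fun x1 c d => \sw(a, b <- l) f (S x1 * c * a) (d * b))); last by lin.
transitivity (\sw(u, v <- x) \sw(a, b <- l) f (PiR u * a) (v * b)).
  apply: eq_tlift => u v; rewrite tlift_exch; apply: eq_tlift => a b.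
  rewrite -(PiR_antipode H) tlift_mul (linear_tlift (L := fun c => f c (v * b))) //; lin.
rewrite (sw_PiR1 H (f := fun u v => \sw(a, b <- l) f (u * a) (v * b))); last by lin.
rewrite -[l in RHS]mul1r [RHS](sw_mul H); last by lin.
by apply: eq_tlift => u v; apply: eq_tlift => a b; rewrite mulrA.
Qed.

Lemma PiL_of_antipode x : PiL (S x) = S (PiR x).
Proof.
rewrite -(PiL_antipode H) (sw_antipode H); last by lin.
rewrite -(PiR_antipode H) fun_tlift /=.
by apply: eq_tlift => a b; rewrite (antipodeM H).
Qed.

Lemma PiR_of_antipode x : PiR (S x) = S (PiL x).
Proof.
rewrite -(PiR_antipode H) (sw_antipode H); last by lin.
rewrite -(PiL_antipode H) fun_tlift /=.
by apply: eq_tlift => a b; rewrite (antipodeM H).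
Qed.

Lemma normalized_haarE h : normalized_haar h <->
  [/\ left_integral h, right_integral h, PiR h = 1 & PiL h = 1].
Proof. by rewrite -(PiR_antipode H) -(PiL_antipode H). Qed.

(** S(l) is a right integral with PiL(S(l)) = 1, whence S(l) = S(l) PiR(l) = S(l) l = PiL(S(l)) l =
    l. *)
Lemma left_normalized_haar l : left_integral l -> PiR l = 1 ->
  normalized_haar l /\ S l = l.
Proof.
move=> /left_integralE lE l1.
have rE a : S l * a = S l * PiR a.
  rewrite -[a](antipodeiK HS) -(antipodeM H) lE (antipodeM H).
  by rewrite -PiR_of_antipode.
have Sl1 : PiL (S l) = 1 by rewrite PiL_of_antipode l1 (antipode1 H).
have Sll : S l = l.
  by rewrite -[LHS]mulr1 -l1 -rE lE Sl1 mul1r.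
split=> //; apply/normalized_haarE; split=> //.
- exact/left_integralE.
- by apply/right_integralE; rewrite -Sll.
- by rewrite -Sll.
Qed.

Section Haar.
Variable h : A.
Hypothesis hh : normalized_haar h.

Lemma haar_l a : a * h = PiL a * h.
Proof. by case/normalized_haarE: hh => /left_integralE. Qed.

Lemma haar_r a : h * a = h * PiR a.
Proof. by case/normalized_haarE: hh => _ /right_integralE. Qed.

Lemma PiR_haar : PiR h = 1. Proof. by case/normalized_haarE: hh. Qed.
Lemma PiL_haar : PiL h = 1. Proof. by case/normalized_haarE: hh. Qed.

Lemma haar_unique h' : normalized_haar h' -> h' = h.
Proof.
case/normalized_haarE => /left_integralE h'l /right_integralE h'r h'R h'L.
by rewrite -[LHS]mulr1 -PiR_haar -h'r haar_l h'L mul1r.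
Qed.

Lemma haarE : haar A = h.
Proof. by apply: xget_unique => // h'; apply: haar_unique. Qed.

Lemma antipode_haar : S h = h.
Proof.
case/normalized_haarE: hh => hl hr hR hL.
by case: (left_normalized_haar hl hR).
Qed.

(** PiL(star h) = 1 gives star h * h = h, and the left-hand side is self-adjoint. *)
Lemma star_haar : star h = h.
Proof.
have PL : PiL (star h) = 1.
  rewrite -[LHS](wstarK HS) -[RHS](star1 HS) (PiL_starE HS); congr star.
  rewrite -[RHS]counitl; apply: eq_tlift => u v.
  by rewrite -(counit_PiR H) PiR_haar mul1r.
have hh' : star h * h = h by rewrite haar_l PL mul1r.
by rewrite -{1}hh' (wstarM HS) (wstarK HS) hh'.
Qed.

Lemma haar_mulR y : inR y -> h * y = h * Si y.
Proof.
move=> yR; rewrite [h * Si y]haar_r -(antipode_inL H) ?(antipodeiK HS)//.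
exact: inL_antipodei.
Qed.

Lemma haar_mulL x : inL x -> h * x = h * S x.
Proof. by move=> xL; rewrite haar_r (antipode_inL H). Qed.

Lemma mulR_haar y : inR y -> y * h = S y * h.
Proof. by move=> yR; rewrite haar_l (antipode_inR H). Qed.

Lemma left_integral_haar l : left_integral l -> l = h * PiR l.
Proof. by move=> /left_integralE lE; rewrite -haar_r lE PiL_haar mul1r. Qed.

End Haar.

Lemma d_RE l : d_R l = PiR l. Proof. exact: PiR_antipode. Qed.

Lemma n_RE l : n_R l = Si (PiL l).
Proof.
rewrite -[LHS](antipodeKi HS) /n_R fun_tlift /= -(PiL_antipode H).
by congr Si; apply: eq_tlift => a b; rewrite (antipodeM H) (antipodeiK HS).
Qed.

Lemma inR_n_R l : inR (n_R l).
Proof. by rewrite n_RE; apply: inR_antipodei => //; apply: inL_PiL. Qed.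

(** By [left_integral_sw] a factor x before l2 becomes S(x) before l1, and S^-1 turns this into x on
    the right. *)
Lemma n_R_comm l x : left_integral l -> x * n_R l = n_R l * x.
Proof.
move=> lL; rewrite /n_R mul_tlift tlift_mul.
under eq_tlift => a b do rewrite mulrA.
rewrite (left_integral_sw (f := fun a b => b * Si a))//; last by lin.
by apply: eq_tlift => a b; rewrite (antipodeiM HS) (antipodeKi HS) mulrA.
Qed.

Lemma right_subalgP y : inR y -> right_subalg y.
Proof.
move=> yR; exists (linfun (fun b : A => eps (y * b) : C^o)).
rewrite -{1}yR PiRE; apply: eq_tlift => a b.
by rewrite /pairing linear_linfun//; lin.
Qed.

Lemma left_subalg_inL x : left_subalg x -> inL x.
Proof. by case=> phi ->; apply: (inL_leg H (f := pairing phi)); lin. Qed.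

End Integrals.

(** * Integrals on the dual, and the bidual *)

Section DualIntegral.
Variables (R : realType) (A : preWeakHopfType R).
Hypothesis HS : weak_star_hopf A.
Local Notation C := R[i].
Local Notation S := (@antipode R A).
Local Notation eps := (@counit R A).
Implicit Types (x y z a b l h r : A) (phi psi chi : dual A).
Let H := wshW HS.

Section LeftIntegral.
Variable lambda : dual A.
Hypothesis lambdaL : left_integral lambda.

(** Tested on phi: [PiL] is its own transpose, and PiL(phi) lambda = phi lambda. *)
Lemma inL_dual_act a : inL (dual_act lambda a).
Proof.
have /(left_integralE (weak_star_hopf_dual HS)) lE := lambdaL.
apply: pairing_inj => phi.
by rewrite -dual_PiLE !pairing_dual_act -lE.
Qed.

Lemma pairing_inLl x a : inL x -> pairing lambda (x * a) = eps (x * dual_act lambda a).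
Proof. by move=> xL; rewrite -(dual_act_mulLl HS)// counit_dual_act. Qed.

Lemma pairing_inLr x a : inL x -> pairing lambda (a * x) = eps (dual_act lambda a * x).
Proof. by move=> xL; rewrite -(dual_act_mulrL HS)// counit_dual_act. Qed.

End LeftIntegral.

Lemma bidual_linear : linear (@bidual R A).
Proof.
move=> c x y; apply: dualP => phi.
by rewrite /pairing add_lfunE scale_lfunE -!/(pairing _ _) !bidualE pairing_linearr.
Qed.

Lemma bidual_surj (Phi : dual (dual A)) : exists a, Phi = bidual a.
Proof.
exists (\sum_i pairing Phi (dual_bas i) *: bas i); apply: dualP => phi.
rewrite bidualE (linear_sumZ (L := pairing phi : A -> C^o)); last by lin.
rewrite {1}[phi]dual_bas_sum (linear_sumZ (L := pairing Phi : _ -> C^o)); last by lin.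
by apply: eq_bigr => i _; apply: mulrC.
Qed.

Lemma bidual_inj : injective (@bidual R A).
Proof. by move=> a b ab; apply: pairing_inj => phi; rewrite -[LHS]bidualE -[RHS]bidualE ab. Qed.

Lemma bidualM a b : bidual (a * b) = bidual a * bidual b.
Proof.
apply: dualP => phi; rewrite bidualE dualME -dual_comulE'.
by apply: eq_tlift => f g; rewrite !bidualE.
Qed.

Lemma bidual_star a : bidual (star a) = star (bidual a).
Proof.
apply: dualP => phi; rewrite starE !bidualE starE antipodeE conjCK.
by rewrite (antipode_star HS) (antipodeKi HS).
Qed.

Lemma bidual_PiL a : PiL (bidual a) = bidual (PiL a).
Proof. by apply: dualP => phi; rewrite dual_PiLE !bidualE dual_PiLE. Qed.

Lemma dual_act_bidual l phi : dual_act (bidual l) phi = act_dual l phi.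
Proof.
apply: dualP => b; rewrite act_dualE -dual_comulE' /dual_act tlift_pairing.
by apply: eq_tlift => f g; rewrite pairingZ bidualE mulrC.
Qed.

Lemma bidual_left_integral l : left_integral (bidual l) <-> left_integral l.
Proof.
have DDH := weak_star_hopf_dual (weak_star_hopf_dual HS).
split=> [/(left_integralE DDH) lE|/(left_integralE HS) lE].
  apply/(left_integralE HS) => a; apply: bidual_inj.
  by rewrite !bidualM lE bidual_PiL.
apply/(left_integralE DDH) => Phi; have [a ->] := bidual_surj Phi.
by rewrite bidual_PiL -!bidualM lE.
Qed.

End DualIntegral.

Section BidualIntegral.
Variables (R : realType) (A : preWeakHopfType R).
Hypothesis HS : weak_star_hopf A.
Let DHS := weak_star_hopf_dual HS.
Implicit Types (l : A) (lambda phi : dual A).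

(** Positivity of lambda refers to functionals on the dual, and all of these are evaluations at
    elements of A. *)
Lemma positive_dual lambda : positive_integral lambda <->
  left_integral lambda /\ forall a : A, 0 <= pairing lambda (star a * a).
Proof.
split=> -[lL lp]; split=> //.
  by move=> a; rewrite -bidualE bidualM (bidual_star HS).
move=> Phi; have [a ->] := bidual_surj Phi.
by rewrite -(bidual_star HS) -bidualM bidualE.
Qed.

Lemma nondegenerate_dual lambda : nondegenerate_integral lambda <->
  (forall a : A, (forall b, pairing lambda (a * b) = 0) -> a = 0) /\
  (forall b : A, (forall a, pairing lambda (a * b) = 0) -> b = 0).
Proof.
have bid0 (a : A) : bidual a = 0 <-> a = 0.
  have b0 : bidual (0 : A) = 0 by apply: (lin0 (@bidual_linear R A)).
  by split=> [|->//]; rewrite -b0 => /bidual_inj.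
split=> -[n1 n2]; split.
- move=> a a0; apply/bid0/n1 => Psi; have [b ->] := bidual_surj Psi.
  by rewrite -bidualM bidualE.
- move=> b b0; apply/bid0/n2 => Phi; have [a ->] := bidual_surj Phi.
  by rewrite -bidualM bidualE.
- move=> Phi; have [a ->] := bidual_surj Phi => a0; apply/bid0/n1 => b.
  by rewrite -bidualE bidualM.
- move=> Psi; have [b ->] := bidual_surj Psi => b0; apply/bid0/n2 => a.
  by rewrite -bidualE bidualM.
Qed.

End BidualIntegral.

Section Bidual.
Variables (R : realType) (A : preWeakHopfType R).
Hypothesis HS : weak_star_hopf A.
Let DHS := weak_star_hopf_dual HS.
Implicit Types (l : A).

Lemma positive_bidual l : positive_integral l -> positive_integral (bidual l).
Proof.
move=> [lL lp]; apply/(positive_dual DHS); split=> [|phi].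
  exact/(bidual_left_integral HS).
by rewrite bidualE.
Qed.

Lemma nondegenerate_bidual l :
  nondegenerate_integral l -> nondegenerate_integral (bidual l).
Proof.
move=> [n1 n2]; apply/nondegenerate_dual.
split=> [phi n|psi n]; [apply: n1 => psi|apply: n2 => phi].
  by rewrite -bidualE n.
by rewrite -bidualE n.
Qed.

End Bidual.

(** * Positive elements *)

Section PolynomialCalculus.
Variables (R : realType) (A : falgType R[i]).
Local Notation C := R[i].
Implicit Types (s : A) (p q : {poly C}) (cs : seq C).
Local Notation ev := (@horner_alg C A).

(** Used to keep polynomials in s inside A_L, inside A_R, and among the fixed points of S^2. *)
Lemma horner_alg_ind (U : A -> Prop) s :
  U 1 -> U s -> (forall x y, U x -> U y -> U (x * y)) ->
  (forall (c : C) x y, U x -> U y -> U (c *: x + y)) ->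
  forall p, U (ev s p).
Proof.
move=> U1 Us UM UD; have UZ (c : C) : U c%:A.
  have U0 : U 0 by rewrite -[0](addNr 1) -scaleN1r; apply: UD.
  by rewrite -[c%:A]addr0; apply: UD.
elim/poly_ind => [|p c Up]; first by rewrite rmorph0 -(scale0r 1); apply: UZ.
rewrite rmorphD /= rmorphM /= horner_algX horner_algC -[X in U (X + _)]scale1r.
by apply: UD => //; apply: UM.
Qed.

Lemma horner_alg_comp s p q : ev s (p \Po q) = ev (ev s q) p.
Proof.
elim/poly_ind: p => [|p c IH]; first by rewrite comp_poly0 !rmorph0.
rewrite comp_polyD comp_polyM comp_polyX comp_polyC !rmorphD /= !rmorphM /=.
by rewrite IH horner_algX !horner_algC.
Qed.

Lemma interpolation (g : C -> C) cs : uniq cs ->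
  exists p, forall c, c \in cs -> p.[c] = g c.
Proof.
elim: cs => [|c cs IH] /= => [_|/andP[ccs /IH [p pE]]]; first by exists 0.
pose P := \prod_(z <- cs) ('X - z%:P).
have P0 z : (P.[z] == 0) = (z \in cs) by rewrite -/(root P z) root_prod_XsubC.
exists (p + ((g c - p.[c]) / P.[c]) *: P) => d.
rewrite inE hornerD hornerZ => /predU1P[->|dcs].
  by rewrite divfK ?P0// addrC subrK.
have /eqP -> : P.[d] == 0 by rewrite P0.
by rewrite mulr0 addr0 pE.
Qed.

(** s is diagonalizable with spectrum inside [cs], which may contain more than the eigenvalues. *)
Definition spectral s cs :=
  uniq cs /\ ev s (\prod_(c <- cs) ('X - c%:P)) = 0.

Lemma spectral_eq s cs p q : spectral s cs ->
  (forall c, c \in cs -> p.[c] = q.[c]) -> ev s p = ev s q.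
Proof.
move=> [ucs cs0] pq; apply/eqP; rewrite -subr_eq0 -rmorphB /=.
have /dvdpP [t ->] : \prod_(c <- cs) ('X - c%:P) %| p - q.
  apply: uniq_roots_dvdp; rewrite ?uniq_rootsE//.
  by apply/allP => c ccs; rewrite rootE hornerD hornerN pq// subrr.
by rewrite rmorphM /= cs0 mulr0.
Qed.

Lemma annihilator s : exists2 p, p != 0 & ev s p = 0.
Proof.
pose n := \dim {:A}; pose X := [tuple s ^+ i | i < n.+1].
have nX : ~~ free X.
  rewrite /free size_tuple; apply/eqP => dX.
  by have := dimvS (subvf <<X>>); rewrite dX ltnn.
apply: contrapT => nP; move/negP: nX; apply; apply/freeP => k k0 i.
apply: contrapT => ki; apply: nP; exists (\poly_(j < n.+1) k (inord j)).
  apply/eqP => /(congr1 (fun p : {poly C} => p`_i)).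
  by rewrite coef_poly coef0 ltn_ord inord_val => /ki.
rewrite poly_def rmorph_sum /= -[RHS]k0; apply: eq_bigr => j _.
rewrite -mul_polyC rmorphM /= horner_algC rmorphXn /= horner_algX mulr_algl.
have -> : X`_j = s ^+ j by rewrite -tnth_nth tnth_mktuple.
by rewrite inord_val.
Qed.

End PolynomialCalculus.

Section Spectral.
Variables (R : realType) (A : preWeakHopfType R).
Hypothesis HS : weak_star_hopf A.
Local Notation C := R[i].
Local Notation ev := (@horner_alg C A).
Implicit Types (s x y a b : A) (p q : {poly C}) (cs : seq C).

Lemma star0 : star 0 = 0 :> A.
Proof. exact: (antilin0 (@star_antilinear R A)). Qed.

Lemma starZ (c : C) a : star (c *: a) = c^* *: star a.
Proof. exact: (antilinZ _ _ (@star_antilinear R A)). Qed.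

Lemma starD a b : star (a + b) = star a + star b.
Proof. exact: (antilinD _ _ (@star_antilinear R A)). Qed.

Lemma starB a b : star (a - b) = star a - star b.
Proof. exact: (antilinB _ _ (@star_antilinear R A)). Qed.

Lemma star_horner s p : star s = s -> star (ev s p) = ev s (map_poly Num.conj p).
Proof.
move=> ss; elim/poly_ind: p => [|p c IH]; first by rewrite !rmorph0 star0.
rewrite !rmorphD /= !rmorphM /= map_polyX map_polyC /= !horner_algX !horner_algC.
rewrite starD (wstarM HS) IH ss starZ (star1 HS); congr (_ + _).
by rewrite -[X in X * _ = _](horner_algX s) -rmorphM mulrC rmorphM /= horner_algX.
Qed.

Lemma spectral_star s cs p : star s = s -> spectral s cs ->
  (forall c, c \in cs -> 0 <= c) ->
  (forall c, c \in cs -> (p.[c])^* = p.[c]) -> star (ev s p) = ev s p.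
Proof.
move=> ss sc cs0 pr; rewrite star_horner//; apply: (spectral_eq sc) => c ccs.
have cr : c^* = c by apply/CrealP/ger0_real/cs0.
by rewrite -{1}cr horner_map /= pr.
Qed.

Record star_subalgebra (U : A -> Prop) : Prop := StarSubalgebra {
  sub1 : U 1;
  subM : forall x y, U x -> U y -> U (x * y);
  subZD : forall (c : C) x y, U x -> U y -> U (c *: x + y);
  sub_star : forall x, U x -> U (star x)
}.

(** Positivity is included. [U] is a parameter because eps will be used on A_L and lambda on all of
    A. *)
Definition faithful (U : A -> Prop) (f : A -> C) :=
  forall x, U x -> x != 0 -> 0 < f (star x * x).

Section Faithful.
Variables (U : A -> Prop) (f : A -> C).
Hypothesis US : star_subalgebra U.
Hypothesis fl : linear (f : A -> C^o).
Hypothesis ff : faithful U f.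

Lemma sub_horner s p : U s -> U (ev s p).
Proof. by case: US => U1 UM UD _ Us; apply: horner_alg_ind. Qed.

Lemma subB x y : U x -> U y -> U (x - y).
Proof. by move=> Ux Uy; rewrite addrC -scaleN1r; apply: (subZD US). Qed.

Lemma hermitian_form (b : A -> A -> C) :
  (forall x, linear (b x : A -> C^o)) ->
  (forall y, antilinear ((b^~ y) : A -> C^o)) ->
  (forall x, U x -> b x x \is Num.real) ->
  forall x y, U x -> U y -> b y x = (b x y)^*.
Proof.
move=> bl br breal x y Ux Uy.
have E c : b (c *: y + x) (c *: y + x) =
    c^* * c * b y y + (c^* * b y x + c * b x y) + b x x.
  by rewrite bl !br !scaleCo; ring.
have rE c : (c^* * b y x + c * b x y) \is Num.real.
  have Ucyx : U (c *: y + x) by apply: (subZD US).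
  have := breal _ Ucyx; rewrite E.
  have r1 : c^* * c * b y y \is Num.real.
    by rewrite rpredM ?breal// mulrC -normCK rpredX// normr_real.
  move=> r2; rewrite -[X in X \is _](addrK (b x x)) -[X in X - _](addKr (c^* * c * b y y)).
  by rewrite rpredB ?breal// rpredD// ?rpredN// addrA.
have /CrealP := rE 1; have /CrealP := rE 'i.
rewrite !(rmorphD, rmorphM) /= !conjCK conjCi rmorph1 !mul1r.
set p := b x y; set q := b y x => e1 e2.
have e4 : q^* - p^* = p - q.
  apply: (mulfI (neq0Ci C)); rewrite !mulrBr.
  by move: e1; rewrite !mulNr => ->; rewrite addrC.
have -> : q = ((q + p) - (p - q)) / 2 by field.
have -> : p^* = ((q^* + p^*) - (q^* - p^*)) / 2 by field.
by rewrite e2 e4.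
Qed.

Lemma form_linear s x : linear (fun y => f (star x * s * y) : C^o).
Proof. lin. Qed.

Lemma form_antilinear s y : antilinear (fun x => f (star x * s * y) : C^o).
Proof.
by move=> c u v; rewrite star_antilinear !mulrDl -!scalerAl fl.
Qed.

Lemma form_ge0 x : U x -> 0 <= f (star x * x).
Proof.
move=> Ux; have [->|x0] := eqVneq x 0; last exact/ltW/ff.
by rewrite mulr0 (lin0 fl).
Qed.

Lemma form_eq0 x : U x -> f (star x * x) = 0 -> x = 0.
Proof.
move=> Ux fx; apply: contrapT => /eqP x0.
by have := ff Ux x0; rewrite fx ltxx.
Qed.

Lemma form_conj x y : U x -> U y -> f (star y * x) = (f (star x * y))^*.
Proof.
move=> Ux Uy.
have := @hermitian_form (fun x y => f (star x * 1 * y)) (form_linear 1)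
  (form_antilinear 1) _ x y Ux Uy.
by rewrite !mulr1; apply=> z Uz; rewrite mulr1 ger0_real// form_ge0.
Qed.

(** For d = star s - s, polarization shows that f(star d * s) and f(star d * star s) are both the
    conjugate of f(s * d), so f(star d * d) = 0. *)
Lemma self_adjoint s : U s -> (forall b, U b -> f (star b * s * b) \is Num.real) ->
  star s = s.
Proof.
move=> Us sr; apply/eqP; rewrite -subr_eq0; apply/eqP.
have Us' : U (star s - s) by apply: subB => //; apply: sub_star.
apply: form_eq0 => //; set d := star s - s.
have := @hermitian_form (fun x y => f (star x * s * y)) (form_linear s)
  (form_antilinear s) sr 1 d (sub1 US) Us'.
rewrite (star1 HS) mul1r mulr1 => E.
have Usd : U (s * d) by apply: (subM US).
have := form_conj (sub1 US) Usd.
rewrite (star1 HS) mul1r mulr1 (wstarM HS) -E => fE.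
rewrite {2}/d mulrBr -scaleN1r addrC fl fE.
by rewrite -[_ *: _]/(_ * _) mulN1r addNr.
Qed.

(** An annihilating polynomial is split over C and its roots are pruned to distinct nonnegative
    ones; f plays the role of an inner product. *)
Lemma annihilated_spectral s : U s -> (forall b, U b -> 0 <= f (star b * s * b)) ->
  exists cs, spectral s cs /\ forall c, c \in cs -> 0 <= c.
Proof.
move=> Us s0.
have ss : star s = s by apply: self_adjoint => // b Ub; apply/ger0_real/s0.
have Uev p : U (ev s p) by apply: sub_horner.
(* If p(s) were nonzero, it would be an eigenvector of s for z, and f(star p(s) s p(s)) = z f(star
   p(s) p(s)) would force z >= 0. *)
have cancel1 z p : ~~ (0 <= z) -> ev s (('X - z%:P) * p) = 0 -> ev s p = 0.
  move=> z0 /eqP; rewrite rmorphM rmorphB /= horner_algX horner_algC mulrBl subr_eq0.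
  rewrite mulr_algl => /eqP E; apply: contrapT => /eqP p0.
  have := s0 _ (Uev p); rewrite -mulrA E -scalerAr (linZ _ _ fl).
  by rewrite -[_ *: _]/(_ * _) pmulr_lge0 ?ff// => zz; rewrite zz in z0.
(* s - z is self-adjoint, so (s - z)^2 p(s) = 0 makes f vanish at star x * x for x = (s - z)
   p(s). *)
have cancel2 z p : 0 <= z -> ev s (('X - z%:P) * (('X - z%:P) * p)) = 0 ->
    ev s (('X - z%:P) * p) = 0.
  move=> z0; rewrite rmorphM; set q := _ * p => E.
  apply: form_eq0 => //; rewrite [in star _]rmorphM /= (wstarM HS) -mulrA.
  have -> : star (ev s ('X - z%:P)) = ev s ('X - z%:P).
    rewrite rmorphB /= horner_algX horner_algC starB starZ (star1 HS) ss.
    by have /CrealP -> := ger0_real z0.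
  by rewrite E mulr0 (lin0 fl).
pose P cs := \prod_(z <- cs) ('X - z%:P) : {poly C}.
have PX z cs : P (z :: cs) = ('X - z%:P) * P cs by rewrite /P big_cons.
have {}cancel1 cs q : ev s (P cs * q) = 0 -> ev s (P [seq z <- cs | 0 <= z] * q) = 0.
  elim: cs q => //= z cs IH q; rewrite PX; case: ifPn => z0.
    by rewrite PX -mulrA mulrCA => /IH; rewrite mulrCA mulrA.
  by rewrite -mulrA => /(cancel1 _ _ z0); apply: IH.
have {}cancel2 cs q : all (>= 0) cs -> ev s (P cs * q) = 0 -> ev s (P (undup cs) * q) = 0.
  elim: cs q => //= z cs IH q /andP[z0 cs0]; rewrite PX -mulrA mulrCA => /(IH _ cs0).
  case: ifPn => zcs; last by rewrite PX mulrCA mulrA.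
  have -> : P (undup cs) = ('X - z%:P) * P (rem z (undup cs)).
    rewrite -PX; apply/perm_big/perm_to_rem.
    by rewrite mem_undup.
  by rewrite mulrACA -!mulrA; apply: cancel2.
have [p p0 sp] := annihilator s.
have [r pE] := closed_field_poly_normal p.
have {p sp p0 pE} r0 : ev s (P r * 1) = 0.
  move: sp; rewrite pE -mul_polyC rmorphM /= horner_algC mulr_algl mulr1 => /eqP.
  by rewrite scaler_eq0 lead_coef_eq0 (negPf p0) => /eqP.
exists (undup [seq z <- r | 0 <= z]); split; last first.
  by move=> c; rewrite mem_undup mem_filter => /andP[].
split; first exact: undup_uniq.
rewrite -[X in ev s X]mulr1; apply: cancel2; first exact: filter_all.
exact: cancel1.
Qed.

(** A fourth root, so that r * r is a square root of s that is itself of the form star r * r. *)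
Lemma positive_root s : U s -> (forall b, U b -> 0 <= f (star b * s * b)) ->
  exists p, let r := ev s p in star r = r /\ r * r * (r * r) = s.
Proof.
move=> Us s0; have [cs [sc cs0]] := annihilated_spectral Us s0.
have ss : star s = s by apply: self_adjoint => // b Ub; apply/ger0_real/s0.
have [p pE] := interpolation (fun c => sqrtC (sqrtC c)) (proj1 sc).
exists p => r; split.
  apply: (spectral_star ss sc cs0) => c ccs; rewrite pE//.
  by apply/CrealP/ger0_real; rewrite !sqrtC_ge0 cs0.
rewrite /r -!rmorphM /= -[RHS](horner_algX s); apply: (spectral_eq sc) => c ccs.
by rewrite !hornerM hornerX pE// -!expr2 !sqrtCK.
Qed.

Lemma definite_unit s : U s -> (forall b, U b -> b != 0 -> 0 < f (star b * s * b)) ->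
  s \is a GRing.unit.
Proof.
move=> Us s0.
have s0' b : U b -> 0 <= f (star b * s * b).
  move=> Ub; have [->|b0] := eqVneq b 0; last exact/ltW/s0.
  by rewrite mulr0 (lin0 fl).
have [cs [sc cs0]] := annihilated_spectral Us s0'.
(* p(s) is the spectral projection at 0; it vanishes since s kills it and s is definite. *)
have [p pE] := interpolation (fun c => (c == 0)%:R) (proj1 sc).
have sp : s * ev s p = 0.
  rewrite -[X in X * _](horner_algX s) -rmorphM -(rmorph0 (ev s)).
  apply: (spectral_eq sc) => c ccs; rewrite hornerM hornerX horner0 pE//.
  by case: eqP => [->|_]; rewrite ?mul0r ?mulr0.
have p0 : ev s p = 0.
  apply: contrapT => /eqP p0; have := s0 _ (sub_horner p Us) p0.
  by rewrite -mulrA sp mulr0 (lin0 fl) ltxx.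
(* By convention the inverse of 0 is 0, so X q + p takes the value 1 at 0 as well. *)
have [q qE] := interpolation (fun c => c^-1) (proj1 sc).
apply/unitrP; exists (ev s q).
suff E : ev s ('X * q) = 1.
  by split; [rewrite -E mulrC|rewrite -E]; rewrite rmorphM /= horner_algX.
have -> : ev s ('X * q) = ev s ('X * q + p) by rewrite rmorphD /= p0 addr0.
rewrite -(rmorph1 (ev s)); apply: (spectral_eq sc) => c ccs.
rewrite hornerD hornerM hornerX hornerC qE// pE//.
by have [->|c0] := eqVneq c 0; rewrite ?mul0r ?add0r// divff// addr0.
Qed.

End Faithful.

Section Positive.
Variable f : A -> C.
Hypothesis fl : linear (f : A -> C^o).
Hypothesis ff : faithful (fun _ => True) f.

Let TS : star_subalgebra (fun _ : A => True). Proof. by []. Qed.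

Lemma positive_star a : positive_element a -> star a = a.
Proof. by case=> y ->; rewrite (wstarM HS) (wstarK HS). Qed.

Lemma positive_spectral a : positive_element a ->
  exists cs, spectral a cs /\ forall c, c \in cs -> 0 <= c.
Proof.
case=> y ->; apply: (annihilated_spectral TS fl ff) => // b _.
rewrite mulrA -mulrA -(wstarM HS).
exact: (form_ge0 fl ff).
Qed.

Lemma positive_sqrt_horner a cs p : spectral a cs ->
  (forall c, c \in cs -> 0 <= c) -> (forall c, c \in cs -> p.[c ^+ 2] = c) ->
  a = ev (a * a) p.
Proof.
move=> sc cs0 pE; have -> : a * a = ev a ('X^2) by rewrite rmorphXn /= horner_algX expr2.
rewrite -horner_alg_comp -[LHS](horner_algX a); apply: (spectral_eq sc) => c ccs.
by rewrite horner_comp hornerXn hornerX pE.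
Qed.

(** One polynomial interpolating the square root on the squares of both spectra recovers a from a *
    a and b from b * b. *)
Lemma positive_sqrt_unique a b :
  positive_element a -> positive_element b -> a * a = b * b -> a = b.
Proof.
move=> /positive_spectral [cs [sc cs0]] /positive_spectral [ds [sd ds0]] ab.
have [p pE] := interpolation sqrtC (undup_uniq [seq c ^+ 2 | c <- cs ++ ds]).
rewrite [LHS](positive_sqrt_horner (p := p) sc cs0) => [|c ccs]; last first.
  rewrite pE ?sqrCK ?cs0// mem_undup; apply/mapP; exists c => //.
  by rewrite mem_cat ccs.
rewrite [RHS](positive_sqrt_horner (p := p) sd ds0) ?ab// => c cds.
rewrite pE ?sqrCK ?ds0// mem_undup; apply/mapP; exists c => //.
by rewrite mem_cat cds orbT.
Qed.

Lemma positive_horner_sqr a : positive_element a -> exists p, a = ev (a * a) p.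
Proof.
move=> /positive_spectral [cs [sc cs0]].
have [p pE] := interpolation sqrtC (undup_uniq [seq c ^+ 2 | c <- cs]).
exists p; apply: (positive_sqrt_horner sc cs0) => c ccs.
by rewrite pE ?sqrCK ?cs0// mem_undup; apply/mapP; exists c.
Qed.

End Positive.

(** If f(star b * b) = 0, the Cauchy-Schwarz argument gives f(a * b) = 0 for all a. *)
Lemma positive_nondegenerate_faithful (f : A -> C) : linear (f : A -> C^o) ->
  (forall a, 0 <= f (star a * a)) -> (forall b, (forall a, f (a * b) = 0) -> b = 0) ->
  faithful (fun _ => True) f.
Proof.
move=> fl f0 fn b _ b0; rewrite lt_neqAle f0 andbT eq_sym; apply/eqP => fb.
move/eqP: b0; apply; apply: fn => a.
pose x := star a; rewrite -[a](wstarK HS) -/x.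
have TS : star_subalgebra (fun _ : A => True) by [].
have herm y z : f (star y * z) = (f (star z * y))^*.
  have := @hermitian_form _ TS (fun x y => f (star x * 1 * y)) (form_linear fl 1)
    (form_antilinear fl 1) _ z y I I.
  by rewrite !mulr1; apply=> u _; rewrite mulr1 ger0_real.
apply: contrapT => /eqP p0; set p := f _ in p0.
pose K := f (star x * x); pose t := p^* * p.
have t0 : t != 0 by rewrite mulf_neq0 ?conjC_eq0.
(* Chosen with c p = - (K + 1) / 2, so that the nonnegative value below becomes - (K + 1) + K =
   -1. *)
pose c := - (K + 1) / (2 * t) * p^*.
have := f0 (c *: b + x).
have -> : f (star (c *: b + x) * (c *: b + x)) = c^* * p^* + (c * p + K).
  rewrite starD starZ mulrDl !mulrDr -!scalerAl -!scalerAr scalerA.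
  rewrite !(linD _ _ fl) !(linZ _ _ fl) !scaleCo fb mulr0 add0r.
  by rewrite (herm b x) -/p; congr (_ + (_ + _)); rewrite [RHS]mulrA.
have cp : c * p = - (K + 1) / 2 by rewrite /c /t; field; rewrite conjC_eq0 p0.
have Kr : K^* = K by apply/CrealP/ger0_real/f0.
rewrite -rmorphM cp /= rmorphM rmorphN rmorphD /= Kr rmorph1 fmorphV rmorph_nat.
have -> : - (K + 1) / 2 + (- (K + 1) / 2 + K) = -1 by field.
by rewrite ler0N1.
Qed.

End Spectral.

(** * The p-dual of an integral *)

Section Units.
Variables (R : realType) (A : falgType R[i]).
Implicit Types x y : A.

Lemma falg_mulr1_comm x y : x * y = 1 -> y * x = 1.
Proof.
move=> xy; have k0 : lker (amull y) == 0%VS.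
  apply/lker0P => a b; rewrite !lfunE /= => yab.
  by rewrite -[a]mul1r -[b]mul1r -xy -!mulrA yab.
have := lker0_lfunVK k0 1; rewrite lfunE /= => yx.
by rewrite -[x]mulr1 -{1}yx [x * _]mulrA xy mul1r.
Qed.

Lemma falg_unit x y : x * y = 1 -> x \is a GRing.unit /\ x^-1 = y.
Proof.
move=> xy; have yx := falg_mulr1_comm xy.
have xU : x \is a GRing.unit by apply/unitrP; exists y.
by split=> //; apply: (mulrI xU); rewrite mulrV.
Qed.

Lemma unit_mull x y : x * y \is a GRing.unit -> x \is a GRing.unit.
Proof.
move=> xyU; have : x * (y * (x * y)^-1) = 1 by rewrite mulrA mulrV.
by case/falg_unit.
Qed.

Lemma antimorph_unit (f : A -> A) x : f 1 = 1 ->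
  (forall a b, f (a * b) = f b * f a) -> x \is a GRing.unit ->
  f x \is a GRing.unit /\ (f x)^-1 = f x^-1.
Proof. by move=> f1 fM xU; apply: falg_unit; rewrite -fM mulVr. Qed.

End Units.

Section IntegralPair.
Variables (R : realType) (A : preWeakHopfType R).
Hypothesis HS : weak_star_hopf A.
Local Notation C := R[i].
Local Notation S := (@antipode R A).
Local Notation Si := (fun_of_lfun (@antipode R A)^-1%VF).
Local Notation eps := (@counit R A).
Implicit Types (x y a b : A) (phi psi chi : dual A).
Let H := wshW HS.
Let DHS := weak_star_hopf_dual HS.

Lemma pairingB phi a b : pairing phi (a - b) = pairing phi a - pairing phi b.
Proof. by rewrite addrC -scaleN1r (pairing_linearr phi) scaleCo mulN1r addrC. Qed.

Lemma inL_subalgebra : star_subalgebra (fun x : A => inL x).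
Proof.
split; [exact: inL1|exact: inL_mul| |exact: inL_star].
by move=> c x y xL yL; rewrite /inL linearP /= xL yL.
Qed.

Lemma inR_horner (s : A) p : inR s -> inR (horner_alg s p).
Proof.
move=> sR; apply: horner_alg_ind => //; [exact: inR1|exact: inR_mul|].
by move=> c x y xR yR; rewrite /inR linearP /= xR yR.
Qed.

Lemma inL_inv x : inL x -> x \is a GRing.unit -> inL x^-1.
Proof. by move=> xL xU; apply: (mulrI xU); rewrite -(PiL_mull H) ?mulrV ?PiL1. Qed.

Lemma counit_linear : linear (eps : A -> C^o).
Proof. exact: linearP. Qed.

Lemma counit_inv_antipode x b : inL x -> inL b -> S (S x) = x ->
  eps (b * x) = eps (x * b).
Proof. by move=> xL bL xx; rewrite [RHS](counit_comm H)// xx. Qed.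

Lemma dual_act_act_dual y phi a : inR y ->
  dual_act (act_dual y phi) a = dual_act phi (a * y).
Proof.
move=> yR; rewrite /dual_act [RHS](sw_mulrR H)//; last by lin.
by apply: eq_tlift => u v; rewrite act_dualE.
Qed.

Variables (l : A) (lambda : dual A) (h k : A).
Hypothesis lL : left_integral l.
Hypothesis lambdaL : left_integral lambda.
Hypothesis hh : normalized_haar h.
Hypothesis kR : inR k.
Hypothesis ks : star k = k.
Hypothesis kk : k * k = PiR l.
Hypothesis Ek : dual_act lambda (k * h * k) = 1.
Hypothesis lambdaF : faithful (fun _ => True) (pairing lambda).
Hypothesis lF : faithful (fun _ => True) (fun phi : dual A => pairing phi l).
(* k is the square root of d_R(l); being positive, it has a square root in A_R. *)
Hypothesis kroot : exists m, [/\ inR m, star m = m & m * m = k].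

Let E := dual_act lambda.
Let t := S k.
Let z := E h.

Lemma pair_tL : inL t. Proof. exact: inL_antipode. Qed.
Let tL := pair_tL.

Lemma pair_star_t : star t = Si k.
Proof. by rewrite -(antipodei_star HS) ks. Qed.

Let stL : inL (star t). Proof. exact: inL_star. Qed.
Let zL : inL z. Proof. exact: inL_dual_act. Qed.

Lemma pair_kh : k * h = t * h.
Proof. exact: mulR_haar. Qed.

Lemma pair_hk : h * k = h * star t.
Proof. by rewrite (haar_mulR HS hh)// pair_star_t. Qed.

Lemma pair_tz : t * z * star t = 1.
Proof.
rewrite -Ek pair_kh -(mulrA t h) pair_hk mulrA.
by rewrite (dual_act_mulrL HS)// (dual_act_mulLl HS).
Qed.

Lemma pair_t_unit : t \is a GRing.unit.
Proof. by have := pair_tz; rewrite -mulrA => /falg_unit[]. Qed.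
Let tU := pair_t_unit.

Lemma pair_k_unit : k \is a GRing.unit.
Proof.
have [] := antimorph_unit (antipodei1 HS) (antipodeiM HS) tU.
by rewrite (antipodeKi HS).
Qed.

Lemma star_unit x : x \is a GRing.unit -> star x \is a GRing.unit.
Proof. by move=> xU; case: (antimorph_unit (star1 HS) (wstarM HS) xU). Qed.

Let stU : star t \is a GRing.unit. Proof. exact: star_unit. Qed.

Lemma pair_zE : star t * t * z = 1.
Proof. by rewrite -mulrA; apply: falg_mulr1_comm; apply: pair_tz. Qed.

Lemma pair_zE' : z * (star t * t) = 1.
Proof. exact: (falg_mulr1_comm pair_zE). Qed.

Lemma pair_z_unit : z \is a GRing.unit.
Proof. by have [] := falg_unit pair_zE'. Qed.

Lemma pair_l : l = h * k * k.
Proof. by rewrite -mulrA kk; apply: left_integral_haar. Qed.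

Lemma pair_haar_eq0 x : inL x -> h * x = 0 -> x = 0.
Proof.
move=> xL hx; apply: (mulrI pair_z_unit); rewrite mulr0 /z /E.
by rewrite -(dual_act_mulrL HS)// hx linear0.
Qed.

(* The functional of l on the dual algebra, restricted to x |-> act_dual x 1,
   is eps (star t * _ * t) on A_L; this makes eps faithful there. *)
Lemma counit_faithful : faithful (fun x => inL x) eps.
Proof.
move=> x xL x0; pose y := x * t^-1; pose phi : dual A := act_dual y 1.
have tiL : inL t^-1 by apply: inL_inv.
have yL : inL y by apply: (inL_mul H).
have yt : y * t = x by rewrite /y mulrVK.
have phi0 : phi != 0.
  apply: contra_neq x0 => /(act_dual1_inj yL) y0.
  by rewrite -yt y0 mul0r.
have := lF I phi0; rewrite /phi (star_act_dual1 HS)// (act_dual1M HS); last exact: inL_star.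
rewrite act_dualE dual1E -(counit_PiR H) -kk.
have sL : inL (star y * y) by apply: inL_mul => //; apply: inL_star.
rewrite -(inLR_comm H sL); last exact: inR_mul.
rewrite -(counit_inR H); last exact: inR_mul.
rewrite (antipodeM H) -/t mulrA -(mulrA (star y)) yt.
have -> : star y * x * t = star y * (x * t) by rewrite mulrA.
have tE : S (S (star t)) = t by rewrite pair_star_t (antipodeiK HS).
rewrite mulrA -[X in _ * X]tE -(counit_comm H)//; last first.
  by apply: inL_mul => //; apply: inL_star.
by rewrite mulrA -(wstarM HS) yt.
Qed.
Let epsF := counit_faithful.

Lemma counit_injr x y : inL x -> inL y ->
  (forall b, inL b -> eps (b * x) = eps (b * y)) -> x = y.
Proof.
move=> xL yL xy; apply/eqP; rewrite -subr_eq0; apply/eqP.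
have dL : inL (x - y) by apply: (subB inL_subalgebra).
apply: (form_eq0 epsF) => //.
by rewrite mulrBr linearB /= xy ?subrr//; apply: inL_star.
Qed.

Lemma counit_injl x y : inL x -> inL y ->
  (forall b, inL b -> eps (x * b) = eps (y * b)) -> x = y.
Proof.
move=> xL yL xy; rewrite -[x](antipodeKi HS) -[y](antipodeKi HS).
rewrite -[S x](antipodeKi HS) -[S y](antipodeKi HS); congr (Si (Si _)).
have SSL a : inL a -> inL (S (S a)).
  by move=> aL; apply: (inL_antipode H); apply: (inR_antipode H).
by apply: counit_injr => [||b bL]; rewrite -?(counit_comm H) ?xy//; apply: SSL.
Qed.

(** * The dual Haar integral and the modular structure of A_L *)

Let w := \sw(u, v <- (1 : A)) (pairing lambda u *: v).

Lemma pair_wL : inL w.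
Proof. by apply: (inL_leg H (f := pairing lambda)); lin. Qed.
Let wL := pair_wL.

(** This is the origin of w: it represents d_R(lambda) under the embedding x |-> x ⇀ 1 of A_L. *)
Lemma pair_PiR_lambda : PiR lambda = act_dual w 1.
Proof.
apply: dualP => b; rewrite dual_PiRE act_dualE dual1E PiRE pairing_tlift mul_tlift.
by rewrite fun_tlift; apply: eq_tlift => u v; rewrite pairingZr -scalerAr linearZ mulrC.
Qed.

(** The value is lambda(star y * y) for y = S^-1(b) in A_R, where lambda reduces to eps and w. *)
Lemma pair_w_definite b : inL b -> b != 0 -> 0 < eps (star b * w * b).
Proof.
move=> bL b0; pose y := Si b.
have yR : inR y by apply: inR_antipodei.
have y0 : y != 0.
  by apply: contra_neq b0 => y0; rewrite -[b](antipodeiK HS) -/y y0 linear0.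
have := lambdaF I y0.
have yyR : inR (star y * y) by apply: inR_mul => //; apply: inR_star.
rewrite -yyR -dual_PiRE pair_PiR_lambda act_dualE dual1E.
have -> : star y = S (star b) by rewrite /y (antipode_star HS).
rewrite -mulrA -(inLR_comm H wL yR) (counit_inL H); last exact: inL_star.
by rewrite mulrA -(counit_inR H)// (antipodeiK HS).
Qed.

Lemma pair_w_unit : w \is a GRing.unit.
Proof.
by apply: (definite_unit HS inL_subalgebra counit_linear epsF wL); apply: pair_w_definite.
Qed.
Let wU := pair_w_unit.
Let wi := w^-1.
Let wiL : inL wi. Proof. exact: inL_inv. Qed.

Let hd : dual A := lambda * act_dual wi 1.

Lemma pair_hdE a : pairing hd a = pairing lambda (a * Si wi).
Proof. by rewrite /hd (act_dual1_mulr HS)// act_dualE. Qed.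

Lemma pair_lambdaE a : pairing lambda a = pairing hd (a * Si w).
Proof. by rewrite pair_hdE -mulrA -(antipodeiM HS) mulVr// (antipodei1 HS) mulr1. Qed.

(** PiR(hd) = (w ⇀ 1)(w^-1 ⇀ 1) = 1, and a left integral so normalized is Haar. *)
Lemma pair_hd_haar : normalized_haar hd.
Proof.
have inR_act x : inR (act_dual x 1 : dual A).
  by apply: dualP => b; rewrite dual_PiRE !act_dualE !dual1E (counit_PiR H).
apply: (proj1 (left_normalized_haar DHS _ _)).
  apply/(left_integralE DHS) => phi; rewrite mulrA.
  by have /(left_integralE DHS) -> := lambdaL; rewrite mulrA.
rewrite (PiR_mulr (wshW DHS))// pair_PiR_lambda (act_dual1M HS)//.
by rewrite mulrV// act_dual1.
Qed.
Let hdL : left_integral hd. Proof. by case: pair_hd_haar. Qed.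

Lemma pair_hd_antipode a : pairing hd (S a) = pairing hd a.
Proof. by rewrite -antipodeE (antipode_haar DHS pair_hd_haar). Qed.

(** S-invariance of hd turns y b into S(b) S(y) with S(y) in A_L; there the twisted trace property
    of eps moves it to the front as S^-1(y), and a second use of the invariance gives b S^-2(y). *)
Lemma pair_hd_inR y b : inR y -> pairing hd (y * b) = pairing hd (b * Si (Si y)).
Proof.
move=> yR; rewrite -[LHS]pair_hd_antipode (antipodeM H).
rewrite [LHS](pairing_inLr HS); last exact: inL_antipode.
have yL : inL (Si y) by apply: inL_antipodei.
have SSy : S (S (Si y)) = S y by rewrite (antipodeiK HS).
rewrite -SSy -(counit_comm H)//; last exact: (inL_dual_act HS hdL).
rewrite -(pairing_inLl HS)//.
rewrite -[X in X * S b](antipodeiK HS) -(antipodeM H).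
exact: pair_hd_antipode.
Qed.

Let z' := dual_act hd h.
Let z'L : inL z'. Proof. exact: inL_dual_act. Qed.

Lemma pair_z'E : z' = z * Si (Si wi).
Proof.
have wR : inR (Si wi) by apply: inR_antipodei.
rewrite /z' /hd (act_dual1_mulr HS)// dual_act_act_dual// (haar_mulR HS hh)//.
by rewrite (dual_act_mulrL HS)//; apply: inL_antipodei.
Qed.

(** S-invariance of hd and h gives hd(h b) = hd(b h) on A_L, so eps(z' b) = eps(b z'), and the
    twisted trace property concludes. *)
Lemma pair_z'_inv : S (S z') = z'.
Proof.
have SzL : inL (S (S z')) by apply: (inL_antipode H); apply: (inR_antipode H).
apply: counit_injr => // b bL.
rewrite -(counit_comm H)// /z' -(pairing_inLl HS)// -(pairing_inLr HS)//.
rewrite (haar_mulL HS hh)// -[in LHS](antipode_haar HS hh) -(antipodeM H).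
by rewrite pair_hd_antipode.
Qed.

(** x is carried around h: S^4(x) h = S^3(x) h with S^3(x) in A_R, hd moves it to the right end as
    S(x), and h absorbs it as x. *)
Lemma pair_z'_comm x : inL x -> S (S (S (S x))) * z' = z' * x.
Proof.
move=> xL; pose y := S (S (S x)).
have yR : inR y by apply: (inR_antipode H); apply: (inL_antipode H); apply: (inR_antipode H).
have yL : inL (S y) by apply: inL_antipode.
apply: counit_injl => [||b bL]; try exact: inL_mul.
rewrite /z' -(dual_act_mulLl HS)// -!(dual_act_mulrL HS)// !counit_dual_act.
rewrite -(mulR_haar HS hh)// -mulrA pair_hd_inR// /y !(antipodeKi HS).
have SxR : inR (S x) by apply: inR_antipode.
rewrite -mulrA (inLR_comm H bL SxR) mulrA -(haar_mulL HS hh)//.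
Qed.

Lemma definite_ge0 s : (forall b, inL b -> b != 0 -> 0 < eps (star b * s * b)) ->
  forall b, inL b -> 0 <= eps (star b * s * b).
Proof.
move=> s0 b bL; have [->|b0] := eqVneq b 0; last exact/ltW/s0.
by rewrite mulr0 linear0.
Qed.

Lemma pair_definite_root s : inL s ->
    (forall b, inL b -> b != 0 -> 0 < eps (star b * s * b)) ->
  exists p, let r := horner_alg s p in
    [/\ inL r, star r = r, r * r * (r * r) = s & r \is a GRing.unit].
Proof.
move=> sL s0.
have sU := definite_unit HS inL_subalgebra counit_linear epsF sL s0.
have [p [rs r4]] := positive_root HS inL_subalgebra counit_linear epsF sL (definite_ge0 s0).
exists p; split=> //; first exact: (sub_horner inL_subalgebra).
by move: sU; rewrite -{1}r4 -mulrA => /unit_mull.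
Qed.

Lemma antipodei_unit x : x \is a GRing.unit -> Si x \is a GRing.unit.
Proof. by move=> xU; case: (antimorph_unit (antipodei1 HS) (antipodeiM HS) xU). Qed.

(** For v = S^-1 of the square root of w, hd(star v * a * v) = lambda(a), so faithfulness comes from
    lambda. *)
Lemma pair_hd_faithful : faithful (fun _ => True) (pairing hd).
Proof.
have [u [uL us uu uU]] : exists u, [/\ inL u, star u = u, u * u = w & u \is a GRing.unit].
  have [p [rL rs r4 rU]] := pair_definite_root wL pair_w_definite.
  exists (horner_alg w p * horner_alg w p); split=> //; first exact: inL_mul.
    by rewrite (wstarM HS) rs.
  by rewrite unitrMl.
pose v := Si u.
have vU : v \is a GRing.unit by apply: antipodei_unit.
have hv a : pairing hd (star v * a * v) = pairing lambda a.
  have -> : star v = S u by rewrite /v -(antipode_star HS) us.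
  rewrite -mulrA pair_hd_inR; last exact: inR_antipode.
  by rewrite (antipodeKi HS) pair_lambdaE -uu (antipodeiM HS) mulrA.
move=> x _ x0; have -> : star x * x = star v * (star (x * v^-1) * (x * v^-1)) * v.
  by rewrite mulrA -(wstarM HS) mulrVK// mulrA mulrVK.
rewrite hv; apply: lambdaF => //.
by apply: contra_neq x0 => xv; rewrite -[x](mulrVK vU) xv mul0r.
Qed.

(** star b * h * b = star (h b) * (h b), and h b is nonzero because E(h b) = z b. *)
Lemma pair_z'_definite b : inL b -> b != 0 -> 0 < eps (star b * z' * b).
Proof.
move=> bL b0; have sbL : inL (star b) by apply: inL_star.
rewrite /z' -(dual_act_mulLl HS)// -(dual_act_mulrL HS)// counit_dual_act.
have -> : star b * h * b = star (h * b) * (h * b).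
  rewrite (wstarM HS) (star_haar HS hh) -mulrA -[in LHS](mul1r h) -(PiL_haar HS hh).
  by rewrite -(haar_l HS hh) !mulrA.
apply: pair_hd_faithful => //.
by apply: contra_neq b0; apply: pair_haar_eq0.
Qed.

(* S^4 is conjugation by z' = g^2 on A_L, so th = Ad(g^-1) S^2 is an involution.
   If th d = - d then eps (d * star d) = - eps (star d * (g * d * g^-1)), where
   both values of eps are nonnegative; hence d = 0. *)
Lemma pair_modular : exists r, [/\ inL r, star r = r, r \is a GRing.unit,
  r * r * (r * r) = z' & forall x, inL x -> S (S x) = r * r * x * (r * r)^-1].
Proof.
have SSM a b : S (S (a * b)) = S (S a) * S (S b) by rewrite !(antipodeM H).
(* r is a polynomial in z', hence fixed by S^2. *)
have [r [rL rs r4 rU SSr]] : exists r, [/\ inL r, star r = r,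
    r * r * (r * r) = z', r \is a GRing.unit & S (S r) = r].
  have [p [rL rs r4 rU]] := pair_definite_root z'L pair_z'_definite.
  exists (horner_alg z' p); split=> //.
  apply: (horner_alg_ind (U := fun x => S (S x) = x)) => [|||c x y xx yy].
  - by rewrite !(antipode1 H).
  - exact: pair_z'_inv.
  - by move=> x y xx yy; rewrite SSM xx yy.
  - by rewrite !linearP /= xx yy.
exists r; split=> // x xL.
have [g gE] : exists g, g = r * r by exists (r * r).
rewrite -gE in r4 *.
have gU : g \is a GRing.unit by rewrite gE unitrMl.
have SSg : S (S g) = g by rewrite gE SSM SSr.
have SSV a : a \is a GRing.unit -> S (S a) = a -> S (S a^-1) = a^-1.
  move=> aU aa; apply: (mulrI aU); rewrite mulrV// -{1}aa -SSM mulrV//.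
  by rewrite !(antipode1 H).
have SSL a : inL a -> inL (S (S a)).
  by move=> aL; apply: (inL_antipode H); apply: (inR_antipode H).
have riL : inL r^-1 by apply: inL_inv.
have gL : inL g by rewrite gE; apply: inL_mul.
have giL : inL g^-1 by apply: inL_inv.
pose th a := g^-1 * S (S a) * g.
have thth : th (th x) = x.
  have Yg : S (S (S (S x))) * g * g = g * g * x by rewrite -mulrA r4 pair_z'_comm.
  rewrite /th !SSM SSg SSV// -!mulrA.
  by rewrite [_ * (g * g)]mulrA Yg -mulrA !mulKr.
pose d := x - th x.
have dL : inL d.
  by apply: (subB inL_subalgebra) => //; do ?[apply: inL_mul => //]; apply: SSL.
have thd : th d = - d.
  have thB a b : th (a - b) = th a - th b by rewrite /th !linearB /= mulrBr mulrBl.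
  by rewrite /d thB thth opprB.
have SSd : S (S d) = - (g * d * g^-1).
  have := congr1 (fun a => g * a * g^-1) thd; rewrite /th mulrN mulNr => <-.
  by rewrite !mulrA mulrV// mul1r mulrK.
have sdL : inL (star d) by apply: inL_star.
have e1 : 0 <= eps (d * star d).
  by rewrite -{1}[d](wstarK HS); apply: (form_ge0 counit_linear epsF sdL).
(* r^-1 is fixed by S^2, so eps lets it pass cyclically; this splits conjugation by g = r^2 into
   conjugation by r in both factors. *)
have e2 : 0 <= eps (star d * (g * d * g^-1)).
  have -> : eps (star d * (g * d * g^-1)) =
      eps (star (r * d * r^-1) * (r * d * r^-1)); last first.
    by apply: (form_ge0 counit_linear epsF); do ?[apply: inL_mul => //].
  have rir : star r^-1 = r^-1.
    by have [_ <-] := antimorph_unit (star1 HS) (wstarM HS) rU; rewrite rs.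
  rewrite !(wstarM HS) rs rir gE invrM// !mulrA.
  rewrite counit_inv_antipode ?SSV//; last by do ?[apply: inL_mul => //].
  by rewrite !mulrA.
have d0 : eps (d * star d) = 0.
  apply/eqP; rewrite eq_le e1 andbT.
  by rewrite (counit_comm H)// SSd mulrN linearN /= oppr_le0.
have {}d0 : star d = 0 by apply: (form_eq0 epsF sdL); rewrite (wstarK HS).
have {d0} : d = 0 by rewrite -[d](wstarK HS) d0 star0.
move/eqP; rewrite subr_eq0 => /eqP {2}->.
by rewrite /th !mulrA mulrV// mul1r mulrK.
Qed.

(* v^-1 is the square root of w; the form q * star q shows that it is positive. *)
Lemma pair_dual_sqrt : exists q, let v := q * star q in
  [/\ inL q, q \is a GRing.unit, w * (v * v) = 1 &
    z * Si (Si v) * (star t * star t) * v^-1 = 1].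
Proof.
have [r [rL rs rU r4 SSE]] := pair_modular.
have [m [mR ms mm]] := kroot.
have [n nE] : exists n, n = S m by exists (S m).
have [g gE] : exists g, g = r * r by exists (r * r).
rewrite -gE in r4 SSE; exists (n * r) => v.
have gU : g \is a GRing.unit by rewrite gE unitrMl.
have nL : inL n by rewrite nE; apply: inL_antipode.
have snL : inL (star n) by apply: inL_star.
have tE : t = n * n by rewrite /t -mm (antipodeM H) nE.
have nU : n \is a GRing.unit by move: tU; rewrite tE => /unit_mull.
(* S^2 sends star n = S^-1(m) to S(m) = n and is conjugation by g. *)
have gn : g * star n = n * g.
  have : S (S (star n)) = n.
    by rewrite nE (antipode_star HS) (antipodeKi HS) ms.
  by rewrite SSE// => {2}<-; rewrite mulrVK.
have vE : v = t * g.
  by rewrite /v (wstarM HS) rs mulrA -[n * r * r]mulrA -gE -mulrA gn mulrA -tE.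
have vE' : v = g * star t.
  rewrite vE tE -mulrA -gn mulrA -gn -mulrA; congr (_ * _).
  by rewrite (wstarM HS).
have vL : inL v by rewrite /v; apply: inL_mul; rewrite ?(wstarM HS) ?rs; do ?[apply: inL_mul => //].
clearbody v.
have vU : v \is a GRing.unit by rewrite vE unitrMl.
have SSi x : inL x -> Si (Si x) = g^-1 * x * g.
  move=> xL; have xL' : inL (Si (Si x)) by apply: inL_antipodei => //; apply: inR_antipodei.
  have := SSE _ xL'; rewrite !(antipodeiK HS) => {2}->.
  by rewrite !mulrA mulVr// mul1r mulrVK.
(* Compare z' = z S^-2(w^-1) with z' = g^2, where S^-2 is conjugation by g^-1. *)
have zE : z = g * w * g.
  have := pair_z'E; rewrite SSi// -r4 => /(congr1 (fun a => a * (g^-1 * w * g))).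
  rewrite -[z * _ * _]mulrA.
  have -> : g^-1 * wi * g * (g^-1 * w * g) = 1.
    by rewrite !mulrA mulrK// -[_ * wi * w]mulrA mulVr// mulr1 mulVr.
  by rewrite mulr1 => <-; rewrite !mulrA mulrK.
have wvv : w * (v * v) = 1.
  apply: (mulrI gU); rewrite mulr1 -[RHS]mul1r -pair_zE' zE.
  by rewrite {1}vE' vE !mulrA.
split=> //; first exact: inL_mul.
  by rewrite unitrMl.
have wE : w = v^-1 * v^-1.
  have vvU : v * v \is a GRing.unit by rewrite unitrMl.
  by apply: (mulIr vvU); rewrite wvv mulrA mulrVK// mulVr.
have stE : star t = g^-1 * v by rewrite vE' mulrA mulVr// mul1r.
rewrite SSi// zE wE stE !mulrA.
by rewrite !(mulrK gU) !(mulrK vU) !(mulrVK vU) mulrV.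
Qed.

(** u ⇀ 1 is the square root of d_R(lambda). As hd is lambda times w^-1 ⇀ 1 with w = u^2, the
    right-hand root in e_lambda becomes v = u^-1. The last equation is the one behind
    [pair_bidual]. *)
Lemma pair_e_lambda : exists u v, [/\ inL u, inL v, u * v = 1,
    forall a, pairing (e_of lambda) a = pairing lambda (a * u * Si v) &
    z * Si (Si v) * (star t * star t) * u = 1].
Proof.
have [q [qL qU]] := pair_dual_sqrt; set v := q * star q => wvv zv.
have sqU : star q \is a GRing.unit by apply: star_unit.
have vL : inL v by apply: inL_mul => //; apply: inL_star.
have vU : v \is a GRing.unit by rewrite unitrMl.
have uL : inL v^-1 by apply: inL_inv.
have qiL : inL q^-1 by apply: inL_inv.
have uu : v^-1 * v^-1 = w.
  have vvU : v * v \is a GRing.unit by rewrite unitrMl.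
  by apply: (mulIr vvU); rewrite wvv mulrA mulrVK// mulVr.
have uP : positive_element (act_dual v^-1 1 : dual A).
  exists (act_dual q^-1 1); rewrite (star_act_dual1 HS)// (act_dual1M HS); last exact: inL_star.
  have [_ <-] := antimorph_unit (star1 HS) (wstarM HS) qU.
  by rewrite /v invrM.
have uS : act_dual v^-1 1 * act_dual v^-1 1 = d_R lambda.
  by rewrite (act_dual1M HS)// uu -pair_PiR_lambda (d_RE DHS).
have sqrtE : psqrt (d_R lambda) = act_dual v^-1 1.
  have [sP sS] := xgetPex (0 : dual A) (ex_intro
    (fun s => positive_element s /\ s * s = d_R lambda) _ (conj uP uS)).
  (* Positive square roots in the dual are unique, l being the faithful functional there. *)
  apply: (positive_sqrt_unique DHS (pairing_linearl l) lF sP uP).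
  by rewrite uS.
exists v^-1, v; split=> //; first by rewrite mulVr.
move=> a; rewrite /e_of sqrtE (haarE DHS pair_hd_haar) -mulrA.
rewrite (act_dual1_mull HS)// (act_dual1_mulr HS)// !act_dualE pair_hdE -!mulrA.
congr (pairing _ (_ * (_ * _))); rewrite -(antipodeiM HS) /wi -uu.
by rewrite invrM ?unitrV// invrK mulrK.
Qed.

(** The claim is that e_lambda takes b l to eps(b). Here b l = PiL(b) l, and l u S^-1(v) is h times
    an element of A_L whose product with z is 1. *)
Lemma pair_bidual : dual_act (bidual l) (e_of lambda) = 1.
Proof.
have [u [v [uL vL uv eE zv]]] := pair_e_lambda.
have SvR : inR (Si v) by apply: inR_antipodei.
rewrite dual_act_bidual; apply: dualP => b; rewrite act_dualE eE.
have /(left_integralE HS) -> := lL.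
have SSvL : inL (Si (Si v)) by apply: inL_antipodei.
have -> : PiL b * l * u * Si v = PiL b * (h * (Si (Si v) * (star t * star t) * u)).
  rewrite -!mulrA; congr (_ * _); rewrite (inLR_comm H uL SvR) pair_l !mulrA.
  congr (_ * _); have kkvR : inR (k * (k * Si v)) by do ?[apply: inR_mul => //].
  by rewrite -!mulrA (haar_mulR HS hh kkvR) !(antipodeiM HS) -pair_star_t !mulrA.
rewrite (pairing_inLl HS); last exact: inL_PiL.
rewrite (dual_act_mulrL HS); last by do ?[apply: inL_mul => //].
have -> : dual_act lambda h * (Si (Si v) * (star t * star t) * u) = 1.
  by rewrite -zv !mulrA.
by rewrite mulr1 -[PiL b]mul1r (counit_PiL H) mul1r.
Qed.

Hypothesis lambdaN : forall b : A, (forall a, pairing lambda (a * b) = 0) -> b = 0.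

(** e_lambda is lambda shifted by units, so it inherits the nondegeneracy that determines l from b l
    |-> eps(b). *)
Lemma pair_bidual_unique (Phi : dual (dual A)) :
  dual_act Phi (e_of lambda) = 1 -> Phi = bidual l.
Proof.
have [u [v [uL vL uv eE _]]] := pair_e_lambda.
have [l' ->] := bidual_surj Phi.
rewrite -pair_bidual !dual_act_bidual => ll'; congr bidual; apply/eqP.
rewrite -subr_eq0; apply/eqP.
have [uU uE] := falg_unit uv.
have vU : v \is a GRing.unit by rewrite -uE unitrV.
have SvU := antipodei_unit vU.
apply: (mulIr uU); apply: (mulIr SvU); rewrite !mul0r.
apply: lambdaN => a; rewrite !mulrA mulrBr !mulrBl pairingB.
have := congr1 (fun phi => pairing phi a) ll'; rewrite !act_dualE !eE => ->.
exact: subrr.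
Qed.

(** * The quasi-basis of E and the index *)

Let y := S (star t * t).

(** By coassociativity the sum is lambda(S^-1(h1)) n_R(h2) with n_R(h2) = S^-1(PiL(h2)); [sw_PiL2]
    reduces it to a sum over Delta(1), namely 1_1 eps(z 1_2) = PiR(z). *)
Lemma haar_quasi_basis : \sw(a, b <- h) (b * E (Si a)) = S z.
Proof.
transitivity (\sw(a, b <- h) \sw(c, d <- a) (pairing lambda (Si c) *: (b * Si d))).
  apply: eq_tlift => a b; rewrite /E /dual_act (sw_antipodei HS); last by lin.
  by rewrite mul_tlift; apply: eq_tlift => c d; rewrite scalerAr.
rewrite (sw_coassoc (F := fun c d b => pairing lambda (Si c) *: (b * Si d))); last by lin.
transitivity (\sw(c, e <- h) (pairing lambda (Si c) *: Si (PiL e))).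
  apply: eq_tlift => c e; rewrite -n_RE// /n_R scale_tlift.
  by apply: eq_tlift => d b.
rewrite (sw_PiL2 H (f := fun c e => pairing lambda (Si c) *: Si e)); last by lin.
transitivity (\sw(a, b <- Si 1) (pairing lambda (h * b) *: a)).
  rewrite (sw_antipodei HS); last by lin.
  apply: eq_tlift => a b; rewrite (antipodeiM HS).
  by rewrite -[in X in Si X * _](antipode_haar HS hh) (antipodeKi HS).
rewrite (antipodei1 HS) (antipode_inL H)// PiRE.
transitivity (\sw(a, b <- (1 : A)) (pairing lambda (h * PiL b) *: a)).
  rewrite (sw_PiL2 H (f := fun a b => pairing lambda (h * b) *: a)); last by lin.
  by apply: eq_tlift => a b; rewrite mulr1.
apply: eq_tlift => a b; rewrite (pairing_inLr HS); last exact: inL_PiL.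
by rewrite (counit_PiL H).
Qed.

Lemma pair_yR : inR y.
Proof. by apply: (inR_antipode H); apply: (inL_mul H). Qed.

(** [left_integral_sw] brings x out of E to the front; what remains is S(z) y = S(t^* t z) = 1. *)
Lemma pair_expansion x : \sw(a, b <- h) (b * y * E (Si a * x)) = x.
Proof.
have hL : left_integral h by case: hh.
transitivity (x * ((\sw(a, b <- h) (b * E (Si a))) * y)).
  rewrite tlift_mul mul_tlift.
  transitivity (\sw(a, b <- h) (x * b * y * E (Si a))); last first.
    apply: eq_tlift => a b; rewrite -!mulrA; congr (_ * (_ * _)).
    by rewrite (inLR_comm H (inL_dual_act HS lambdaL (Si a)) pair_yR).
  rewrite (left_integral_sw HS (f := fun a b => b * y * E (Si a)))//; last by rewrite /E; lin.
  by apply: eq_tlift => a b; rewrite (antipodeiM HS) (antipodeKi HS).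
by rewrite haar_quasi_basis /y -(antipodeM H) pair_zE (antipode1 H) mulr1.
Qed.

Hypothesis lambdaN' : forall a : A, (forall b, pairing lambda (a * b) = 0) -> a = 0.

(** The mirror image follows by nondegeneracy, since lambda(E(a) c) and lambda(a E(c)) are both
    eps(E(a) E(c)). *)
Lemma pair_expansion' x : \sw(a, b <- h) (E (x * (b * y)) * Si a) = x.
Proof.
apply/eqP; rewrite -subr_eq0; apply/eqP; apply: lambdaN' => c.
rewrite mulrBl pairingB tlift_mul pairing_tlift.
rewrite (eq_tlift (g := fun a b => pairing lambda (x * (b * y * E (Si a * c))))).
  rewrite -pairing_tlift -mul_tlift pair_expansion; exact: subrr.
have EL := inL_dual_act HS lambdaL.
move=> a b; rewrite -[in LHS]mulrA [x * (_ * E _)]mulrA.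
rewrite [LHS](pairing_inLl HS); last exact: EL.
by rewrite [RHS](pairing_inLr HS) //; apply: EL.
Qed.

(* A quasi-basis is not unique, so dual_Ind is compared with the explicit one. *)
Lemma pair_dual_Ind : dual_Ind lambda = \sw(a, b <- h) (b * y * Si a).
Proof.
pose uv := [seq ((comul h : 'M_(_, _)) i j *: (bas j * y), Si (bas i)) |
  i <- enum 'I_(\dim {:A}), j <- enum 'I_(\dim {:A})].
have uvE (V : lmodType C) (f : A -> A -> V) : bilin f ->
    \sum_(p <- uv) f p.1 p.2 = \sw(a, b <- h) f (b * y) (Si a).
  move=> bf; rewrite /uv big_allpairs_dep /= big_enum; apply: eq_bigr => i _.
  by rewrite big_enum; apply: eq_bigr => j _; rewrite bilZl.
have uvB : quasi_basis (dual_act lambda) uv.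
  move=> x; split.
    rewrite (uvE _ (fun a b => a * dual_act lambda (b * x))); last by lin.
    exact: pair_expansion.
  rewrite (uvE _ (fun a b => dual_act lambda (x * a) * b)); last by lin.
  exact: pair_expansion'.
rewrite -(uvE _ (fun a b => a * b)); last by lin.
rewrite /dual_Ind /watatani_index.
have := xgetPex [::] (ex_intro (quasi_basis (dual_act lambda)) uv uvB).
set ab := xget _ _ => abB.
(* The double sum contracts to either index, by one half of each quasi-basis property. *)
transitivity (\sum_(p <- ab) \sum_(q <- uv) p.1 * (dual_act lambda (p.2 * q.1) * q.2)).
  by apply: eq_bigr => p _; rewrite -mulr_sumr (proj2 (uvB _)).
rewrite exchange_big /=; apply: eq_bigr => q _.
under eq_bigr do rewrite mulrA.
by rewrite -mulr_suml (proj1 (abB _)).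
Qed.

(** y = S(t) k. The factor S(t) passes through h to become t in the first leg, where S^-1 turns it
    into a second k; this matches l = h k k. *)
Lemma pair_dual_Ind_n_R : dual_Ind lambda = n_R l.
Proof.
have SSk : inR (S t) by apply: inR_antipode.
rewrite pair_dual_Ind {1}pair_l -mulrA /n_R (sw_mulrR H); [|by lin|exact: inR_mul].
have -> : y = S t * k by rewrite /y (antipodeM H) pair_star_t (antipodeiK HS).
transitivity (\sw(a, b <- h * S t) (b * k * Si a)).
  by rewrite (sw_mulrR H)//; [apply: eq_tlift => a b; rewrite mulrA|lin].
rewrite -(haar_mulL HS hh)// (sw_mulrL H)//; last by lin.
by apply: eq_tlift => a b; rewrite (antipodeiM HS) (antipodeKi HS) !mulrA.
Qed.

Let c := PiL l.

Lemma pair_c_central x : x * c = c * x.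
Proof.
have -> : c = S (n_R l) by rewrite n_RE// (antipodeiK HS).
by rewrite -[x](antipodeiK HS) -!(antipodeM H) n_R_comm.
Qed.

Lemma pair_ch : c * h = h * k * k * h.
Proof. by rewrite -(haar_l HS hh) {1}pair_l. Qed.

(** For x = t^* b one has star b * c * b = E(star x * (c h) * x), and c h = h k k h makes the
    argument star (k h x) * (k h x). *)
Lemma pair_c_definite b : inL b -> b != 0 -> 0 < eps (star b * c * b).
Proof.
move=> bL b0; pose x := star t * b.
have xL : inL x by apply: inL_mul.
have sxL : inL (star x) by apply: inL_star.
have cL : inL c by apply: inL_PiL.
have -> : star b * c * b = E (star x * (c * h) * x).
  rewrite /E (dual_act_mulrL HS)// (dual_act_mulLl HS)// (dual_act_mulLl HS)//.
  rewrite -[dual_act lambda h]/z [star x](wstarM HS) (wstarK HS) /x.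
  have tzb : t * (z * (star t * b)) = b by rewrite !mulrA pair_tz mul1r.
  by rewrite !mulrA -[star b * t * c]mulrA (pair_c_central t) -!mulrA tzb.
rewrite counit_dual_act.
have -> : star x * (c * h) * x = star (k * h * x) * (k * h * x).
  by rewrite pair_ch !(wstarM HS) ks (star_haar HS hh) !mulrA.
apply: lambdaF => //; apply: contra_neq b0 => khx.
apply: (mulrI stU); rewrite mulr0; apply: pair_haar_eq0 => //.
by apply: (mulrI pair_k_unit); rewrite mulr0 mulrA.
Qed.

(** c is central, so S^2(c) = c by the twisted trace property, and its fourth root r is fixed too.
    Hence S^-1(r^2) is self-adjoint, and n_R(l) is its square. *)
Lemma pair_n_R_positive : positive_element (n_R l) /\ n_R l \is a GRing.unit.
Proof.
have cL : inL c by apply: inL_PiL.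
have SSM a b : S (S (a * b)) = S (S a) * S (S b) by rewrite !(antipodeM H).
have SSc : S (S c) = c.
  apply: counit_injr => // [|b bL].
    by apply: (inL_antipode H); apply: (inR_antipode H).
  by rewrite -(counit_comm H)// pair_c_central.
have [p [rL rs r4 rU]] := pair_definite_root cL pair_c_definite.
have SSr : S (S (horner_alg c p)) = horner_alg c p.
  apply: (horner_alg_ind (U := fun x => S (S x) = x)) => // [|x x' xx xx'|a x x' xx xx'].
  - by rewrite !(antipode1 H).
  - by rewrite SSM xx xx'.
  - by rewrite !linearP /= xx xx'.
move: rL rs r4 rU SSr; set r := horner_alg c p => rL rs r4 rU SSr.
have nE : n_R l = Si (r * r) * Si (r * r) by rewrite n_RE// -/c -{1}r4 (antipodeiM HS).
split; last first.
  have rrU : Si (r * r) \is a GRing.unit by apply: antipodei_unit; rewrite unitrMl.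
  by rewrite nE unitrMl.
exists (Si (r * r)); rewrite nE; congr (_ * _).
rewrite -(antipode_star HS) (wstarM HS) rs.
by rewrite -[RHS](antipodeKi HS) SSM SSr.
Qed.

(** * Identities for e_l and e_lambda *)

Let e := k * h * k.

Lemma pair_e_sqr : e * e = e * n_R l.
Proof.
have nh : n_R l * h = h * k * k * h.
  rewrite -pair_ch (mulR_haar HS hh); last exact: inR_n_R.
  by rewrite n_RE// (antipodeiK HS).
rewrite [e * n_R l]n_R_comm// /e !mulrA -[n_R l * k]n_R_comm// -[k * n_R l * h]mulrA nh.
by rewrite !mulrA.
Qed.

(** This is t^* e; it arises when the last factor of e = k h t^* is moved into phi ⇀ e. *)
Let c0 := star t * t * h * k.

Lemma pair_e_act phi : e * dual_act phi e =
  \sw(a, b <- (1 : A)) (pairing phi (c0 * b) *: (k * h * a)).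
Proof.
have eE : e = k * h * star t by rewrite /e -mulrA pair_hk mulrA.
rewrite {1}eE -mulrA -(dual_act_mulLl HS)//.
have -> : star t * e = c0 by rewrite /e /c0 pair_kh !mulrA.
rewrite -mulrA (haar_r HS hh) /dual_act fun_tlift /= mulrA mul_tlift.
rewrite (eq_tlift (g := fun a b => pairing phi b *: (k * h * PiR a))); last first.
  by move=> a b; rewrite linearZ scalerAr.
rewrite (sw_PiR1 H (f := fun a b => pairing phi b *: (k * h * a)))//; lin.
Qed.

(** In lambda(a u S^-1(v)) the factor t^* t of c0 cancels E(h) = z, and u and v cancel each
    other. *)
Lemma pair_e_lambda_c0 b d :
  pairing (e_of lambda) (c0 * PiL b * d) = eps (k * PiL b * d).
Proof.
have [u [v [uL vL uv eE _]]] := pair_e_lambda.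
have SvR : inR (Si v) by apply: inR_antipodei.
have sttL : inL (star t * t) by apply: inL_mul.
rewrite eE; have -> : c0 * PiL b * d * u * Si v =
    star t * t * (h * (PiR (k * PiL b * d * u) * Si v)).
  by rewrite (mulrA h) -(haar_r HS hh) /c0 !mulrA.
rewrite (pairing_inLl HS)// (haar_mulR HS hh); last first.
  by apply: inR_mul => //; apply: inR_PiR.
rewrite (dual_act_mulrL HS); last first.
  by apply: inL_antipodei => //; apply: inR_mul => //; apply: inR_PiR.
rewrite mulrA pair_zE mul1r (counit_antipodei HS) (counit_PiR H) -!mulrA.
by rewrite !mulrA -(counit_inR H)// (antipodeiK HS) -mulrA uv mulr1.
Qed.

End IntegralPair.

(** * Crossed products *)

Section DualAct.
Variables (R : realType) (A : preWeakHopfType R).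
Hypothesis HS : weak_star_hopf A.
Local Notation C := R[i].
Let H := wshW HS.

Lemma sw_dual_act (V : lmodType C) (f : A -> A -> V) phi a : bilin f ->
  \sw(b, c <- dual_act phi a) f b c = \sw(b, c <- a) f b (dual_act phi c).
Proof.
move=> bf; rewrite /dual_act tlift_comul_tlift.
transitivity (\sw(u, v <- a) \sw(b, c <- u) (pairing phi v *: f b c)).
  by apply: eq_tlift => u v; rewrite sw_scale.
rewrite (sw_coassoc (F := fun b c v => pairing phi v *: f b c)); last by lin.
apply: eq_tlift => b c; rewrite (linear_tlift (L := f b)); last by lin.
by apply: eq_tlift => u v; rewrite bilZr.
Qed.

Lemma dual_actM (phi : dual A) (a b : A) :
  dual_act phi (a * b) = \sw(f, g <- phi) (dual_act f a * dual_act g b).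
Proof.
rewrite {1}/dual_act (sw_mul H); last by lin.
under [RHS]eq_tlift => f g.
  rewrite /dual_act tlift_mul; under eq_tlift => a1 a2 do rewrite mul_tlift.
  over.
rewrite [RHS]tlift_exch; apply: eq_tlift => a1 a2.
rewrite [RHS]tlift_exch; apply: eq_tlift => b1 b2.
rewrite -dual_comulE' tlift_scale; apply: eq_tlift => f g.
by rewrite -scalerAl -scalerAr scalerA.
Qed.

Lemma dual_act_PiL1 (phi : dual A) : dual_act (PiL phi) 1 = dual_act phi 1 :> A.
Proof.
apply: pairing_inj => psi; rewrite !pairing_dual_act -!dual_counitE'.
exact: (counit_PiL (wshW (weak_star_hopf_dual HS))).
Qed.

Lemma left_subalg_PiL (a : A) : left_subalg (PiL a).
Proof.
exists (act_dual a 1); rewrite PiLE; apply: eq_tlift => u v.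
by rewrite act_dualE.
Qed.

End DualAct.

(* The crossed product only inherits these properties, which suffice for the
   iterated crossed product; its * is never used. *)
Record unstarred_module_algebra (R : realType) (A : preWeakHopfType R)
    (M : modAlg A) : Prop := UnstarredModuleAlgebra {
  umulA : associative (@mmul _ _ M);
  umul1l : left_id (mone M) (@mmul _ _ M);
  umul1r : right_id (mone M) (@mmul _ _ M);
  umul_bilin : bilin (@mmul _ _ M);
  uact_bilin : bilin (@mact _ _ M);
  uactA : forall (a b : A) (m : M), mact (a * b) m = mact a (mact b m);
  uact1 : forall m : M, mact 1 m = m;
  uactM : forall (a : A) (m n : M),
    mact a (mmul m n) = \sw(a1, a2 <- a) (mmul (mact a1 m) (mact a2 n));
  uact_one : forall a : A, mact a (mone M) = mact (PiL a) (mone M)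
}.

Lemma module_algebra_unstarred (R : realType) (A : preWeakHopfType R) (M : modAlg A) :
  weak_hopf A -> is_module_algebra M -> unstarred_module_algebra M.
Proof.
move=> H [*]; split=> //.
by move=> a; rewrite -(PiL_antipode H).
Qed.

Section CrossedTheory.
Variables (R : realType) (A : preWeakHopfType R).
Hypothesis HS : weak_star_hopf A.
Local Notation C := R[i].
Let H := wshW HS.
Variable M : modAlg A.
Hypothesis HM : unstarred_module_algebra M.
Implicit Types (m n p : M) (a b c : A) (x y : crossed_space M).

Let mulB := umul_bilin HM.
Let actB := uact_bilin HM.

Lemma proj_linear : linear (@proj R A M).
Proof. by move=> c s t; rewrite projD projZ. Qed.

Lemma crossed_bilin : bilin (@crossed R A M).
Proof.
split=> [a c m n|m c a b]; rewrite /crossed -proj_linear; congr proj;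
  apply/ffunP => i; rewrite !ffunE.
  by rewrite scalerDr !scalerA mulrC.
by rewrite linearP scalerDl scalerA.
Qed.
Let crB := crossed_bilin.

Lemma mlift_linear (V : lmodType C) (f : M -> A -> V) : bilin f -> linear (mlift f).
Proof.
move=> [fl _] c s t; rewrite /mlift scaler_sumr -big_split; apply: eq_bigr => i _.
by rewrite !ffunE fl.
Qed.

Lemma mlift_mtensor (V : lmodType C) (f : M -> A -> V) m a : bilin f ->
  mlift f (mtensor m a) = f m a.
Proof.
move=> bf; rewrite {2}[a]crd_sum (linear_sumZ (L := f m)); last by lin.
by apply: eq_bigr => i _; rewrite ffunE bilZl.
Qed.

Lemma mtens_sum (t : mtens M) : t = \sum_i mtensor (t i) (bas i).
Proof.
apply/ffunP => i; rewrite sum_ffunE (bigD1 i)//= big1 => [|j ji].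
  by rewrite ffunE crd_bas eqxx scale1r addr0.
by rewrite ffunE crd_bas (negPf ji) scale0r.
Qed.

(** Functions that descend to the tensor product over A_L. Every element of A_L has the form
    [PiL b], and for module algebras b acts on 1_M as [PiL b] does. *)
Definition balanced (V : lmodType C) (f : M -> A -> V) :=
  bilin f /\ forall m a b, f m (PiL b * a) = f (mmul m (mact b (mone M))) a.

Lemma mlift_repr_proj (V : lmodType C) (f : M -> A -> V) t :
  balanced f -> mlift f (repr (proj t)) = mlift f t.
Proof.
move=> [bf fb]; have fl := mlift_linear bf.
suff f0 s : balancing s -> mlift f s = 0.
  have /f0 : balancing (repr (proj t) - t) by apply/projE; rewrite projK.
  by rewrite addrC -scaleN1r fl scaleN1r addrC => /eqP; rewrite subr_eq0 => /eqP.
elim=> [|c u v _ u0 _ v0|m b a bL]; first exact: lin0.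
  by rewrite fl u0 v0 scaler0 addr0.
have bE : PiL b = b by apply: (left_subalg_inL HS).
by rewrite addrC -scaleN1r fl !mlift_mtensor// scaleN1r -{2}bE fb addNr.
Qed.

Lemma mlift_crossed (V : lmodType C) (f : M -> A -> V) m a :
  balanced f -> mlift f (repr (crossed m a)) = f m a.
Proof. by move=> fb; rewrite mlift_repr_proj// mlift_mtensor//; case: fb. Qed.

Lemma mlift_repr_linear (V : lmodType C) (f : M -> A -> V) :
  balanced f -> linear (fun x : crossed_space M => mlift f (repr x)).
Proof.
move=> fb c x y; rewrite -[x in LHS]projK -[y in LHS]projK -proj_linear.
by rewrite mlift_repr_proj// (mlift_linear (proj1 fb)).
Qed.

Lemma crossed_space_ext (V : lmodType C) (F G : crossed_space M -> V) :
  linear F -> linear G -> (forall m a, F (crossed m a) = G (crossed m a)) -> F =1 G.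
Proof.
move=> lF lG FG x; rewrite -[x]projK [repr x]mtens_sum.
have sumE (L : crossed_space M -> V) (t : 'I_(\dim {:A}) -> mtens M) : linear L ->
    L (proj (\sum_i t i)) = \sum_i L (proj (t i)).
  move=> lL; apply: (big_morph (fun t => L (proj t))) => [s u|].
    by rewrite projD linD.
  by rewrite (lin0 proj_linear) lin0.
by rewrite !sumE//; apply: eq_bigr => i _; apply: FG.
Qed.

Lemma crossed_balance m a b :
  crossed m (PiL b * a) = crossed (mmul m (mact b (mone M))) a.
Proof.
apply/projE; rewrite (uact_one HM); apply: BalancingG.
exact: left_subalg_PiL.
Qed.

Let G m a n b := \sw(a1, a2 <- a) crossed (mmul m (mact a1 n)) (a2 * b).

(** With c = a2 PiL(b), the action on 1_M moves back into A as PiL(c1), and PiL(c1) c2 = c. *)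
Lemma crossed_mul_balancedr m a : balanced (G m a).
Proof.
split=> [|n c b]; first by rewrite /G; lin.
rewrite /G; symmetry.
transitivity (\sw(a1, a2 <- a) \sw(c1, c2 <- a2)
    crossed (mmul (mmul m (mact a1 n)) (mact (c1 * b) (mone M))) (c2 * c)).
  rewrite -(sw_coassoc (F := fun a1 c1 c2 => crossed
    (mmul (mmul m (mact a1 n)) (mact (c1 * b) (mone M))) (c2 * c))); last by lin.
  apply: eq_tlift => a1 a2.
  rewrite (uactM HM) (linear_tlift (L := fun p => crossed (mmul m p) (a2 * c))); last by lin.
  by apply: eq_tlift => c1 c2; rewrite (umulA HM) (uactA HM).
apply: eq_tlift => a1 a2.
transitivity (\sw(c1, c2 <- a2 * PiL b) crossed (mmul m (mact a1 n)) (PiL c1 * c2 * c)).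
  rewrite (sw_mulrL H); [|by lin|exact: inL_PiL].
  apply: eq_tlift => c1 c2; rewrite -mulrA crossed_balance.
  by rewrite !(uactA HM) -(uact_one HM).
rewrite -(linear_tlift (L := fun d => crossed (mmul m (mact a1 n)) (d * c))); last by lin.
by rewrite (PiL_mul_id H) -mulrA.
Qed.

Lemma mlift_bilin (V : lmodType C) (F : M -> A -> M -> A -> V) t :
  (forall n b, bilin (fun m a => F m a n b)) ->
  bilin (fun m a => mlift (F m a) t).
Proof.
by move=> FB; rewrite /mlift; split=> [a|m]; apply: linear_sumf => i;
  case: (FB (t i) (bas i)).
Qed.

(** Apply d to the product of 1_M and m, using Delta(d) = 1_1 d ⊗ 1_2. *)
Lemma act_inL d m : inL d -> mact d m = mmul (mact d (mone M)) m.
Proof.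
move=> dL; rewrite -{1}[m](umul1l HM) (uactM HM) (sw_inLr H)//; last by lin.
under eq_tlift => u v do rewrite (uactA HM).
by rewrite -(uactM HM) (uact1 HM).
Qed.

Lemma crossed_mul_balancedl y : balanced (fun m a => mlift (G m a) (repr y)).
Proof.
split; first by apply: mlift_bilin => n b; rewrite /G; lin.
move=> m a b; apply: eq_bigr => i _; set n := repr y i.
rewrite /G (sw_mulLl H); [|by lin|exact: inL_PiL].
transitivity (\sw(a1, a2 <- a)
  crossed (mmul m (mmul (mact b (mone M)) (mact a1 n))) (a2 * bas i)); last first.
  by apply: eq_tlift => a1 a2; rewrite (umulA HM).
by apply: eq_tlift => a1 a2; rewrite (uactA HM) (act_inL _ (inL_PiL H b)) -(uact_one HM).
Qed.

Lemma crossed_mulE m a n b :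
  crossed_mul (crossed m a) (crossed n b) =
  \sw(a1, a2 <- a) crossed (mmul m (mact a1 n)) (a2 * b).
Proof.
rewrite /crossed_mul (mlift_crossed m a (crossed_mul_balancedl _)).
exact: (mlift_crossed n b (crossed_mul_balancedr m a)).
Qed.

Lemma crossed_mul_bilin : bilin (@crossed_mul R A M).
Proof.
split=> [y|x]; first exact: (mlift_repr_linear (crossed_mul_balancedl y)).
rewrite /crossed_mul /mlift; apply: linear_sumf => i.
exact: (mlift_repr_linear (crossed_mul_balancedr _ _)).
Qed.

Lemma crossed_act_balanced phi : balanced (fun m a => crossed m (dual_act phi a)).
Proof.
split=> [|m a b]; first by lin.
by rewrite (dual_act_mulLl HS) ?crossed_balance//; apply: inL_PiL.
Qed.

Lemma crossed_actE phi m a : crossed_act phi (crossed m a) = crossed m (dual_act phi a).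
Proof. exact: (mlift_crossed m a (crossed_act_balanced phi)). Qed.

Lemma crossed_act_bilin : bilin (@crossed_act R A M).
Proof.
split=> [x|phi]; last exact: (mlift_repr_linear (crossed_act_balanced phi)).
rewrite /crossed_act /mlift; apply: linear_sumf => i.
by apply: (linear_comp (proj2 crB _)); apply: dual_act_linearl.
Qed.

(** The leg 1_2 returns to M as its action on 1_M, and Delta(1) then acts on the product of n and
    1_M. *)
Lemma sw_one_crossed m n b :
  \sw(u, v <- (1 : A)) crossed (mmul m (mact u n)) (v * b) = crossed (mmul m n) b.
Proof.
transitivity (\sw(u, v <- (1 : A)) crossed (mmul m (mmul (mact u n) (mact v (mone M)))) b).
  transitivity (\sw(u, v <- (1 : A)) crossed (mmul m (mact u n)) (PiL v * b)).
    rewrite (sw_PiL2 H (f := fun u v => crossed (mmul m (mact u n)) (v * b))); last by lin.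
    by apply: eq_tlift => u v; rewrite mulr1.
  by apply: eq_tlift => u v; rewrite crossed_balance (umulA HM).
rewrite -(linear_tlift (L := fun p => crossed (mmul m p) b)); last by lin.
by rewrite -(uactM HM) (uact1 HM) (umul1r HM).
Qed.

Lemma crossed_mul_cross1 m n b :
  crossed_mul (crossed m 1) (crossed n b) = crossed (mmul m n) b.
Proof. by rewrite crossed_mulE sw_one_crossed. Qed.

Lemma crossed_mul_1cross m a b :
  crossed_mul (crossed m a) (crossed (mone M) b) = crossed m (a * b).
Proof.
rewrite crossed_mulE -[a in RHS](PiL_mul_id H) tlift_mul.
rewrite (linear_tlift (L := fun c => crossed m c)); last by lin.
by apply: eq_tlift => a1 a2; rewrite -mulrA crossed_balance.
Qed.

Lemma crossed_mulA x y u :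
  crossed_mul x (crossed_mul y u) = crossed_mul (crossed_mul x y) u.
Proof.
have bB := crossed_mul_bilin.
apply: (@crossed_space_ext _ (fun x => crossed_mul x (crossed_mul y u))
  (fun x => crossed_mul (crossed_mul x y) u)); [lin|lin|] => m a {x}.
apply: (@crossed_space_ext _ (fun y => crossed_mul (crossed m a) (crossed_mul y u))
  (fun y => crossed_mul (crossed_mul (crossed m a) y) u)); [lin|lin|] => n b {y}.
apply: (@crossed_space_ext _ (fun u => crossed_mul (crossed m a) (crossed_mul (crossed n b) u))
  (fun u => crossed_mul (crossed_mul (crossed m a) (crossed n b)) u)); [lin|lin|] => p c {u}.
pose F a1 a2 a3 b1 b2 := crossed (mmul m (mmul (mact a1 n) (mact (a2 * b1) p))) (a3 * b2 * c).
transitivity (\sw(a', a3 <- a) \sw(a1, a2 <- a') \sw(b1, b2 <- b) F a1 a2 a3 b1 b2).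
  rewrite crossed_mulE (linear_tlift (L := fun x => crossed_mul (crossed m a) x)); last by lin.
  transitivity (\sw(b1, b2 <- b) \sw(a', a3 <- a) \sw(a1, a2 <- a') F a1 a2 a3 b1 b2).
    apply: eq_tlift => b1 b2; rewrite crossed_mulE; apply: eq_tlift => a' a3.
    rewrite (uactM HM).
    rewrite (linear_tlift (L := fun q : M => crossed (mmul m q) (a3 * (b2 * c)))); last by lin.
    by apply: eq_tlift => a1 a2; rewrite /F (uactA HM) mulrA.
  rewrite tlift_exch; apply: eq_tlift => a' a3; exact: tlift_exch.
rewrite (sw_coassoc (F := fun a1 a2 a3 => \sw(b1, b2 <- b) F a1 a2 a3 b1 b2)); last first.
  by rewrite /F; lin.
rewrite crossed_mulE (linear_tlift (L := fun x => crossed_mul x (crossed p c))); last by lin.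
apply: eq_tlift => a1 a2; rewrite crossed_mulE (sw_mul H); last by lin.
apply: eq_tlift => a3 a4; apply: eq_tlift => b1 b2.
by rewrite /F (umulA HM).
Qed.

Lemma crossed_product_unstarred : unstarred_module_algebra (crossed_product M).
Proof.
have mB := crossed_mul_bilin; have aB := crossed_act_bilin.
split=> //=.
- exact: crossed_mulA.
- move=> x; apply: (@crossed_space_ext _ (fun x => crossed_mul (crossed (mone M) 1) x)
    (fun x => x)); [lin|lin|] => m a.
  by rewrite crossed_mul_cross1 (umul1l HM).
- move=> x; apply: (@crossed_space_ext _ (fun x => crossed_mul x (crossed (mone M) 1))
    (fun x => x)); [lin|lin|] => m a.
  by rewrite crossed_mul_1cross mulr1.
- move=> phi psi x; apply: (@crossed_space_ext _ (fun x => crossed_act (phi * psi) x)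
    (fun x => crossed_act phi (crossed_act psi x))); [lin|lin|] => m a.
  by rewrite !crossed_actE dual_act_mul.
- move=> x; apply: (@crossed_space_ext _ (fun x => crossed_act 1 x) (fun x => x));
    [lin|lin|] => m a.
  by rewrite !crossed_actE dual_act1.
- move=> phi x y.
  apply: (@crossed_space_ext _ (fun x => crossed_act phi (crossed_mul x y))
    (fun x => \sw(f, g <- phi) crossed_mul (crossed_act f x) (crossed_act g y)));
    [lin|lin|] => m a {x}.
  apply: (@crossed_space_ext _ (fun y => crossed_act phi (crossed_mul (crossed m a) y))
    (fun y => \sw(f, g <- phi) crossed_mul (crossed_act f (crossed m a)) (crossed_act g y)));
    [lin|lin|] => n b {y}.
  rewrite crossed_mulE (linear_tlift (L := fun x => crossed_act phi x)); last by lin.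
  under [RHS]eq_tlift => f g.
    rewrite !crossed_actE crossed_mulE sw_dual_act; last by lin.
    over.
  rewrite [RHS]tlift_exch; apply: eq_tlift => a1 a2.
  rewrite crossed_actE (dual_actM HS) (linear_tlift (L := crossed _))//; lin.
- by move=> phi; rewrite !crossed_actE (dual_act_PiL1 HS).
Qed.

End CrossedTheory.

(** * Jones relations *)

Section JonesRelations.
Variables (R : realType) (A : preWeakHopfType R).
Hypothesis HS : weak_star_hopf A.
Local Notation C := R[i].
Local Notation D := (dual A).
Let H := wshW HS.
Let DHS := weak_star_hopf_dual HS.
Let DH := wshW DHS.
Variable M : modAlg A.
Hypothesis HM : unstarred_module_algebra M.

Let MA := crossed_product M.
Let HMA : unstarred_module_algebra MA := crossed_product_unstarred HS HM.
Let emb (a : A) : MA := crossed (mone M) a.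
Let one : MA := emb 1.
Let cr : MA -> D -> crossed_space MA := @crossed R D MA.
Let mul := @crossed_mul R D MA.

Let crB : bilin cr := @crossed_bilin R D MA.
Let mulB : bilin mul := crossed_mul_bilin DHS HMA.
Let emb_lin : linear emb.
Proof. by rewrite /emb; case: (@crossed_bilin R A M) => _; apply. Qed.

Let embM a b : mmul (emb a) (emb b) = emb (a * b).
Proof. exact: (crossed_mul_1cross HS HM). Qed.

Let act_emb phi a : mact phi (emb a) = emb (dual_act phi a).
Proof. exact: (crossed_actE HS HM). Qed.

Let cr1l (x y : MA) phi : mul (cr x 1) (cr y phi) = cr (mmul x y) phi.
Proof. exact: (crossed_mul_cross1 DHS HMA). Qed.

Let cr1r (x : MA) phi psi : mul (cr x phi) (cr one psi) = cr x (phi * psi).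
Proof. exact: (crossed_mul_1cross DHS HMA). Qed.

Let balance (x : MA) f phi : cr x (PiL f * phi) = cr (mmul x (mact f one)) phi.
Proof. exact: (crossed_balance HMA). Qed.

Lemma jones_sqr_r phi psi chi :
  phi * psi = chi -> mul (cr one phi) (cr one psi) = cr one chi.
Proof. by move=> <-; rewrite cr1r. Qed.

Lemma jones_sqr_l a b c : a * b = c -> mul (cr (emb a) 1) (cr (emb b) 1) = cr (emb c) 1.
Proof. by move=> <-; rewrite cr1l embM. Qed.

Lemma jones_product e phi :
  mul (cr one phi) (cr (emb e) 1) = \sw(f, g <- phi) cr (emb (dual_act f e)) g.
Proof.
rewrite /mul /cr (crossed_mulE DHS HMA); apply: eq_tlift => f g.
by rewrite act_emb mulr1 [mmul one _](umul1l HMA).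
Qed.

(** In the right-hand copy of kappa hd kappa the integral turns g kappa into its [PiL], and
    [sw_PiL2] collapses Delta(ehat kappa) to 1_1 ehat kappa ⊗ 1_2. As ehat kappa = kappa lambda, the
    assumption lambda ⇀ e = 1 applies, and kappa ⇀ 1 passes back to the dual and restores ehat. *)
Lemma jones_hat (e : A) (hd kappa lambda ehat : D) :
  normalized_haar hd -> inR kappa -> ehat = kappa * hd * kappa ->
  lambda = hd * kappa * kappa -> dual_act lambda e = 1 ->
  mul (mul (cr one ehat) (cr (emb e) 1)) (cr one ehat) = cr one ehat.
Proof.
move=> hdH kR ehE lamE lam1; rewrite jones_product.
have elin := dual_act_linearl e.
rewrite (linear_tlift (L := fun x => mul x (cr one ehat))); last by lin.
transitivity (\sw(f, g <- ehat * kappa) cr (emb (dual_act f e)) (PiL g * (hd * kappa))).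
  rewrite (sw_mulrR DH)//; last by lin.
  apply: eq_tlift => f g; rewrite cr1r ehE.
  by rewrite [PiL _ * _]mulrA -(haar_l DHS hdH) !mulrA.
rewrite (sw_PiL2 DH (f := fun f g => cr (emb (dual_act f e)) (g * (hd * kappa)))); last by lin.
transitivity (\sw(f, g <- (1 : D)) cr (mmul one (mact f (mact kappa one))) (g * (hd * kappa))).
  apply: eq_tlift => f g; rewrite [mmul one _](umul1l HMA) !act_emb.
  have -> : f * (ehat * kappa) = f * (kappa * lambda) by rewrite ehE lamE !mulrA.
  by rewrite !dual_act_mul lam1.
rewrite (sw_one_crossed DHS HMA) (umul1l HMA).
transitivity (cr (mmul one (mact kappa one)) (hd * kappa)).
  by rewrite [mmul one _](umul1l HMA).
rewrite -balance.
by rewrite mulrA -(haar_l DHS hdH) -ehE.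
Qed.

(** The iterated crossed product treats A and its dual differently, so [jones_hat] is not simply
    dualized. The partial evaluations G(PiL(1_2)) of Delta(ehat) lie in the left subalgebra of the
    dual, pass into A as S(PiL(1_2)) k, and 1_1 S(1_2) = 1 restores e. *)
Lemma jones_unhat (e k h c0 : A) (ehat : D) :
  e = k * h * k -> inR k ->
  (forall phi, e * dual_act phi e =
     \sw(a, b <- (1 : A)) (pairing phi (c0 * b) *: (k * h * a))) ->
  (forall b d, pairing ehat (c0 * PiL b * d) = counit (k * PiL b * d)) ->
  mul (mul (cr (emb e) 1) (cr one ehat)) (cr (emb e) 1) = cr (emb e) 1.
Proof.
move=> eE kR eact ec0.
rewrite -[mul (mul _ _) _](crossed_mulA DHS HMA) -/mul jones_product.
rewrite (linear_tlift (L := fun x => mul (cr (emb e) 1) x)); last by lin.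
pose G b := \sw(f, g <- ehat) (pairing f (c0 * b) *: g).
transitivity (\sw(a, b <- (1 : A)) cr (emb (k * h * a)) (G b)).
  rewrite /G; under [RHS]eq_tlift => a b.
    rewrite (linear_tlift (L := fun g => cr (emb (k * h * a)) g)); last by lin.
    over.
  rewrite [RHS]tlift_exch; apply: eq_tlift => f g.
  rewrite cr1l embM eact (linear_tlift (L := fun a => cr (emb a) g)); last by lin.
  by apply: eq_tlift => a b; rewrite (linZ _ _ emb_lin) bilZl// bilZr.
have Glin : linear G by rewrite /G; lin.
have GE b d : pairing (G (PiL b)) d = counit (k * PiL b * d).
  rewrite /G tlift_pairing -ec0 -dual_comulE'.
  by apply: eq_tlift => f g; rewrite pairingZ.
clearbody G.
transitivity (\sw(a, b <- (1 : A)) cr (emb (k * h * a)) (G (PiL b))).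
  rewrite (sw_PiL2 H (f := fun a b => cr (emb (k * h * a)) (G b))); last by lin.
  by apply: eq_tlift => a b; rewrite mulr1.
transitivity (\sw(a, b <- (1 : A)) cr (emb (k * h * (a * antipode (PiL b) * k))) 1).
  apply: eq_tlift => a b.
  (* [PiL] is its own transpose, and eps(a PiL(d)) = eps(a d). *)
  have GL : PiL (G (PiL b)) = G (PiL b).
    by apply: dualP => d; rewrite dual_PiLE !GE (counit_PiL H).
  rewrite -[G (PiL b)]mulr1 -{1}GL balance act_emb embM.
  have -> : dual_act (G (PiL b)) 1 = PiR (k * PiL b).
    rewrite /dual_act PiRE; apply: eq_tlift => u v; rewrite GE //.
  rewrite -(inLR_comm H (inL_PiL H b) kR) (PiR_mulr H)//.
  by rewrite -(antipode_inL H) ?mulrA//; apply: inL_PiL.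
rewrite (sw_PiL2 H (f := fun a b => cr (emb (k * h * (a * antipode b * k))) 1)); last by lin.
under eq_tlift => a b do rewrite mulr1.
rewrite -(linear_tlift (L := fun a => cr (emb (k * h * (a * k))) 1)); last by lin.
by rewrite (PiL_antipode H) PiL1 mul1r -eE.
Qed.

End JonesRelations.

(** * Pairs of p-dual integrals *)

Section PDual.
Variables (R : realType).

(** The form of p-duality that can be dualized: by [p_dual_pair_dual] it holds for (lambda, bidual
    l) over the dual. *)
Definition p_dual_pair (A : preWeakHopfType R) (l : A) (lambda : dual A) :=
  [/\ positive_integral l, nondegenerate_integral l,
      positive_integral lambda, nondegenerate_integral lambda
    & dual_act lambda (e_of l) = 1].

Section Pair.
Variable A : preWeakHopfType R.
Hypothesis HS : weak_star_hopf A.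
Let DHS := weak_star_hopf_dual HS.
Variables (l : A) (lambda : dual A).
Hypothesis ll : p_dual_pair l lambda.

Lemma p_dual_pair_integrals : left_integral l /\ left_integral lambda.
Proof. by case: ll => [[lL _] _ [lambdaL _] _ _]. Qed.

Lemma p_dual_pair_faithful : faithful (fun _ => True) (pairing lambda) /\
  faithful (fun _ => True) (fun phi : dual A => pairing phi l).
Proof.
case: ll => [[_ l0] [_ lN] lambda0 lambdaN _]; split.
  apply: (positive_nondegenerate_faithful HS (@pairing_linearr _ _ _)).
    exact: (proj2 (proj1 (positive_dual HS _) lambda0)).
  exact: (proj2 (proj1 (nondegenerate_dual _) lambdaN)).
exact: (positive_nondegenerate_faithful DHS (@pairing_linearl _ _ _)).
Qed.

(* haar and psqrt default to 0 when there is no such element, but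
   lambda ⇀ e_l = 1 excludes e_l = 0; this gives their existence. *)
Lemma p_dual_pair_root : exists h k,
  [/\ normalized_haar h /\ e_of l = k * h * k, inR k, star k = k, k * k = PiR l
    & exists m, [/\ inR m, star m = m & m * m = k]].
Proof.
have [lambdaF _] := p_dual_pair_faithful.
case: ll => [_ _ _ _ E1].
have e0 : e_of l <> 0.
  move=> e0; move: E1; rewrite e0 (lin0 (dual_act_linear _)) => /esym/eqP.
  by rewrite oner_eq0.
have [h hh] : exists h : A, normalized_haar h.
  apply: contrapT => nh; apply: e0; rewrite /e_of /haar xgetPN ?mulr0 ?mul0r// => h hh.
  by apply: nh; exists h.
have [k [kpos kk]] : exists k, positive_element k /\ k * k = d_R l /\ k = psqrt (d_R l).
  apply: contrapT => nk; apply: e0; rewrite /e_of /psqrt xgetPN ?mulr0// => k [kp kk].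
  apply: nk; rewrite /psqrt; case: xgetP => [y yE [yp yy]|/(_ k)[]//].
  by exists y.
case: kk => kk kE; rewrite (d_RE HS) in kk.
have [y yE] := kpos.
(* A positive element is a polynomial in its square, here PiR(l), so k stays in A_R. *)
have kR : inR k.
  have [p ->] := positive_horner_sqr HS (@pairing_linearr _ _ _) lambdaF kpos.
  by apply: (inR_horner HS); rewrite kk; apply: (inR_PiR (wshW HS)).
exists h, k; split=> //.
- by rewrite /e_of (haarE HS hh) -kE.
- exact: positive_star.
have TS : star_subalgebra (fun _ : A => True) by [].
have [||p [rs rr]] := positive_root HS TS (@pairing_linearr _ _ lambda) lambdaF (s := k) => //.
  move=> b _; rewrite yE !mulrA -mulrA -(wstarM HS).
  case: ll => _ _ /(positive_dual HS)[_ lambda0] _ _; exact: lambda0.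
set r := horner_alg _ _ in rs rr.
have rR : inR r by apply: inR_horner.
by exists (r * r); split=> //; [apply: (inR_mul (wshW HS))|rewrite (wstarM HS) rs].
Qed.

Lemma p_dual_pair_bidual : dual_act (bidual l) (e_of lambda) = 1.
Proof.
have [lL lambdaL] := p_dual_pair_integrals.
have [lambdaF lF] := p_dual_pair_faithful.
have [h [k [[hh eE] kR ks kk kroot]]] := p_dual_pair_root.
have Ek : dual_act lambda (k * h * k) = 1 by rewrite -eE; case: ll.
exact: (pair_bidual HS lL lambdaL hh kR ks kk Ek).
Qed.

Lemma p_dual_pair_dual : p_dual_pair lambda (bidual l).
Proof.
case: ll => l0 lN lambda0 lambdaN _; split=> //.
- exact: positive_bidual.
- exact: nondegenerate_bidual.
- exact: p_dual_pair_bidual.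
Qed.

Lemma p_dual_bidual : is_p_dual lambda (bidual l).
Proof.
split=> [|Phi [_ _ Phi1]]; first by case: p_dual_pair_dual.
have [lL lambdaL] := p_dual_pair_integrals.
have [lambdaF lF] := p_dual_pair_faithful.
have [h [k [[hh eE] kR ks kk kroot]]] := p_dual_pair_root.
case: ll => _ _ _ /nondegenerate_dual[_ lambdaN]; rewrite eE => Ek.
by rewrite (pair_bidual_unique HS lL lambdaL hh kR ks kk Ek lambdaF lF kroot lambdaN Phi1).
Qed.

Lemma p_dual_index :
  [/\ positive_element (dual_Ind lambda), dual_Ind lambda \is a GRing.unit,
      dual_Ind lambda = n_R l, n_R l \in 'Z({:A})%VS & right_subalg (n_R l)].
Proof.
have [lL lambdaL] := p_dual_pair_integrals.
have [lambdaF lF] := p_dual_pair_faithful.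
have [h [k [[hh eE] kR ks kk kroot]]] := p_dual_pair_root.
case: ll => _ _ _ /nondegenerate_dual[lambdaN _]; rewrite eE => Ek.
have [npos nunit] := pair_n_R_positive HS lL hh kR ks kk Ek lambdaF lF.
have IE := pair_dual_Ind_n_R HS lL lambdaL hh kR ks kk Ek lambdaN.
split; rewrite ?IE//; last exact: right_subalgP (inR_n_R HS l).
rewrite memv_cap memvf; apply/centvP => x _; exact/esym/(n_R_comm HS).
Qed.

Lemma p_dual_e_sqr : e_of l * e_of l = e_of l * dual_Ind lambda.
Proof.
have [lL _] := p_dual_pair_integrals.
have [h [k [[hh ->] _ _ kk _]]] := p_dual_pair_root.
by have [_ _ -> _ _] := p_dual_index; apply: (pair_e_sqr HS lL hh kk).
Qed.

Lemma Ind_bidual : Ind l = dual_Ind (bidual l).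
Proof.
rewrite /Ind /dual_Ind; congr watatani_index; apply: funext => phi.
by rewrite dual_act_bidual.
Qed.

Variable M : modAlg A.
Hypothesis HM : unstarred_module_algebra M.
Let MA := crossed_product M.
Let N := crossed_product MA.
Let ein (a : A) : N := (mone M ⋊ a : MA) ⋊ (1 : dual A).
Let phin (phi : dual A) : N := (mone M ⋊ (1 : A) : MA) ⋊ phi.

Lemma p_dual_jones_sqr : mmul (ein (e_of l)) (ein (e_of l)) =
  mmul (ein (e_of l)) (ein (dual_Ind lambda)).
Proof.
rewrite /N /= !(jones_sqr_l HS HM (erefl _)).
by rewrite p_dual_e_sqr.
Qed.

Lemma p_dual_jones_unhat : mmul (mmul (ein (e_of l)) (phin (e_of lambda))) (ein (e_of l)) =
  ein (e_of l).
Proof.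
have [lL lambdaL] := p_dual_pair_integrals.
have [lambdaF lF] := p_dual_pair_faithful.
have [h [k [[hh eE] kR ks kk kroot]]] := p_dual_pair_root.
have Ek : dual_act lambda (k * h * k) = 1 by rewrite -eE; case: ll.
apply: (jones_unhat HS HM eE kR (c0 := star (antipode k) * antipode k * h * k)).
  by rewrite eE; apply: (pair_e_act HS hh kR ks).
exact: (pair_e_lambda_c0 HS lambdaL hh kR ks kk Ek lambdaF lF kroot).
Qed.

End Pair.
End PDual.

Section PDualJones.
Variables (R : realType) (A : preWeakHopfType R).
Hypothesis HS : weak_star_hopf A.
Let DHS := weak_star_hopf_dual HS.
Variables (l : A) (lambda : dual A).
Hypothesis ll : p_dual_pair l lambda.
Let dd := p_dual_pair_dual HS ll.
Variable M : modAlg A.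
Hypothesis HM : unstarred_module_algebra M.
Let MA := crossed_product M.
Let N := crossed_product MA.
Let ein (a : A) : N := (mone M ⋊ a : MA) ⋊ (1 : dual A).
Let phin (phi : dual A) : N := (mone M ⋊ (1 : A) : MA) ⋊ phi.

Lemma p_dual_jones_dual_sqr : mmul (phin (e_of lambda)) (phin (e_of lambda)) =
  mmul (phin (e_of lambda)) (phin (Ind l)).
Proof.
rewrite /N /= !(jones_sqr_r HS HM (erefl _)).
by rewrite (p_dual_e_sqr DHS dd) Ind_bidual.
Qed.

(** The dual pair supplies e_lambda = kappa hd kappa, and [pair_l] read in the dual gives lambda =
    hd kappa kappa. *)
Lemma p_dual_jones_hat : mmul (mmul (phin (e_of lambda)) (ein (e_of l))) (phin (e_of lambda)) =
  phin (e_of lambda).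
Proof.
have [lambdaL _] := p_dual_pair_integrals dd.
have [h [k [[hh eE] kR _ kk _]]] := p_dual_pair_root DHS dd.
apply: (jones_hat HS HM hh kR eE (pair_l DHS lambdaL hh kk)).
by case: ll.
Qed.

End PDualJones.

Theorem theorem3p3p4 (R : realType) (A : weakCstarHopfType R) (l : A)
    (lambda : dual A) :
  positive_integral l -> nondegenerate_integral l -> is_p_dual l lambda ->
  [/\ is_p_dual lambda (bidual l),
      [/\ positive_element (Ind l), Ind l \is a GRing.unit, Ind l = n_R lambda,
          n_R lambda \in 'Z({:dual A})%VS & right_subalg (n_R lambda)],
      [/\ positive_element (dual_Ind lambda), dual_Ind lambda \is a GRing.unit,
          dual_Ind lambda = n_R l, n_R l \in 'Z({:A})%VS
        & right_subalg (n_R l)]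
    & forall M : modAlg A, is_module_algebra M ->
      let MA := crossed_product M in
      let N := crossed_product MA in
      let e : N := ((mone M ⋊ e_of l : MA) ⋊ (1 : dual A)) in
      let ehat : N := ((mone M ⋊ (1 : A) : MA) ⋊ e_of lambda) in
      let indl : N := ((mone M ⋊ (1 : A) : MA) ⋊ Ind l) in
      let indlambda : N := ((mone M ⋊ dual_Ind lambda : MA) ⋊ (1 : dual A)) in
      [/\ mmul e e = mmul e indlambda,
          mmul ehat ehat = mmul ehat indl,
          mmul (mmul ehat e) ehat = ehat
        & mmul (mmul e ehat) e = e]].
Proof.
move=> l0 lN [[lambda0 lambdaN lambda1] _].
have HS := weakCstarHopf_weak_star A; have DHS := weak_star_hopf_dual HS.
have ll : p_dual_pair l lambda by [].
split; first exact: (p_dual_bidual HS ll).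
- rewrite Ind_bidual; exact: (p_dual_index DHS (p_dual_pair_dual HS ll)).
- exact: (p_dual_index HS ll).
move=> M /(module_algebra_unstarred (wshW HS)) HM MA N; split.
- exact: (p_dual_jones_sqr HS ll HM).
- exact: (p_dual_jones_dual_sqr HS ll HM).
- exact: (p_dual_jones_hat HS ll HM).
- exact: (p_dual_jones_unhat HS ll HM).
Qed.
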